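(* There exists an $O(\log^2 n)$-competitive deterministic online algorithm for node-weighted Steiner forest with delay which runs in polynomial time, where $n$ is the number of vertices of the input graph.
   Context: Node-weighted Steiner forest with delay: given in advance a graph $G=(V,E)$ with $|V|=n$ and vertex costs $c:V\to\mathbb{R}^+$. Requests arrive over time; each request $q$ is a pair of vertices $(u_1,u_2)$, released at time $r_q$ with a continuous, monotone non-decreasing delay function $d_q(t)$ tending to infinity, revealed at release. At any time the algorithm may transmit a vertex set $V'\subseteq V$ at cost $\sum_{v\in V'}c(v)$; this serves every pending request $(u_1,u_2)$ such that $u_1,u_2$ are in the same connected component of the subgraph induced by $V'$. The cost is the total transmission cost plus, for each request $q$, the delay $d_q(t_q)$ accumulated until its service time $t_q$. An online algorithm is $\alpha$-competitive if on every input its cost is at most $\alpha$ times the optimal offline cost. *)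

(* Defs.v *)
From HB Require Import structures.
From mathcomp Require Import all_boot all_order all_algebra.
From mathcomp Require Import all_classical all_reals all_analysis.

Set Implicit Arguments.
Unset Strict Implicit.
Unset Printing Implicit Defensive.

Import Order.TTheory GRing.Theory Num.Theory.
Import numFieldNormedType.Exports.

Local Open Scope classical_set_scope.
Local Open Scope ring_scope.

Record wgraph (R : realType) (n : nat) := WGraph {
  adj : rel 'I_n;
  adj_sym : symmetric adj;
  adj_irr : irreflexive adj;
  vcost : 'I_n -> R;
  vcost_gt0 : forall v, 0 < vcost v }.

(* Only the restriction of [delay] to [release, +oo[ is meaningful. *)
Record request (R : realType) (n : nat) := Request {
  endp1 : 'I_n;
  endp2 : 'I_n;
  release : R;
  delay : R -> R;
  delay_ge0 : 0 <= delay release;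
  delay_cont : {within `[release, +oo[, continuous delay};
  delay_homo : {in `[release, +oo[ &, {homo delay : s t / s <= t}};
  delay_infty : delay t @[t --> +oo] --> +oo }.

Definition in_order (R : realType) (n : nat) : rel (request R n) :=
  fun q q' => release q <= release q'.

Definition schedule (R : realType) (n : nat) : Type := seq (R * {set 'I_n}).

Section Cost.
Variables (R : realType) (n : nat) (G : wgraph R n).
Implicit Types (X : {set 'I_n}) (q : request R n) (S : schedule R n).

Definition induced X : rel 'I_n :=
  [rel u v | [&& u \in X, v \in X & adj G u v]].

Definition same_component X (u v : 'I_n) : bool :=
  [&& u \in X, v \in X & connect (induced X) u v].

Definition serves (tr : R * {set 'I_n}) q : bool :=
  (release q <= tr.1) && same_component tr.2 (endp1 q) (endp2 q).

Definition service_time S q : \bar R :=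
  \big[mine/+oo%E]_(tr <- S | serves tr q) tr.1%:E.

Definition delay_cost S q : \bar R :=
  if service_time S q is EFin t then (delay q t)%:E else +oo%E.

Definition transmission_cost S : R :=
  \sum_(tr <- S) \sum_(v in tr.2) vcost G v.

Definition total_cost (Q : seq (request R n)) S : \bar R :=
  ((transmission_cost S)%:E + \sum_(q <- Q) delay_cost S q)%E.

Definition opt (Q : seq (request R n)) : \bar R :=
  ereal_inf [set total_cost Q S | S in [set: schedule R n]].

End Cost.

(* An algorithm is a program of a unit-cost real random-access machine with   *)
(* an integer memory and a real memory.  Real arithmetic is + - * / and       *)
(* comparison, without floor; integer arithmetic is + and truncated -, so     *)
(* after k steps integers have O(k) bits more than the input.  The syntax     *)
(* does not mention R: the only constants available are natural numbers.      *)
(* The program is run at each arrival and each alarm, keeping its memory.     *)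

Inductive nexpr : Type :=
| NLit of nat
| NLoad of nexpr
| NAdd of nexpr & nexpr
| NSub of nexpr & nexpr
| NVertices
| NReleased
| NEndp1 of nexpr
| NEndp2 of nexpr.

Inductive rexpr : Type :=
| RNat of nexpr
| RLoad of nexpr
| RAdd of rexpr & rexpr
| RSub of rexpr & rexpr
| RMul of rexpr & rexpr
| RDiv of rexpr & rexpr
| RNow
| RCost of nexpr
| RRelease of nexpr
| RDelay of nexpr & rexpr
| RReach of nexpr & rexpr.

Inductive bexpr : Type :=
| BLeN of nexpr & nexpr
| BLeR of rexpr & rexpr
| BAdj of nexpr & nexpr
| BNot of bexpr
| BAnd of bexpr & bexpr.

Inductive cmd : Type :=
| CSkip
| CStoreN of nexpr & nexpr
| CStoreR of nexpr & rexpr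
| CSeq of cmd & cmd
| CIf of bexpr & cmd & cmd
| CWhile of bexpr & cmd
| CTransmit of nexpr
| CAlarm of rexpr.

Record state (R : realType) (n : nat) := State {
  nmem : nat -> nat;
  rmem : nat -> R;
  alarm : option R;
  outbox : seq {set 'I_n} }.

Section Machine.
Variables (R : realType) (n : nat) (G : wgraph R n).
Implicit Types (Q : seq (request R n)) (q : request R n) (st : state R n).

(* The two queries to the delay function of a released request: its value at  *)
(* a time, and the earliest time at which it reaches a value.  Both may       *)
(* concern the future, the whole function being revealed at the release.      *)
Definition delay_at q (t : R) : R := delay q (Num.max (release q) t).

Definition reach_time q (x : R) : R :=
  inf [set t | release q <= t /\ x <= delay q t].

Definition storeN st (a k : nat) : state R n :=
  State [eta nmem st with a |-> k] (rmem st) (alarm st) (outbox st).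

Definition storeR st (a : nat) (x : R) : state R n :=
  State (nmem st) [eta rmem st with a |-> x] (alarm st) (outbox st).

Definition set_alarm st (s : R) : state R n :=
  State (nmem st) (rmem st) (Some s) (outbox st).

(* The set to transmit is given by n consecutive integer flags in memory. *)
Definition transmit st (a : nat) : state R n :=
  State (nmem st) (rmem st) (alarm st)
    (rcons (outbox st) [set v : 'I_n | nmem st (a + v) != 0%N]%SET).

Definition wake st : state R n := State (nmem st) (rmem st) None [::].

Definition init_state : state R n := State (fun=> 0%N) (fun=> 0) None [::].

(* The index i refers to the i-th request released so far, in order of        *)
(* arrival; the evaluators see no other request.  Queries on an index out of  *)
(* range return 0 (or false).                                                 *)
Section Eval.
Variables (Q : seq (request R n)) (now : R).

Definition vertex (i : nat) : option 'I_n := insub i.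

Fixpoint evalN st (e : nexpr) : nat :=
  match e with
  | NLit k => k
  | NLoad a => nmem st (evalN st a)
  | NAdd e1 e2 => evalN st e1 + evalN st e2
  | NSub e1 e2 => evalN st e1 - evalN st e2
  | NVertices => n
  | NReleased => size Q
  | NEndp1 i => oapp (fun q => nat_of_ord (endp1 q)) 0%N (onth Q (evalN st i))
  | NEndp2 i => oapp (fun q => nat_of_ord (endp2 q)) 0%N (onth Q (evalN st i))
  end%N.

Fixpoint evalR st (e : rexpr) : R :=
  match e with
  | RNat k => (evalN st k)%:R
  | RLoad a => rmem st (evalN st a)
  | RAdd e1 e2 => evalR st e1 + evalR st e2
  | RSub e1 e2 => evalR st e1 - evalR st e2
  | RMul e1 e2 => evalR st e1 * evalR st e2
  | RDiv e1 e2 => evalR st e1 / evalR st e2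
  | RNow => now
  | RCost i => oapp (vcost G) 0 (vertex (evalN st i))
  | RRelease i => oapp (@release R n) 0 (onth Q (evalN st i))
  | RDelay i t => oapp (delay_at ^~ (evalR st t)) 0 (onth Q (evalN st i))
  | RReach i x => oapp (reach_time ^~ (evalR st x)) 0 (onth Q (evalN st i))
  end.

Fixpoint evalB st (e : bexpr) : bool :=
  match e with
  | BLeN e1 e2 => (evalN st e1 <= evalN st e2)%N
  | BLeR e1 e2 => evalR st e1 <= evalR st e2
  | BAdj i j =>
      if (vertex (evalN st i), vertex (evalN st j)) is (Some u, Some v)
      then adj G u v else false
  | BNot b => ~~ evalB st b
  | BAnd b1 b2 => evalB st b1 && evalB st b2
  end.

(* [exec st c st' k]: from st, c terminates in st' after k steps.  An         *)
(* expression costs O(1), its size being bounded by that of the program.      *)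
(* Alarms cannot be set in the past.                                          *)
Inductive exec : state R n -> cmd -> state R n -> nat -> Prop :=
| ExecSkip st : exec st CSkip st 1
| ExecStoreN st a e :
    exec st (CStoreN a e) (storeN st (evalN st a) (evalN st e)) 1
| ExecStoreR st a e :
    exec st (CStoreR a e) (storeR st (evalN st a) (evalR st e)) 1
| ExecSeq st1 st2 st3 c1 c2 k1 k2 :
    exec st1 c1 st2 k1 -> exec st2 c2 st3 k2 ->
    exec st1 (CSeq c1 c2) st3 (k1 + k2).+1
| ExecIf st st' b c1 c2 k :
    exec st (if evalB st b then c1 else c2) st' k ->
    exec st (CIf b c1 c2) st' k.+1
| ExecWhileFalse st b c :
    ~~ evalB st b -> exec st (CWhile b c) st 1
| ExecWhileTrue st1 st2 st3 b c k1 k2 :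
    evalB st1 b -> exec st1 c st2 k1 -> exec st2 (CWhile b c) st3 k2 ->
    exec st1 (CWhile b c) st3 (k1 + k2).+1
| ExecTransmit st a :
    exec st (CTransmit a) (transmit st (evalN st a)) n.+1
| ExecAlarm st t :
    exec st (CAlarm t) (set_alarm st (Num.max now (evalR st t))) 1.

End Eval.

Definition stamp (t : R) (xs : seq {set 'I_n}) : schedule R n :=
  [seq (t, X) | X <- xs].

(* [run P past future st S k]: with the requests in past released and those   *)
(* in future still to come, P transmits S and becomes idle, all requests      *)
(* being released, after k steps.  An arrival precedes an alarm set for the   *)
(* same time, and cancels the alarm; so does an alarm going off.              *)
Inductive run (P : cmd) : seq (request R n) -> seq (request R n) ->
    state R n -> schedule R n -> nat -> Prop :=
| RunIdle past st : alarm st = None -> run P past [::] st [::] 0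
| RunArrival past q future st st' S k1 k2 :
    (if alarm st is Some s then release q <= s else true) ->
    exec (rcons past q) (release q) (wake st) P st' k1 ->
    run P (rcons past q) future st' S k2 ->
    run P past (q :: future) st
      (stamp (release q) (outbox st') ++ S) (k1 + k2)
| RunAlarm past future st st' s S k1 k2 :
    alarm st = Some s ->
    (if future is q :: _ then s < release q else true) ->
    exec past s (wake st) P st' k1 ->
    run P past future st' S k2 ->
    run P past future st (stamp s (outbox st') ++ S) (k1 + k2).

Definition online_run (P : cmd) Q (S : schedule R n) (k : nat) : Prop :=
  run P [::] Q init_state S k.

Lemma exec_det Q now st c st1 k1 st2 k2 :
  exec Q now st c st1 k1 -> exec Q now st c st2 k2 -> st1 = st2 /\ k1 = k2.
Proof.
move=> ex1; elim: ex1 st2 k2 => {st c st1 k1}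
  [st|st a e|st a e|a1 a2 a3 c1 c2 k1 k2 _ IH1 _ IH2|st st' b c1 c2 k _ IH
  |st b c nb|a1 a2 a3 b c k1 k2 tb _ IH1 _ IH2|st a|st t] st2 l ex2;
  inversion ex2 as [| | |? t2 ? ? ? l1 l2 x1 x2|? ? ? ? ? l1 x1|? ? ? x1
                   |? t2 ? ? ? l1 l2 x1 x2 x3| |]; subst => //.
- by have [? ?] := IH1 _ _ x1; subst; have [? ?] := IH2 _ _ x2; subst.
- by have [? ?] := IH _ _ x1; subst.
- by rewrite x1 in nb.
- by rewrite tb in x1.
- by have [? ?] := IH1 _ _ x2; subst; have [? ?] := IH2 _ _ x3; subst.
Qed.

Lemma run_det P past future st S1 k1 S2 k2 :
  run P past future st S1 k1 -> run P past future st S2 k2 ->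
  S1 = S2 /\ k1 = k2.
Proof.
move=> r1; elim: r1 S2 k2 => {past future st S1 k1}
  [past st na|past q future st st' S k1 k2 le_qs ex _ IH
  |past future st st' s S k1 k2 al lt_sq ex _ IH] S2 l r2;
  inversion r2 as [? ? y1|? ? ? ? t' T l1 l2 y1 y2 y3
                  |? ? ? t' s' T l1 l2 y1 y2 y3 y4]; subst => //.
- by rewrite na in y1.
- by have [? ?] := exec_det ex y2; subst; have [? ?] := IH _ _ y3; subst.
- by move: le_qs; rewrite y1 leNgt y2.
- by rewrite al in y1.
- by move: y1; rewrite al leNgt lt_sq.
- move: y1; rewrite al => -[?]; subst.
  by have [? ?] := exec_det ex y3; subst; have [? ?] := IH _ _ y4; subst.
Qed.

End Machine.

Definition competitive (R : realType) (P : cmd) (alpha : nat -> R) : Prop :=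
  forall (n : nat) (G : wgraph R n) (Q : seq (request R n)),
    sorted (@in_order R n) Q ->
    exists (S : schedule R n) (k : nat), online_run G P Q S k /\
      (total_cost G Q S <= (alpha n)%:E * opt G Q)%E.

(* The size of an instance is its number of vertices plus its number of       *)
(* requests, and k counts all the steps over the whole run.                   *)
Definition polynomial_time (R : realType) (P : cmd) : Prop :=
  exists p : {poly nat},
    forall (n : nat) (G : wgraph R n) (Q : seq (request R n)),
      sorted (@in_order R n) Q ->
      exists (S : schedule R n) (k : nat), online_run G P Q S k /\
        (k <= p.[n + size Q])%N.

(* Main.v *)
Require Import Defs.
From mathcomp Require Import all_boot all_order all_algebra.
From mathcomp Require Import all_classical all_reals all_analysis.
From mathcomp Require Import zify ring lra.

(* A pending request has a level [l], and a budget [chain l]; budgets at       *)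
(* least double from a level to the next.  It starts at the first level such  *)
(* that vertices cheaper than the budget connect its two ends.  When the      *)
(* unpaid delay of a level [l] reaches half its budget, the algorithm spends  *)
(* the budget b of level [l + 1]: it buys all vertices of cost below b / 2n   *)
(* and moves forward in time, committing to the future delay of the requests  *)
(* of level at most [l + 1], as long as a prize-collecting Steiner forest in  *)
(* which these future delays are the penalties costs O(b log n).  The prizes  *)
(* rise in steps of b / 2N, and the forest is found by the greedy spider      *)
(* algorithm of Klein and Ravi, whose factor is gam n = 2 + 2 H_n.  What is   *)
(* left unserved moves to level [l + 1].                                      *)
(*                                                                            *)
(* Each service costs O(gam n) times half the budget of its level [l], which  *)
(* is charged to the optimum between the previous service at a level at least *)
(* [l] and this one, vertex costs being truncated at [chain l] and dropped    *)
(* below [chain l / 2n].  A vertex is thus charged by O(log n) levels up to   *)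
(* a geometric sum, hence O(log n) times its cost, and delays are charged     *)
(* once.                                                                      *)
(*                                                                            *)
(* The machine cannot multiply integers, so a table of the multiples of n is  *)
(* needed to address matrices.                                                *)

Set Implicit Arguments.
Unset Strict Implicit.
Unset Printing Implicit Defensive.

Import Order.TTheory GRing.Theory Num.Theory.
Import numFieldNormedType.Exports.

Local Open Scope ring_scope.

(** * A structured language compiled to the machine *)

(** The cost of the algorithm is measured in half budgets: a service at level [l] costs [O(gam n)]
    times [chain l / 2], and each half budget is charged to what an arbitrary offline schedule did
    since the last service at a level at least [l].

    Offline side. Unless a service at level [l] serves everything it looked at, it leaves a
    certificate to level [l.+1]: a time up to which no solution, buying vertices and paying delay,
    could have handled these requests for [chain l.+1] or less. When a level becomes critical,
    [charge_key] finds half a budget in the offline schedule: it met the certificate, or it bought a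
    heavy vertex, or it paid the same delay. [charge] makes this a step of the potential inequality
    in [ginv]. In the end ([wt_bound]) a vertex is charged at most [lg n + 3] times its cost,
    because a level only sees costs truncated to its own scale ([trc_sum]), while delays are charged
    in disjoint segments, hence once.

    Online side. By [serv_cost] a service costs at most [4 * (gam R n + 3)] half budgets: the unpaid
    delays of the lower levels form a geometric sum, and the forest bought is within the factor
    [gam] of every prize-collecting solution ([pc_spec]). The forest is built greedily, by buying
    the cheapest spider or giving up the cheapest component. Weak duality ([spider_lb]) bounds the
    price of a step by any solution's cost over the number of components, and these prices sum to a
    harmonic number. The product of the two logarithmic factors is [competitive_ratio].

    Computation. The algorithm is written in a language with bounded loops only, so the time of one
    event is polynomial by syntax ([tm_poly]), and it is verified on a denotation that the machine
    simulates ([sim_den]). Continuous time is crossed by jumps to the next moment at which some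
    request has gained a fixed fraction of a budget, a progress measure bounding their number. The
    number of events is polynomial because each service removes a request or raises its level, and
    only polynomially many levels can be served ([lev_Lm], [lives_serv]). [run_ledger] joins
    everything in one induction, which builds the run, counts its steps and compares its cost with
    every offline schedule. *)

Inductive hn : Type :=
| HLit of nat
| HGet of nat & hn
| HAdd of hn & hn
| HSub of hn & hn
| HV
| HQ
| HE1 of hn
| HE2 of hn
| HRow of hn.

Inductive hr : Type :=
| HNat of hn
| HGetR of nat & hn
| HAddR of hr & hr
| HSubR of hr & hr
| HMulR of hr & hr
| HDivR of hr & hr
| HNow
| HCost of hn
| HDelay of hn & hr
| HReach of hn & hr.

Inductive hb : Type :=
| HLeN of hn & hn
| HLeR of hr & hr
| HAdj of hn & hn
| HNot of hb
| HAnd of hb & hb.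

(* The bound (a, b, d) of a loop stands for a n + b N + d, for n vertices and *)
(* N released requests.                                                       *)
Inductive prog : Type :=
| PSkip
| PN of nat & hn & hn
| PR of nat & hn & hr
| PSeq of prog & prog
| PIf of hb & prog & prog
| PFor of nat & nat * nat * nat & prog
| PTransmit of nat
| PAlarm of hr.

Fixpoint wN (p : prog) : seq nat :=
  match p with
  | PN k _ _ => [:: k]
  | PSeq p1 p2 | PIf _ p1 p2 => wN p1 ++ wN p2
  | PFor x _ p => x :: wN p
  | _ => [::]
  end.

Fixpoint wR (p : prog) : seq nat :=
  match p with
  | PR k _ _ => [:: k]
  | PSeq p1 p2 | PIf _ p1 p2 => wR p1 ++ wR p2
  | PFor x _ p => wR p
  | _ => [::]
  end.

Fixpoint pure (p : prog) : bool :=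
  match p with
  | PSeq p1 p2 | PIf _ p1 p2 => pure p1 && pure p2
  | PFor x _ p => pure p
  | PTransmit _ | PAlarm _ => false
  | _ => true
  end.

Fixpoint okN (r : bool) (e : hn) : bool :=
  match e with
  | HGet k e => (k < 63)%N && okN r e
  | HAdd e1 e2 | HSub e1 e2 => okN r e1 && okN r e2
  | HE1 e | HE2 e => okN r e
  | HRow e => r && okN r e
  | _ => true
  end.

Fixpoint okR (r : bool) (e : hr) : bool :=
  match e with
  | HNat e | HCost e => okN r e
  | HGetR k e => (k < 64)%N && okN r e
  | HAddR e1 e2 | HSubR e1 e2 | HMulR e1 e2 | HDivR e1 e2 => okR r e1 && okR r e2
  | HDelay i e | HReach i e => okN r i && okR r e
  | HNow => true
  end.

Fixpoint okB (r : bool) (e : hb) : bool :=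
  match e with
  | HLeN e1 e2 | HAdj e1 e2 => okN r e1 && okN r e2
  | HLeR e1 e2 => okR r e1 && okR r e2
  | HNot b => okB r b
  | HAnd b1 b2 => okB r b1 && okB r b2
  end.

(* When [r] holds, rows may be used but the row table, array 0, not written. *)
Fixpoint okP (r : bool) (p : prog) : bool :=
  match p with
  | PSkip => true
  | PN k i e => [&& (k < 63)%N, r ==> (k != 0)%N, okN r i & okN r e]
  | PR k i e => [&& (k < 64)%N, okN r i & okR r e]
  | PSeq p1 p2 => okP r p1 && okP r p2
  | PIf b p1 p2 => [&& okB r b, okP r p1 & okP r p2]
  | PFor x b p => [&& (x < 63)%N, r ==> (x != 0)%N, x \notin wN p & okP r p]
  | PTransmit k => (k < 63)%N
  | PAlarm e => okR r e
  end.

Section Syntax.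

Definition m64 (e : nexpr) : nexpr := iter 6 (fun e => NAdd e e) e.
(* Entry [e] of array [k]; the first n cells hold the flags of a transmission. *)
Definition ad (k : nat) (e : nexpr) : nexpr :=
  NAdd NVertices (NAdd (m64 e) (NLit k)).

Fixpoint cN (e : hn) : nexpr :=
  match e with
  | HLit k => NLit k
  | HGet k e => NLoad (ad k (cN e))
  | HAdd e1 e2 => NAdd (cN e1) (cN e2)
  | HSub e1 e2 => NSub (cN e1) (cN e2)
  | HV => NVertices
  | HQ => NReleased
  | HE1 e => NEndp1 (cN e)
  | HE2 e => NEndp2 (cN e)
  | HRow e => NLoad (ad 0 (cN e))
  end.

Fixpoint cR (e : hr) : rexpr :=
  match e with
  | HNat e => RNat (cN e)
  | HGetR k e => RLoad (ad k (cN e))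
  | HAddR e1 e2 => RAdd (cR e1) (cR e2)
  | HSubR e1 e2 => RSub (cR e1) (cR e2)
  | HMulR e1 e2 => RMul (cR e1) (cR e2)
  | HDivR e1 e2 => RDiv (cR e1) (cR e2)
  | HNow => RNow
  | HCost e => RCost (cN e)
  | HDelay i e => RDelay (cN i) (cR e)
  | HReach i e => RReach (cN i) (cR e)
  end.

Fixpoint cB (e : hb) : bexpr :=
  match e with
  | HLeN e1 e2 => BLeN (cN e1) (cN e2)
  | HLeR e1 e2 => BLeR (cR e1) (cR e2)
  | HAdj e1 e2 => BAdj (cN e1) (cN e2)
  | HNot b => BNot (cB b)
  | HAnd b1 b2 => BAnd (cB b1) (cB b2)
  end.

Definition cbnd (b : nat * nat * nat) : nexpr :=
  NAdd (iter b.1.1 (NAdd NVertices) (NLit 0))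
    (NAdd (iter b.1.2 (NAdd NReleased) (NLit 0)) (NLit b.2)).

Definition cfor (k : nat) (bd : nexpr) (c : cmd) : cmd :=
  CSeq (CStoreN (ad k (NLit 0)) (NLit 0))
    (CWhile (BLeN (NAdd (NLoad (ad k (NLit 0))) (NLit 1)) bd)
      (CSeq c (CStoreN (ad k (NLit 0)) (NAdd (NLoad (ad k (NLit 0))) (NLit 1))))).

Fixpoint cP (p : prog) : cmd :=
  match p with
  | PSkip => CSkip
  | PN k i e => CStoreN (ad k (cN i)) (cN e)
  | PR k i e => CStoreR (ad k (cN i)) (cR e)
  | PSeq p1 p2 => CSeq (cP p1) (cP p2)
  | PIf b p1 p2 => CIf (cB b) (cP p1) (cP p2)
  | PFor x b p => cfor x (cbnd b) (cP p)
  | PTransmit k =>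
      CSeq (cfor 63 NVertices
        (CStoreN (NLoad (ad 63 (NLit 0))) (NLoad (ad k (NLoad (ad 63 (NLit 0)))))))
        (CTransmit (NLit 0))
  | PAlarm e => CAlarm (cR e)
  end.

(* Bounds the number of steps when [m] is positive and at least the numbers   *)
(* of vertices and of released requests.                                      *)
Fixpoint tm (p : prog) (m : nat) : nat :=
  match p with
  | PSeq p1 p2 => (tm p1 m + tm p2 m).+1
  | PIf _ p1 p2 => (tm p1 m + tm p2 m).+1
  | PFor _ b p => ((b.1.1 + b.1.2 + b.2) * m * (tm p m + 3) + 3)%N
  | PTransmit _ => (m * 5 + 10)%N
  | _ => 1%N
  end.

(** A loop multiplies the time by a linear bound, hence raises the degree by one, and the nesting
    depth is fixed by the syntax. *)
Lemma tm_poly (p : prog) : exists C d, forall m, (0 < m)%N -> (tm p m <= C * m ^ d)%N.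
Proof.
elim: p => [|k i e|k i e|p1 [C1 [d1 H1]] p2 [C2 [d2 H2]]
  |b p1 [C1 [d1 H1]] p2 [C2 [d2 H2]]|x b p [C [d H]]|k|e];
  try by exists 1%N, 0%N => m _; rewrite expn0.
- exists (C1 + C2 + 1)%N, (d1 + d2)%N => m m0 /=.
  move: (H1 m m0) (H2 m m0); rewrite expnD.
  by have := expn_gt0 m d1; have := expn_gt0 m d2; rewrite m0 /=; nia.
- exists (C1 + C2 + 1)%N, (d1 + d2)%N => m m0 /=.
  move: (H1 m m0) (H2 m m0); rewrite expnD.
  by have := expn_gt0 m d1; have := expn_gt0 m d2; rewrite m0 /=; nia.
- exists ((b.1.1 + b.1.2 + b.2) * (C + 3) + 3)%N, d.+1 => m m0 /=.
  move: (H m m0); have := expn_gt0 m d; rewrite m0 /= expnS.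
  move: (b.1.1 + b.1.2 + b.2)%N (tm p m) (m ^ d)%N => B t D D0 le.
  apply: (@leq_trans (B * m * (C * D + 3 * D) + 3 * (m * D))).
    by rewrite leq_add ?leq_mul2l ?leq_add ?leq_pmulr ?orbT // muln_gt0 m0.
  by rewrite leq_eqVlt; apply/orP; left; apply/eqP; ring.
- by exists 15%N, 1%N => m m0 /=; lia.
Qed.

End Syntax.

(** * Denotation of programs, and its simulation by the machine *)

Section Lang.
Variables (R : realType) (n : nat) (G : wgraph R n).

Record hstate := HState {
  na : nat -> nat -> nat;
  ra : nat -> nat -> R;
  al : option R;
  ob : seq {set 'I_n} }.

Definition setN (s : hstate) (k i x : nat) : hstate :=
  HState (fun k' => if k' == k then (fun i' => if i' == i then x else na s k i') else na s k')
    (ra s) (al s) (ob s).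

Definition setR (s : hstate) (k i : nat) (x : R) : hstate :=
  HState (na s) (fun k' => if k' == k then (fun i' => if i' == i then x else ra s k i') else ra s k')
    (al s) (ob s).

(** The table has [n * n] entries because an address with three indices, [(a * n + v) * n + x],
    takes the row of a number of the form [a * n + v]. *)
Definition tab (s : hstate) : Prop := forall i, (i < n * n)%N -> na s 0 i = (i * n)%N.

Section Eval.
Variables (Q : seq (request R n)) (now : R).
Implicit Types (s : hstate).

Definition ep1 (i : nat) : nat := oapp (fun q => nat_of_ord (endp1 q)) 0%N (onth Q i).
Definition ep2 (i : nat) : nat := oapp (fun q => nat_of_ord (endp2 q)) 0%N (onth Q i).
Definition dl (i : nat) (t : R) : R := oapp (fun q => delay_at q t) 0 (onth Q i).
Definition rch (i : nat) (x : R) : R := oapp (fun q => reach_time q x) 0 (onth Q i).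
Definition vc (v : nat) : R := oapp (vcost G) 0 (vertex n v).
Definition adjn (u v : nat) : bool :=
  if (vertex n u, vertex n v) is (Some u, Some v) then adj G u v else false.

(** Beyond the table, [HRow] denotes whatever array 0 holds there, so that the denotation agrees
    with the machine on every index. *)
Fixpoint eN s (e : hn) : nat :=
  match e with
  | HLit k => k
  | HGet k e => na s k (eN s e)
  | HAdd e1 e2 => eN s e1 + eN s e2
  | HSub e1 e2 => eN s e1 - eN s e2
  | HV => n
  | HQ => size Q
  | HE1 i => ep1 (eN s i)
  | HE2 i => ep2 (eN s i)
  | HRow e => if (eN s e < n * n)%N then eN s e * n else na s 0 (eN s e)
  end%N.

Fixpoint eR s (e : hr) : R :=
  match e with
  | HNat e => (eN s e)%:R
  | HGetR k e => ra s k (eN s e)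
  | HAddR e1 e2 => eR s e1 + eR s e2
  | HSubR e1 e2 => eR s e1 - eR s e2
  | HMulR e1 e2 => eR s e1 * eR s e2
  | HDivR e1 e2 => eR s e1 / eR s e2
  | HNow => now
  | HCost i => vc (eN s i)
  | HDelay i e => dl (eN s i) (eR s e)
  | HReach i e => rch (eN s i) (eR s e)
  end.

Fixpoint eB s (e : hb) : bool :=
  match e with
  | HLeN e1 e2 => (eN s e1 <= eN s e2)%N
  | HLeR e1 e2 => eR s e1 <= eR s e2
  | HAdj i j => adjn (eN s i) (eN s j)
  | HNot b => ~~ eB s b
  | HAnd b1 b2 => eB s b1 && eB s b2
  end.

Definition bnd (b : nat * nat * nat) : nat := (b.1.1 * n + b.1.2 * size Q + b.2)%N.

Fixpoint loop (x : nat) (f : hstate -> hstate) (m : nat) (s : hstate) : hstate :=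
  if m is m'.+1 then f (setN (loop x f m' s) x 0 m') else s.

Fixpoint den (p : prog) s : hstate :=
  match p with
  | PSkip => s
  | PN k i e => setN s k (eN s i) (eN s e)
  | PR k i e => setR s k (eN s i) (eR s e)
  | PSeq p1 p2 => den p2 (den p1 s)
  | PIf b p1 p2 => if eB s b then den p1 s else den p2 s
  | PFor x b p => setN (loop x (den p) (bnd b) s) x 0 (bnd b)
  | PTransmit k =>
      HState (na s) (ra s) (al s) (rcons (ob s) [set v : 'I_n | na s k v != 0%N]%SET)
  | PAlarm e => HState (na s) (ra s) (Some (Num.max now (eR s e))) (ob s)
  end.

(** A frame condition at the granularity of whole arrays: that a program preserves an array then
    reduces to a computed non-membership. *)
Definition fr (p : prog) s s' : Prop :=
  [/\ forall k, k \notin wN p -> na s' k = na s k,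
      forall k, k \notin wR p -> ra s' k = ra s k &
      pure p -> al s' = al s /\ ob s' = ob s].

Lemma fr_trans p s1 s2 s3 : fr p s1 s2 -> fr p s2 s3 -> fr p s1 s3.
Proof.
move=> [a1 b1 c1] [a2 b2 c2]; split=> [k wk|k wk|pp].
- by rewrite a2 ?a1.
- by rewrite b2 ?b1.
- by have [-> ->] := c2 pp; have [-> ->] := c1 pp.
Qed.

Lemma fr_weak p p' s s' : {subset wN p <= wN p'} -> {subset wR p <= wR p'} ->
  (pure p' -> pure p) -> fr p s s' -> fr p' s s'.
Proof.
move=> sN sR pu [a b c]; split=> [k wk|k wk|pp]; last exact/c/pu.
- by apply: a; apply: contra wk => /sN.
- by apply: b; apply: contra wk => /sR.
Qed.

Lemma fr_setN p s k i x : k \in wN p -> fr p s (setN s k i x).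
Proof.
move=> kp; split=> // k' wk /=; case: eqP => // e.
by rewrite e kp in wk.
Qed.

Lemma den_fr p s : fr p s (den p s).
Proof.
elim: p s => [|k i e|k i e|p1 IH1 p2 IH2|b p1 IH1 p2 IH2|x b p IH|k|e] s //=.
- by apply: fr_setN; rewrite inE.
- by split=> // k' /=; rewrite inE; case: eqP.
- apply: (@fr_trans _ _ (den p1 s)).
    apply: fr_weak (IH1 s) => /= [k|k|/andP[]//]; rewrite mem_cat => ->//.
  by apply: fr_weak (IH2 _) => /= [k|k|/andP[]//]; rewrite mem_cat => ->; rewrite orbT.
- case: ifP => _.
    apply: fr_weak (IH1 s) => /= [k|k|/andP[]//]; rewrite mem_cat => ->//.
  by apply: fr_weak (IH2 _) => /= [k|k|/andP[]//]; rewrite mem_cat => ->; rewrite orbT.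
- apply: fr_trans (fr_setN _ _ _ _); last by rewrite /= inE eqxx.
  elim: (bnd b) => [|m IHm] //=.
  apply: fr_trans IHm _; apply: (fr_trans (@fr_setN (PFor x b p) _ x 0 m _)); first by rewrite /= inE eqxx.
  by apply: fr_weak (IH _) => //= k kw; rewrite inE kw orbT.
Qed.

(** The loop rule behind all specifications: the frame comes for free, so an invariant need only
    speak of the arrays that the loop writes. *)
Lemma for_ind (I : nat -> hstate -> Prop) (J : hstate -> Prop) x b p s :
  I 0%N s ->
  (forall i s1, (i < bnd b)%N -> fr (PFor x b p) s s1 -> I i s1 ->
     I i.+1 (den p (setN s1 x 0 i))) ->
  (forall s1, fr (PFor x b p) s s1 -> I (bnd b) s1 -> J (setN s1 x 0 (bnd b))) ->
  J (den (PFor x b p) s).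
Proof.
move=> I0 IS IJ /=.
suff H m : (m <= bnd b)%N -> fr (PFor x b p) s (loop x (den p) m s) /\
    I m (loop x (den p) m s) by have [] := H _ (leqnn _); apply: IJ.
elim: m => [|m IHm] // lt; have mb := ltnW lt; split; last first.
  by have [f Im] := IHm mb; apply: IS.
have [f _] := IHm mb => /=.
apply: fr_trans f _; apply: (fr_trans (@fr_setN (PFor x b p) _ x 0 m _)); first by rewrite /= inE eqxx.
by apply: fr_weak (den_fr p _) => //= k kw; rewrite inE kw orbT.
Qed.

End Eval.

(** Two regions of the integer memory are hidden: the first [n] cells, which hold the flags of a
    transmission, and array 63, the counter of the loop that copies them. *)
Definition sim (st : state R n) (s : hstate) : Prop :=
  [/\ forall k i, (k < 63)%N -> nmem st (n + (64 * i + k))%N = na s k i,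
      forall k i, (k < 64)%N -> rmem st (n + (64 * i + k))%N = ra s k i,
      alarm st = al s & outbox st = ob s].

Section Sim.
Variables (Q : seq (request R n)) (now : R).

Lemma ev_ad st k e : evalN Q st (ad k e) = (n + (64 * evalN Q st e + k))%N.
Proof. by rewrite /ad /m64 /=; lia. Qed.
Local Opaque ad.

Definition rowok (r : bool) s := r -> tab s.

Lemma sim_N r st s e : sim st s -> rowok r s -> okN r e ->
  evalN Q st (cN e) = eN Q s e.
Proof.
move=> [sN _ _ _] rk; elim: e => //= [k e IH|e1 IH1 e2 IH2|e1 IH1 e2 IH2|e IH|e IH|e IH].
- by move=> /andP[k31 /IH ie]; rewrite ev_ad ie sN.
- by move=> /andP[/IH1-> /IH2->].
- by move=> /andP[/IH1-> /IH2->].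
- by move=> /IH->.
- by move=> /IH->.
- move=> /andP[rr /IH ie]; rewrite ev_ad ie sN //.
  by case: ifP => // lt; rewrite (rk rr).
Qed.

Lemma sim_R r st s e : sim st s -> rowok r s -> okR r e ->
  evalR G Q now st (cR e) = eR Q now s e.
Proof.
move=> ss rk; have [_ sR _ _] := ss.
elim: e => //= [e|k e|e1 IH1 e2 IH2|e1 IH1 e2 IH2|e1 IH1 e2 IH2|e1 IH1 e2 IH2|e|i e IH|i e IH].
- by move=> /(sim_N ss rk)->.
- by move=> /andP[k32 /(sim_N ss rk) ie]; rewrite ev_ad ie sR.
- by move=> /andP[/IH1-> /IH2->].
- by move=> /andP[/IH1-> /IH2->].
- by move=> /andP[/IH1-> /IH2->].
- by move=> /andP[/IH1-> /IH2->].
- by move=> /(sim_N ss rk)->.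
- by move=> /andP[/(sim_N ss rk)-> /IH->].
- by move=> /andP[/(sim_N ss rk)-> /IH->].
Qed.

Lemma sim_B r st s e : sim st s -> rowok r s -> okB r e ->
  evalB G Q now st (cB e) = eB Q now s e.
Proof.
move=> ss rk; elim: e => //= [e1 e2|e1 e2|e1 e2|e IH|e1 IH1 e2 IH2].
- by move=> /andP[/(sim_N ss rk)-> /(sim_N ss rk)->].
- by move=> /andP[/(sim_R ss rk)-> /(sim_R ss rk)->].
- by move=> /andP[/(sim_N ss rk)-> /(sim_N ss rk)->].
- by move=> /IH->.
- by move=> /andP[/IH1-> /IH2->].
Qed.

Lemma ev_bnd st b : evalN Q st (cbnd b) = bnd Q b.
Proof.
have it e a : evalN Q st (iter a (NAdd e) (NLit 0)) = (a * evalN Q st e)%N.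
  by elim: a => //= a ->; rewrite mulSn.
by rewrite /cbnd /bnd /= !it /= addnA.
Qed.

Lemma sim_setN st s k i x : (k < 63)%N -> sim st s ->
  sim (storeN st (n + (64 * i + k)) x) (setN s k i x).
Proof.
move=> k31 [sN sR sa so]; split=> // k' i' k'31 /=.
rewrite !eqn_add2l; case: eqP => [e|ne].
  have [-> ->] : k' = k /\ i' = i by lia.
  by rewrite !eqxx.
rewrite sN //; case: eqP => // ek /=; case: eqP => [ei|//]; last by rewrite ek.
by case: ne; rewrite ek ei.
Qed.

Lemma sim_setR st s k i x : (k < 64)%N -> sim st s ->
  sim (storeR st (n + (64 * i + k)) x) (setR s k i x).
Proof.
move=> k31 [sN sR sa so]; split=> // k' i' k'31 /=.
rewrite !eqn_add2l; case: eqP => [e|ne].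
  have [-> ->] : k' = k /\ i' = i by lia.
  by rewrite !eqxx.
rewrite sR //; case: eqP => // ek /=; case: eqP => [ei|//]; last by rewrite ek.
by case: ne; rewrite ek ei.
Qed.

Definition ctr (st : state R n) k (x : nat) := nmem st (n + (64 * 0 + k))%N = x.

Lemma exec_for (I : nat -> state R n -> Prop) k bd m c T st :
  (forall st', evalN Q st' bd = m) ->
  I 0%N (storeN st (n + (64 * 0 + k)) 0) ->
  (forall i st', (i < m)%N -> ctr st' k i -> I i st' ->
     exists st'' t, [/\ exec G Q now st' c st'' t, (t <= T)%N, ctr st'' k i &
       I i.+1 (storeN st'' (n + (64 * 0 + k)) i.+1)]) ->
  exists st' t, [/\ exec G Q now st (cfor k bd c) st' t, (t <= m * (T + 3) + 3)%N,
    ctr st' k m & I m st'].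
Proof.
move=> hbd I0 IS.
have ea st' : evalN Q st' (ad k (NLit 0)) = (n + (64 * 0 + k))%N by rewrite ev_ad.
(* Induction on the number [j] of iterations left, since [ExecWhileTrue] peels off the first one.
   Incrementing, sequencing and testing add three steps to the body. *)
suff H j st1 : (j <= m)%N -> ctr st1 k (m - j) -> I (m - j)%N st1 ->
  exists st' t, [/\ exec G Q now st1 (CWhile
      (BLeN (NAdd (NLoad (ad k (NLit 0))) (NLit 1)) bd)
      (CSeq c (CStoreN (ad k (NLit 0)) (NAdd (NLoad (ad k (NLit 0))) (NLit 1)))))
      st' t, (t <= j * (T + 3) + 1)%N, ctr st' k m & I m st'].
  have [st' [t [ex le cm Im]]] : exists st' t, [/\ exec G Q now
      (storeN st (n + (64 * 0 + k)) 0) (CWhile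
      (BLeN (NAdd (NLoad (ad k (NLit 0))) (NLit 1)) bd)
      (CSeq c (CStoreN (ad k (NLit 0)) (NAdd (NLoad (ad k (NLit 0))) (NLit 1)))))
      st' t, (t <= m * (T + 3) + 1)%N, ctr st' k m & I m st'].
    by apply: H; rewrite // subnn // /ctr /= eqxx.
  exists st', (1 + t).+1; split => //; last by lia.
  apply: ExecSeq ex.
  have := ExecStoreN G Q now st (ad k (NLit 0)) (NLit 0).
  by rewrite ea.
elim: j st1 => [|j IHj] st1 jm c1 I1.
  exists st1, 1%N; rewrite subn0 in c1 I1; split=> //; apply: ExecWhileFalse.
  by rewrite /= hbd ea c1 addn1 ltnn.
have jlt : (m - j.+1 < m)%N by lia.
have e1 : (m - j.+1).+1 = (m - j)%N by lia.
have [st2 [t [ex le c2 I2]]] := IS _ _ jlt c1 I1.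
rewrite e1 in I2.
have c3 : ctr (storeN st2 (n + (64 * 0 + k)) (m - j)) k (m - j) by rewrite /ctr /= eqxx.
have [st3 [t3 [ex3 le3 cm Im]]] := IHj _ (ltnW jm) c3 I2.
exists st3, ((t + 1).+1 + t3).+1; split=> //; last by nia.
apply: ExecWhileTrue ex3.
  by rewrite /= hbd ea c1 addn1.
apply: (ExecSeq ex).
have := ExecStoreN G Q now st2 (ad k (NLit 0)) (NAdd (NLoad (ad k (NLit 0))) (NLit 1)).
by rewrite /= ea c2 addn1 e1.
Qed.

Lemma rowok_setN (r : bool) s x i v : (r ==> (x != 0))%N -> rowok r s -> rowok r (setN s x i v).
Proof.
move=> x0 rk rr j lt; move: x0; rewrite rr /=; case: x => //= x _; exact: rk.
Qed.

Lemma tab_den r p s : okP r p -> rowok r s -> rowok r (den Q now p s).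
Proof.
move=> ok rk rr; suff w : (0%N \notin wN p) by have [h _ _] := den_fr Q now p s; move=> i lt; rewrite h // (rk rr).
subst; move: ok; rewrite rr; elim: p => //=.
- by move=> k i e; rewrite inE eq_sym => /and4P[].
- by move=> p1 IH1 p2 IH2 /andP[/IH1 h1 /IH2 h2]; rewrite mem_cat negb_or h1.
- by move=> b p1 IH1 p2 IH2 /and3P[_ /IH1 h1 /IH2 h2]; rewrite mem_cat negb_or h1.
- by move=> x b p IH /and4P[_ x0 _ /IH h]; rewrite inE negb_or h eq_sym x0.
Qed.

Lemma loop_ok r x p m s : okP r p -> (r ==> (x != 0))%N -> rowok r s ->
  rowok r (loop x (den Q now p) m s).
Proof.
move=> ok x0 rk; by elim: m => //= m IH; apply: tab_den => //; apply: rowok_setN.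
Qed.

(** Correctness of the compiler together with its cost. A program that uses rows needs the table at
    every intermediate state; [okP] forbids writing to it. *)
Lemma sim_den r p st s m : (0 < m)%N -> (n <= m)%N -> (size Q <= m)%N ->
  sim st s -> rowok r s -> okP r p ->
  exists st' t, [/\ exec G Q now st (cP p) st' t, (t <= tm p m)%N &
    sim st' (den Q now p s)].
Proof.
move=> m0 nm Qm.
elim: p st s => [|k i e|k i e|p1 IH1 p2 IH2|b p1 IH1 p2 IH2|x b p IH|k|e] st s ss rk /=.
- by move=> _; exists st, 1%N; split=> //; exact: ExecSkip.
- move=> /and4P[k31 _ oi oe]; exists (storeN st (n + (64 * eN Q s i + k)) (eN Q s e)), 1%N.
  split=> //; last by apply: sim_setN.
  by have := ExecStoreN G Q now st (ad k (cN i)) (cN e); rewrite ev_ad !(sim_N ss rk).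
- move=> /and3P[k31 oi oe]; exists (storeR st (n + (64 * eN Q s i + k)) (eR Q now s e)), 1%N.
  split=> //; last by apply: sim_setR.
  by have := ExecStoreR G Q now st (ad k (cN i)) (cR e); rewrite ev_ad (sim_N ss rk) // (sim_R ss rk).
- move=> /andP[ ok1 ok2]; have [st1 [t1 [ex1 le1 s1]]] := IH1 _ _ ss rk ok1.
  have [st2 [t2 [ex2 le2 s2]]] := IH2 _ _ s1 (tab_den ok1 rk) ok2.
  by exists st2, (t1 + t2).+1; split=> //; [exact: ExecSeq ex1 ex2|rewrite ltnS leq_add].
- move=> /and3P[okb ok1 ok2]; case: ifP => bb.
    have [st1 [t1 [ex1 le1 s1]]] := IH1 _ _ ss rk ok1.
    exists st1, t1.+1; split=> //; last by rewrite ltnS; apply: leq_trans le1 (leq_addr _ _).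
    by apply: ExecIf; rewrite (sim_B ss rk) // bb.
  have [st1 [t1 [ex1 le1 s1]]] := IH2 _ _ ss rk ok2.
  exists st1, t1.+1; split=> //; last by rewrite ltnS; apply: leq_trans le1 (leq_addl _ _).
  by apply: ExecIf; rewrite (sim_B ss rk) // bb.
- move=> /and4P[x31 x0 xp op].
  have [||st' [t [ex le cc Im]]] := @exec_for (fun i st' => sim st' (setN (loop x (den Q now p) i s) x 0 i))
      x (cbnd b) (bnd Q b) (cP p) (tm p m) st (ev_bnd^~ b).
  + exact: sim_setN.
  + move=> i st1 ib ci si.
    have rki : rowok r (setN (loop x (den Q now p) i s) x 0 i).
      by apply: rowok_setN => //; apply: loop_ok.
    have [st2 [t [ex le s2]]] := IH _ _ si rki op.
    exists st2, t; split=> //; last exact: (sim_setN _ _ _ s2).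
    have [sN _ _ _] := s2; rewrite /ctr sN //=.
    by have [-> //] := den_fr Q now p (setN (loop x (den Q now p) i s) x 0 i); rewrite /= eqxx /= .
  exists st', t; split=> //; apply: leq_trans le _.
  rewrite leq_add2r leq_mul2r; apply/orP; right; rewrite /bnd.
  by have := leq_mul (leqnn b.1.1) nm; have := leq_mul (leqnn b.1.2) Qm; nia.
- move=> k31; have [sN sR sa so] := ss.
  have [||st' [t [ex le cc [vals s']]]] := @exec_for (fun i st' =>
      (forall j, (j < i)%N -> nmem st' j = na s k j) /\ sim st' s)
      63 NVertices n (CStoreN (NLoad (ad 63 (NLit 0))) (NLoad (ad k (NLoad (ad 63 (NLit 0)))))) 1 st (fun=> erefl).
  + split=> //; split=> // k' i k'31 /=; rewrite -sN // ifN //; lia.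
  + move=> i st1 ib ci [vals [sN1 sR1 sa1 so1]].
    exists (storeN st1 i (na s k i)), 1%N; split=> //.
    * have := ExecStoreN G Q now st1 (NLoad (ad 63 (NLit 0))) (NLoad (ad k (NLoad (ad 63 (NLit 0))))).
      have e63 : evalN Q st1 (NLoad (ad 63 (NLit 0))) = i.
        by rewrite -ci -(ev_ad st1 63 (NLit 0)).
      have ek : evalN Q st1 (NLoad (ad k (NLoad (ad 63 (NLit 0))))) = na s k i.
        rewrite -[LHS]/(nmem st1 (evalN Q st1 (ad k (NLoad (ad 63 (NLit 0)))))).
        by rewrite ev_ad e63 sN1.
      by rewrite e63 ek.
    * by rewrite /ctr /=; case: eqP => //; lia.
    * split=> [j ji /=|].
        rewrite ifN; last by lia.
        by case: eqP => [->//|ne]; apply: vals; lia.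
      split=> // k' i' k'31 /=; rewrite ifN ?ifN ?sN1 //; lia.
  have [sN' sR' sa' so'] := s'.
  exists (transmit st' 0), (t + n.+1).+1; split; first 1 last.
  + by move: le; rewrite addnS; lia.
  + split=> //=; rewrite so'; congr rcons; apply/setP => v; rewrite !inE add0n vals //.
  by apply: (ExecSeq ex); exact: ExecTransmit.
- move=> oe; have [sN sR sa so] := ss.
  exists (set_alarm st (Num.max now (evalR G Q now st (cR e)))), 1%N; split=> //.
    exact: ExecAlarm.
  by split=> //=; rewrite (sim_R ss rk).
Qed.

End Sim.
End Lang.

(** * Prize-collecting node-weighted Steiner forest *)

Section Component.
Variables (R : realType) (n : nat) (G : wgraph R n).
Implicit Types (X Y : {set 'I_n}) (u v w : 'I_n).
Notation sc := (same_component G).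

Lemma sc_sub X Y u v : X \subset Y -> sc X u v -> sc Y u v.
Proof.
move=> /fintype.subsetP XY /and3P[uX vX c]; apply/and3P; split; [exact: XY|exact: XY|].
apply: connect_sub c => x y /and3P[xX yX a]; apply: connect1.
by apply/and3P; split=> //; exact: XY.
Qed.

Lemma induced_sym X : symmetric (Defs.induced G X).
Proof. by move=> u v; rewrite /Defs.induced /= adj_sym andbCA. Qed.

Lemma sc_sym X u v : sc X u v = sc X v u.
Proof.
by rewrite /same_component andbCA (sym_connect_sym (induced_sym X)).
Qed.

Lemma sc_refl X u : sc X u u = (u \in X).
Proof. by rewrite /same_component connect0 andbT andbb. Qed.

Lemma sc_trans X v u w : sc X u v -> sc X v w -> sc X u w.
Proof.
move=> /and3P[uX vX c] /and3P[_ wX d]; apply/and3P; split=> //.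
exact: connect_trans c d.
Qed.

Lemma sc_adj X u v w : sc X u v -> w \in X -> adj G v w -> sc X u w.
Proof.
move=> uv wX a; apply: (sc_trans uv); have /and3P[_ vX _] := uv.
apply/and3P; split=> //; apply: connect1; by rewrite /Defs.induced /= vX wX.
Qed.

Lemma sc_l X u v : sc X u v -> u \in X. Proof. by case/and3P. Qed.
Lemma sc_r X u v : sc X u v -> v \in X. Proof. by case/and3P. Qed.

(** Telescoping along a simple path inside [Y]: no vertex is counted twice, and the other vertices
    of [Y] only add nonnegative terms. This turns inequalities on edges into a lower bound on what a
    connecting set pays. *)
Lemma path_cost Y x y (f g : 'I_n -> R) : sc Y x y ->
  {in Y &, forall v w, adj G v w -> f w <= f v + g v} ->
  {in Y, forall v, 0 <= g v} ->
  f y <= f x + \sum_(v in Y) g v.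
Proof.
move=> /and3P[xY _ /connectP[p0 pp ->]] st g0.
case/shortenP: pp => p pp up _ {p0 y}.
apply: (@le_trans _ _ (f x + \sum_(v <- belast x p) g v)).
  elim: p x xY pp up => [|z p IH] x xY /= pp up; first by rewrite big_nil addr0.
  move: pp up => /andP[/and3P[_ zY a] pp] /andP[_ up].
  rewrite big_cons addrA; apply: (le_trans (IH z zY pp up)).
  by rewrite lerD2r; exact: st.
rewrite lerD2l.
have ub : uniq (belast x p) by move: up; rewrite lastI rcons_uniq => /andP[].
have sb : {subset belast x p <= Y}.
  move=> z zb; have : z \in x :: p by exact: mem_belast.
  rewrite inE => /orP[/eqP->//|]; clear zb ub up.
  elim: p x xY pp => //= w p IH x xY /andP[/and3P[_ wY _] pp].
  by rewrite inE => /orP[/eqP->//|]; exact: IH wY pp.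
rewrite (big_uniq _ ub) /= big_mkcond [leRHS]big_mkcond /=.
by apply: ler_sum => v _; case: ifP => [/sb->//|_]; case: ifP => // /g0.
Qed.

End Component.

(** * Harmonic numbers, for the greedy potential *)

Section Harmonic.
Variable R : realType.

Definition harm (k : nat) : R := \sum_(i < k) (i.+1%:R)^-1.

Lemma harmS k : harm k.+1 = harm k + (k.+1%:R)^-1.
Proof. exact: big_ord_recr. Qed.

Lemma le_harm k l : (k <= l)%N -> harm k <= harm l.
Proof.
elim: l => [|l IH]; first by rewrite leqn0 => /eqP->.
rewrite leq_eqVlt => /orP[/eqP->//|]; rewrite ltnS => /IH h.
by rewrite harmS (le_trans h) // lerDl invr_ge0.
Qed.

Lemma harm_ge0 k : 0 <= harm k.
Proof. by apply: sumr_ge0 => i _; rewrite invr_ge0. Qed.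

(** Each of the last [l - k] terms of [harm l] is at least [1 / l]. The left side is the share of a
    lower bound spread over [l] components that a step removing [l - k] of them consumes. *)
Lemma harm_sub k l : (k <= l)%N -> (0 < l)%N -> (l - k)%:R / l%:R <= harm l - harm k.
Proof.
move=> kl l0; rewrite -(subnKC kl); move: (l - k)%N => d {kl}.
rewrite addKn; suff H m : (d <= m)%N -> (k + d <= m)%N -> (0 < m)%N ->
    d%:R / m%:R <= harm (k + d) - harm k.
  case: d H => [|d] H; first by rewrite mul0r addn0 subrr.
  by apply: H; lia.
elim: d {l0} => [|d IH] dm km m0; first by rewrite mul0r addn0 subrr.
rewrite addnS harmS -natr1 mulrDl mul1r addrAC lerD //; first by apply: IH; lia.
by rewrite lef_pV2 ?posrE ?ltr0n // ler_nat; lia.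
Qed.

End Harmonic.

(** * Greedy spiders with penalties: duality and potential *)

Section PC.
Variables (R : realType) (n : nat) (G : wgraph R n) (I : finType).
Variables (e1 e2 : I -> 'I_n) (p : I -> R).
Hypothesis p_ge0 : forall i, 0 <= p i.
Implicit Types (X Y A S : {set 'I_n}) (u v w a b : 'I_n) (D : 'I_n -> 'I_n -> R).
Notation sc := (same_component G).
Notation c := (vcost G).

Definition sv Y i := sc Y (e1 i) (e2 i).

Definition pcc Y : R := \sum_(v in Y) c v + \sum_(i | ~~ sv Y i) p i.

Lemma pcc_ge0 Y : 0 <= pcc Y.
Proof.
by apply: addr_ge0; apply: sumr_ge0 => // v _; exact/ltW/vcost_gt0.
Qed.

Definition rc X v : R := if v \in X then 0 else c v.

Lemma rc_ge0 X v : 0 <= rc X v.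
Proof. by rewrite /rc; case: ifP => // _; exact/ltW/vcost_gt0. Qed.

Definition cross X i a : bool := sc X a (e1 i) (+) sc X a (e2 i).

(** Keeps one representative for each component of [X] that meets [A]. The least one is chosen,
    which a program can do by comparing indices. *)
Definition filt X A : {set 'I_n} :=
  [set a in A | [forall b in A, (b < a)%N ==> ~~ sc X b a]].

Lemma filt_sub X A : filt X A \subset A.
Proof. by apply/fintype.subsetP => a; rewrite inE => /andP[]. Qed.

Lemma filt_sep X A a b : a \in filt X A -> b \in filt X A -> sc X a b -> a = b.
Proof.
rewrite !inE => /andP[aA /forall_inP ha] /andP[bA /forall_inP hb] ab.
apply/eqP; rewrite -val_eqE /= eqn_leq leqNgt [in X in _ && X]leqNgt.
apply/andP; split; apply/negP => lt.
  by move: (ha _ bA); rewrite lt /= sc_sym ab.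
by move: (hb _ aA); rewrite lt /= ab.
Qed.

Lemma filt_cov X A a u : a \in A -> sc X a u -> exists2 a', a' \in filt X A & sc X a' u.
Proof.
move=> aA au.
have ex : exists m, [exists b in A, (val b == m) && sc X b u].
  by exists (val a); apply/existsP; exists a; rewrite aA eqxx.
case: (ex_minnP ex) => m /existsP[b /and3P[bA /eqP bm bu]] mn.
exists b => //; rewrite inE bA; apply/forall_inP => d dA; apply/implyP => db.
apply/negP => sdb; suff : (m <= d)%N by rewrite -bm leqNgt db.
apply: mn; apply/existsP; exists d; rewrite dA eqxx /=.
exact: sc_trans sdb bu.
Qed.

(** All of [S] lies in one component, so at most one of its members survives the filter. *)
Lemma filt_merge X A S : S \subset A -> {in S &, forall a b, sc X a b} ->
  (#|filt X A| + #|S| <= #|A|.+1)%N.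
Proof.
move=> SA conn.
have -> : #|A| = (#|A :\: S| + #|S|)%N.
  by rewrite cardsDS // subnK // subset_leq_card.
rewrite -addSn leq_add2r.
have -> : filt X A = (filt X A :&: S) :|: (filt X A :\: S) by rewrite finset.setID.
rewrite (leq_trans (leq_card_setU _ _)) // -add1n leq_add //.
  apply/card_le1_eqP => a b; rewrite !inE.
  move=> /andP[fa aS] /andP[fb bS]; apply: (@filt_sep X A); rewrite ?inE //.
  exact: conn.
by apply: subset_leq_card; apply: finset.setSD; exact: filt_sub.
Qed.

(** Crossing a vertex of cost [z] at distance [y] from a centre raises the distance, truncated at
    [r], by no more than the part of [z] that lies inside the disc of radius [r]. *)
Lemma disc_step (r x y z : R) : x <= y + z -> 0 <= z ->
  Num.min r x <= Num.min r y + Num.min z (Num.max 0 (r - y)).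
Proof.
case: (leP 0 (r - y)) => h3; case: (leP r x) => h1; case: (leP r y) => h2;
  case: (leP z) => h4; lra.
Qed.

(* Weak duality: while the discs of radius [r] around the components of the   *)
(* representatives [A] are disjoint and no component is worth giving up at    *)
(* price [2 r], every solution pays [r] for each component.                   *)
Lemma spider_lb X A (alive : pred I) D K r :
  A \subset X -> (forall a b, a \in A -> b \in A -> sc X a b -> a = b) ->
  (forall i, alive i -> ~~ sv X i ->
    (exists2 a, a \in A & sc X a (e1 i)) /\ (exists2 a, a \in A & sc X a (e2 i))) ->
  (forall a, a \in A -> D a a = 0) -> (forall a v, a \in A -> 0 <= D a v) ->
  (forall a v w, a \in A -> adj G v w -> D a w <= D a v + rc X v) ->
  0 <= r < K ->
  (forall v b, b \in A -> D b v < K ->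
    (2 <= #|[set a in A | (D a v <= D b v)%R]|)%N ->
    r * #|[set a in A | D a v <= D b v]|%:R <=
      rc X v + \sum_(a in [set a in A | D a v <= D b v]) D a v) ->
  (forall a, a \in A -> 2 * r <= \sum_(i | alive i && cross X i a) p i) ->
  forall Y, r * #|A|%:R <= pcc Y.
Proof.
move=> AX sep cov D0 Dge Dtri /andP[r0 rK] spid pen Y.
have Dz a u : a \in A -> sc X a u -> D a u = 0.
  move=> aA au; apply/eqP; rewrite eq_le Dge // andbT -(D0 _ aA).
  have := @path_cost _ _ G X a u (D a) (fun _ => 0) au.
  rewrite big1 // addr0; apply=> // v w vX wX vw.
  by rewrite (le_trans (Dtri a v w aA vw)) // /rc vX.
(* The part of the cost of [v] covered by the disc of radius [r] around the component of [a]. *)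
pose ac a v : R := Num.min (rc X v) (Num.max 0 (r - D a v)).
have ac0 a v : 0 <= ac a v by rewrite /ac le_min rc_ge0 /= le_max lexx.
pose served a := [exists i, [&& alive i, cross X i a & sv Y i]].
(* The discs are disjoint: only the components at distance less than [r] cover a part of [v], and
   the spider centred at [v] that reaches the farthest of them has ratio at least [r]. *)
have claim1 v : \sum_(a in A) ac a v <= rc X v.
  have small a : r <= D a v -> ac a v = 0.
    move=> h; apply/eqP; rewrite eq_le ac0 andbT /ac ge_min; apply/orP; right.
    by rewrite ge_max lexx /= subr_le0.
  pose S := [set a in A | D a v < r].
  have -> : \sum_(a in A) ac a v = \sum_(a in S) ac a v.
    rewrite big_mkcond [RHS]big_mkcond /=; apply: eq_bigr => a _; rewrite inE.
    case: (a \in A) => //=; case: ltP => // /small ->//.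
  case: (leqP #|S| 1) => cS.
    have [->|[a aS]] := set_0Vmem S; first by rewrite big_set0 rc_ge0.
    have -> : S = [set a].
      by apply/setP => x; rewrite inE; apply/idP/eqP => [xS|->//];
        exact: (card_le1_eqP cS).
    by rewrite big_set1 /ac ge_min lexx.
  have [a0 a0S] : exists a, a \in S by apply/card_gt0P; exact: ltnW cS.
  pose b := [arg max_(i > a0 | i \in S) (D i v)]%O.
  have [bS bmax] : b \in S /\ forall a, a \in S -> D a v <= D b v.
    by rewrite /b; case: arg_maxP.
  have := bS; rewrite inE => /andP[bA bl].
  have SE : [set a in A | D a v <= D b v] = S.
    apply/setP => a; rewrite !inE; case aA: (a \in A) => //=; apply/idP/idP => [h|h].
      exact: le_lt_trans h bl.
    by apply: bmax; rewrite inE aA.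
  have := spid v b bA (lt_trans bl rK); rewrite SE => /(_ cS) hs.
  apply: (@le_trans _ _ (\sum_(a in S) (r - D a v))).
    apply: ler_sum => a; rewrite inE => /andP[_ h].
    by rewrite /ac ge_min; apply/orP; right; rewrite ge_max lexx andbT subr_ge0 ltW.
  by rewrite sumrB sumr_const -mulr_natr lerBlDr.
(* Two components are at distance at least [r]: otherwise a vertex of the second one, free to buy,
   would be the centre of a spider of ratio less than [r]. *)
have far a a' u : a \in A -> a' \in A -> a != a' -> sc X a' u -> r <= D a u.
  move=> aA a'A naa a'u; rewrite leNgt; apply/negP => lt.
  have z : rc X u = 0 by rewrite /rc (sc_r a'u).
  pose S := [set b in A | D b u <= D a u].
  have cS : (2 <= #|S|)%N.
    apply: (@leq_trans #|[set a; a']|); first by rewrite cards2 naa.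
    apply: subset_leq_card; apply/fintype.subsetP => x; rewrite !inE => /orP[]/eqP->.
      by rewrite aA lexx.
    by rewrite a'A (Dz a' u) // Dge.
  have := spid u a aA (lt_trans lt rK) cS; rewrite -/S z add0r leNgt => /negP; apply.
  have aS : a' \in S by rewrite inE a'A (Dz a' u) // Dge.
  rewrite (bigD1 a') //= (Dz a' u) // add0r.
  have r1 : 0 < r by apply: le_lt_trans lt; exact: Dge.
  apply: (@le_lt_trans _ _ (\sum_(b in S | b != a') r)).
    apply: ler_sum => b /andP[]; rewrite inE => /andP[_ h] _.
    exact: le_trans h (ltW lt).
  rewrite mulr_natr -sumr_const [ltRHS](bigD1 a') //=.
  by rewrite ltrDr.
(* A solution serving a pair that the component of [a] separates contains a path from this component
   to another one, which crosses the whole disc. *)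
have claim2 a : a \in A -> served a -> r <= \sum_(v in Y) ac a v.
  move=> aA /existsP[i /and3P[ai cr si]].
  have go u1 u2 : sc Y u1 u2 -> sc X a u1 -> ~~ sc X a u2 ->
      (exists2 a', a' \in A & sc X a' u2) -> r <= \sum_(v in Y) ac a v.
    move=> y12 au1 nau2 [a' a'A a'u2].
    have naa : a != a' by apply: contraNneq nau2 => ->.
    have := @path_cost _ _ G Y u1 u2 (fun v => Num.min r (D a v)) (ac a) y12.
    have -> : Num.min r (D a u2) = r by apply/min_idPl; exact: far naa a'u2.
    rewrite (Dz a u1) //; have -> : Num.min r 0 = 0 by apply/min_idPr.
    rewrite add0r; apply=> // v w vY wY vw.
    have tri := Dtri a v w aA vw; have c0 := rc_ge0 X v.
    exact: disc_step tri c0.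
  have nsX : ~~ sv X i.
    apply/negP => sx; move: cr; rewrite /cross.
    case h1: (sc X a (e1 i)); case h2: (sc X a (e2 i)) => //=.
      by rewrite (sc_trans h1 sx) in h2.
    by move: sx; rewrite /sv sc_sym => sx; rewrite (sc_trans h2 sx) in h1.
  have [c1 c2] := cov i ai nsX.
  move: cr; rewrite /cross; case h1: (sc X a (e1 i)) => /=.
    by move=> nh; apply: (go _ _ si h1 nh c2).
  by move=> h2; apply: (go (e2 i) (e1 i)); rewrite ?h1 // sc_sym.
have -> : r * #|A|%:R = \sum_(a in A | served a) r + \sum_(a in A | ~~ served a) r.
  by rewrite -bigID /= sumr_const mulr_natr.
rewrite /pcc lerD //.
  apply: (@le_trans _ _ (\sum_(a in A | served a) \sum_(v in Y) ac a v)).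
    by apply: ler_sum => a /andP[]; exact: claim2.
  rewrite exchange_big /=; apply: ler_sum => v vY.
  apply: (@le_trans _ _ (rc X v)).
    apply: le_trans (claim1 v).
    by rewrite [leRHS](bigID served) /= lerDl; apply: sumr_ge0.
  by rewrite /rc; case: ifP => // _; exact/ltW/vcost_gt0.
(* The other components are paid by penalties. Each end of a pair lies in at most one component, so
   a pair is used at most twice, hence the price [2 * r]. *)
rewrite -(@ler_pM2l _ 2) // mulr_sumr.
apply: (@le_trans _ _ (\sum_(a in A | ~~ served a) \sum_(i | alive i && cross X i a) p i)).
  by apply: ler_sum => a /andP[aA _]; exact: pen.
rewrite (exchange_big_dep (fun i => ~~ sv Y i)) /=; last first.
  move=> a i /andP[aA ns] /andP[ai cr]; apply: contra ns => si.
  by apply/existsP; exists i; rewrite ai cr.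
rewrite mulr_sumr; apply: ler_sum => i _.
rewrite sumr_const -[leLHS]mulr_natl ler_wpM2r // ler_nat.
pose S u := [set a in A | sc X a u].
have S1 u : (#|S u| <= 1)%N.
  apply/card_le1_eqP => a b; rewrite !inE => /andP[aA au] /andP[bA bu].
  by apply: sep => //; apply: (sc_trans bu); rewrite sc_sym.
apply: (@leq_trans #|S (e1 i) :|: S (e2 i)|).
  apply: subset_leq_card; apply/fintype.subsetP => a.
  rewrite !inE => /andP[/andP[aA _] /andP[_ cr]]; move: cr; rewrite aA /cross /=.
  by do 2 case: (sc X a _).
by apply: (leq_trans (leq_card_setU _ _)); exact: leq_add (S1 _) (S1 _).
Qed.

Lemma sum_setU (f : 'I_n -> R) X Y : (forall v, 0 <= f v) ->
  \sum_(v in X :|: Y) f v <= \sum_(v in X) f v + \sum_(v in Y) f v.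
Proof.
move=> f0; rewrite big_mkcond [X in _ <= X + _]big_mkcond [X in _ <= _ + X]big_mkcond.
rewrite -big_split /=; apply: ler_sum => v _; rewrite inE.
by case: (v \in X); case: (v \in Y); rewrite /= ?addr0 ?add0r // lerDl.
Qed.

Lemma sum_bigcup (f : 'I_n -> R) S (Z : 'I_n -> {set 'I_n}) : (forall v, 0 <= f v) ->
  \sum_(v in \bigcup_(a in S) Z a) f v <= \sum_(a in S) \sum_(v in Z a) f v.
Proof.
move=> f0; elim/big_rec2: _ => [|a x U _ le]; first by rewrite big_set0.
by apply: le_trans (sum_setU _ _ f0) _; rewrite lerD2l.
Qed.

(** The first 2 pays for the initial set of [pcinv_init], and [2 * harm R n] for the greedy steps
    from at most [n] components. *)
Definition gam : R := 2 + 2 * harm R n.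

(** The pairs that are not [alive] have been given up. The last clause is a potential: the money
    spent, plus what the remaining components may still cost, stays within the guarantee against
    every solution. *)
Definition pcinv X A (alive : pred I) : Prop :=
  [/\ A \subset X, forall i, alive i -> (e1 i \in X) && (e2 i \in X),
      forall i, alive i -> ~~ sv X i ->
        (exists2 a, a \in A & sc X a (e1 i)) /\ (exists2 a, a \in A & sc X a (e2 i)) &
      forall Y, \sum_(v in X) c v + \sum_(i | ~~ alive i) p i +
        2 * harm R #|filt X A| * pcc Y <= gam * pcc Y].

Lemma pcinv_filt X A alive : pcinv X A alive -> pcinv X (filt X A) alive.
Proof.
move=> [AX eX cov pot]; split=> //.
- exact: fintype.subset_trans (filt_sub X A) AX.
- move=> i ai ns; have [[a aA a1] [b bA b2]] := cov i ai ns.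
  by split; [exact: filt_cov a1|exact: filt_cov b2].
- move=> Y; apply: le_trans (pot Y); rewrite lerD2l ler_wpM2r ?pcc_ge0 //.
  by rewrite ler_wpM2l // le_harm // subset_leq_card // filt_sub.
Qed.

(** A greedy step pays at most [2 * r] for each component that disappears, and [r <= pcc Y / k];
    [harm_sub] makes the sum telescope. *)
Lemma pot_step (k k' : nat) r t Y : (k' <= k)%N -> (0 < k)%N -> r * k%:R <= pcc Y ->
  0 <= r -> t <= 2 * r * (k - k')%:R ->
  t + 2 * harm R k' * pcc Y <= 2 * harm R k * pcc Y.
Proof.
move=> kk k0 lb r0 tl; have h := harm_sub R kk k0.
have k1 : 0 < k%:R :> R by rewrite ltr0n.
have h2 : (k - k')%:R <= (harm R k - harm R k') * k%:R by rewrite -ler_pdivrMr.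
have d0 : 0 <= harm R k - harm R k' by rewrite subr_ge0 le_harm.
have h3 : r * (k - k')%:R <= r * ((harm R k - harm R k') * k%:R) by rewrite ler_wpM2l.
have h4 : (harm R k - harm R k') * (r * k%:R) <= (harm R k - harm R k') * pcc Y.
  by rewrite ler_wpM2l.
by nra.
Qed.

(** A pair that has an end in the component of [a] and is not given up has both ends there, hence is
    served, so no pair needs [a] any more. The penalty [2 * r] is the price of one component. *)
Lemma pcinv_drop X A alive r a :
  pcinv X A alive -> filt X A = A -> a \in A -> 0 <= r ->
  (forall Y, r * #|A|%:R <= pcc Y) ->
  \sum_(i | alive i && cross X i a) p i = 2 * r ->
  pcinv X (A :\ a) (fun i => alive i && ~~ cross X i a) /\
  (#|filt X (A :\ a)| < #|A|)%N.
Proof.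
move=> [AX eX cov pot] fA aA r0 lb pr.
have cA : (#|filt X (A :\ a)| < #|A|)%N.
  rewrite (leq_ltn_trans (subset_leq_card (filt_sub _ _))) //.
  by rewrite [X in (_ < X)%N](cardsD1 a) aA.
split=> //; split.
- exact: fintype.subset_trans (subsetDl _ _) AX.
- by move=> i /andP[/eX].
- move=> i /andP[ai ncr] ns; have [[b bA b1] [d dA d2]] := cov i ai ns.
  have ne1 u v : sc X a u -> ~~ (sc X a u (+) sc X a v) -> sc X u v.
    by move=> h; rewrite h /= negbK => h2; apply: sc_trans h2; rewrite sc_sym.
  split; [exists b|exists d] => //; rewrite !inE.
    rewrite bA andbT; apply: contraNneq ns => ba.
    by move: b1 ncr; rewrite ba; exact: ne1.
  rewrite dA andbT; apply: contraNneq ns => da.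
  by rewrite /sv sc_sym; move: d2 ncr; rewrite da /cross addbC; exact: ne1.
- move=> Y; have := pot Y; rewrite fA.
  have := @pot_step #|A| #|filt X (A :\ a)| r (2 * r) Y (ltnW cA) (leq_ltn_trans (leq0n _) cA) (lb Y) r0.
  have -> : \sum_(i | ~~ (alive i && ~~ cross X i a)) p i =
      \sum_(i | ~~ alive i) p i + 2 * r.
    rewrite -pr (bigID alive) /= addrC; congr (_ + _); apply: eq_bigl => i.
      by case: (alive i); rewrite /= ?andbF.
    by case: (alive i); rewrite /= ?andbF ?andbT ?negbK.
  move=> h1 h2; apply: le_trans h2; rewrite -!addrA !lerD2l h1 //.
  by rewrite ler_peMr ?mulr_ge0 // ler1n subn_gt0.
Qed.

(** The legs meet at [v] and merge the [#|S|] components into one. As [#|S| >= 2], at least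
    [#|S| / 2] components disappear, which is where the factor 2 comes from. *)
Lemma pcinv_spider X A alive D (Z : 'I_n -> 'I_n -> {set 'I_n}) K r v b :
  pcinv X A alive -> filt X A = A -> 0 <= r ->
  (forall Y, r * #|A|%:R <= pcc Y) ->
  (forall a w, a \in A -> D a w < K -> sc (Z a w :|: [set w]) a w /\
    \sum_(x in Z a w) rc X x <= D a w) ->
  b \in A -> D b v < K ->
  let S := [set a in A | D a v <= D b v] in
  (2 <= #|S|)%N -> rc X v + \sum_(a in S) D a v = r * #|S|%:R ->
  let X' := X :|: ([set v] :|: \bigcup_(a in S) Z a v) in
  pcinv X' A alive /\ (#|filt X' A| < #|A|)%N.
Proof.
move=> [AX eX cov pot] fA r0 lb Zs bA bK S cS rS X'.
have XX' : X \subset X' by exact: finset.subsetUl.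
have mg : (#|filt X' A| + #|S| <= #|A|.+1)%N.
  apply: filt_merge; first by apply/fintype.subsetP => a; rewrite inE => /andP[].
  have hv a : a \in S -> sc X' a v.
    rewrite inE => /andP[aA le]; have [h _] := Zs a v aA (le_lt_trans le bK).
    apply: sc_sub h; rewrite /X' finset.setUC; apply: finset.subsetU; apply/orP; right.
    apply: finset.setUS; apply: finset.bigcup_sup; by rewrite inE aA.
  by move=> x y xS yS; apply: (sc_trans (hv x xS)); rewrite sc_sym; exact: hv.
have cA : (#|filt X' A| < #|A|)%N by lia.
split=> //; split.
- exact: fintype.subset_trans AX XX'.
- by move=> i /eX /andP[h1 h2]; rewrite !(fintype.subsetP XX').
- move=> i ai ns; have nsX : ~~ sv X i by apply: contra ns; exact: sc_sub.
  have [[a aA a1] [d dA d2]] := cov i ai nsX.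
  by split; [exists a|exists d] => //; exact: sc_sub XX' _.
- move=> Y; have := pot Y; rewrite fA.
  have := @pot_step #|A| #|filt X' A| r (r * #|S|%:R) Y (ltnW cA) (leq_ltn_trans (leq0n _) cA) (lb Y) r0.
  have cX' : \sum_(x in X') c x <= \sum_(x in X) c x + r * #|S|%:R.
    have -> : \sum_(x in X') c x = \sum_(x in X) c x + \sum_(x in X') rc X x.
      rewrite (bigID (mem X)) /=; congr (_ + _).
        by apply: eq_bigl => x; case xX: (x \in X); rewrite ?andbT ?andbF // (fintype.subsetP XX').
      rewrite [RHS](bigID (mem X)) /= [X in _ = X + _]big1 ?add0r; last first.
        by move=> x /andP[_ xX]; rewrite /rc xX.
      by apply: eq_bigr => x /andP[_ /negbTE xX]; rewrite /rc xX.
    rewrite lerD2l; apply: (le_trans (sum_setU _ _ (rc_ge0 X))).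
    rewrite [X in X + _]big1 ?add0r; last by move=> x xX; rewrite /rc xX.
    apply: (le_trans (sum_setU _ _ (rc_ge0 X))); rewrite big_set1 -rS lerD2l.
    apply: (le_trans (sum_bigcup _ _ (rc_ge0 X))); apply: ler_sum => a.
    by rewrite inE => /andP[aA le]; have [] := Zs a v aA (le_lt_trans le bK).
  have h : r * #|S|%:R <= 2 * r * (#|A| - #|filt X' A|)%:R.
    by rewrite (mulrC 2) -mulrA ler_wpM2l // -natrM ler_nat; lia.
  move=> /(_ h) h1 h2; apply: le_trans h2.
  move: cX' h1; set x1 := \sum_(x in X') _; set x2 := \sum_(x in X) _; lra.
Qed.

Definition pay u : R := \sum_(i | (e1 i == u) || (e2 i == u)) p i.

(* Every solution pays [min (c u) (pay u)] at each [u], each pair being       *)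
(* counted at most twice.                                                     *)
Lemma pcinv_init :
  let X := [set u | c u < pay u] in
  pcinv X X (fun i => (e1 i \in X) && (e2 i \in X)).
Proof.
move=> X; split=> //.
- by move=> i /andP[h1 h2] _; split; [exists (e1 i)|exists (e2 i)]; rewrite ?sc_refl.
move=> Y; rewrite /gam [leRHS]mulrDl; apply: lerD; last first.
  rewrite ler_wpM2r ?pcc_ge0 // ler_wpM2l // le_harm //.
  by rewrite (leq_trans (max_card _)) // card_ord.
have dead : \sum_(i | ~~ ((e1 i \in X) && (e2 i \in X))) p i <=
    \sum_(u | u \notin X) pay u.
  rewrite /pay (exchange_big_dep xpredT) //= big_mkcond /=; apply: ler_sum => i _.
  have p0 : 0 <= \sum_(u | (u \notin X) && ((e1 i == u) || (e2 i == u))) p i by exact: sumr_ge0.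
  case: ifP => //; rewrite negb_and => /orP[h|h].
    by rewrite (bigD1 (e1 i)) ?h ?eqxx //= lerDl sumr_ge0.
  by rewrite (bigD1 (e2 i)) ?h ?eqxx ?orbT //= lerDl sumr_ge0.
have tot : \sum_(v in X) c v + \sum_(u | u \notin X) pay u <=
    \sum_u (if u \in Y then c u else pay u).
  rewrite [leRHS](bigID (mem X)) /= lerD //; apply: ler_sum => u; rewrite inE.
    by move=> h; case: ifP => // _; exact: ltW.
  by rewrite -leNgt => h; case: ifP.
have rhs : \sum_u (if u \in Y then c u else pay u) <=
    \sum_(v in Y) c v + 2 * \sum_(i | ~~ sv Y i) p i.
  rewrite (bigID (mem Y)) /= lerD //.
    by apply: ler_sum => u ->.
  apply: (@le_trans _ _ (\sum_(u | u \notin Y) pay u)).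
    by apply: ler_sum => u /negbTE->.
  rewrite /pay (exchange_big_dep (fun i => ~~ sv Y i)) /=; last first.
    by move=> u i uY /orP[]/eqP ei; apply: contra uY => /and3P[]; rewrite ei.
  rewrite mulr_sumr; apply: ler_sum => i _; rewrite sumr_const -[leLHS]mulr_natl ler_wpM2r //.
  rewrite ler_nat (@leq_trans #|[set e1 i; e2 i]|) //.
    apply: subset_leq_card; apply/fintype.subsetP => u; rewrite !inE => /andP[_].
    by rewrite ![u == _]eq_sym.
  by rewrite cards2; case: eqP.
apply: (@le_trans _ _ (\sum_(v in Y) c v + 2 * \sum_(i | ~~ sv Y i) p i)).
  by apply: le_trans rhs; apply: le_trans tot; rewrite lerD2l.
rewrite /pcc mulrDr lerD2r ler_peMl //; first by apply: sumr_ge0 => v _; exact/ltW/vcost_gt0.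
by rewrite ler1n.
Qed.

(** An unserved pair that is still alive would have a representative, so every penalty is one
    already accounted for. *)
Lemma pcinv_end X A alive : pcinv X A alive -> filt X A = finset.set0 ->
  forall Y, pcc X <= gam * pcc Y.
Proof.
move=> [AX eX cov pot] fA Y; have := pot Y; rewrite fA cards0.
rewrite /harm big_ord0 mulr0 mul0r addr0; apply: le_trans.
rewrite lerD2l big_mkcond [leRHS]big_mkcond /=; apply: ler_sum => i _.
case: ifP => h; case: ifP => //= /negbFE ai.
have [[a aA a1] _] := cov i ai h.
by have [x] := filt_cov aA a1; rewrite fA inE.
Qed.

End PC.

(** * Levels *)

Section Levels.
Variables (R : realType) (n : nat) (G : wgraph R n).
Notation c := (vcost G).
Implicit Types (X Y : {set 'I_n}) (B : R) (v : 'I_n).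

Lemma c_ge0 v : 0 <= c v. Proof. exact/ltW/vcost_gt0. Qed.
Hint Resolve c_ge0 : core.

Definition ctot : R := \sum_v c v.

(** As a neutral value of the minimum, [ctot] bounds every cost and matters only when no vertex
    qualifies. *)
Definition nextB B : R :=
  Num.max (2 * B) (\big[Num.min/ctot]_(v | B <= (2 * n)%:R * c v) c v).

(* The budgets double, except over gaps in which no vertex has a cost of the  *)
(* order of the budget, so that polynomially many levels suffice.             *)
Definition chain (l : nat) : R := iter l nextB (\big[Num.min/ctot]_v c v).

(** Some vertex is neither negligible nor too expensive for the budget [B]. At such budgets the
    chain exactly doubles, and pending requests only sit at such levels. *)
Definition thick B : Prop := exists v, B <= (2 * n)%:R * c v /\ c v <= B.

Definition trc B v : R := if (2 * n)%:R * c v < B then 0 else Num.min (c v) B.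

Lemma trc_ge0 B v : 0 <= B -> 0 <= trc B v.
Proof. by move=> B0; rewrite /trc; case: ifP => // _; rewrite le_min B0 c_ge0. Qed.

Lemma next_ge B : 2 * B <= nextB B.
Proof. by rewrite /nextB le_max lexx. Qed.

Lemma next_le B v : B <= (2 * n)%:R * c v -> nextB B <= Num.max (2 * B) (c v).
Proof.
move=> h; rewrite /nextB ge_max le_max lexx /= le_max; apply/orP; right.
by rewrite (bigD1 v) //= ge_min lexx.
Qed.

Lemma next_thick B : 0 <= B -> thick B -> nextB B = 2 * B.
Proof.
move=> B0 [v [h1 h2]]; apply/eqP; rewrite eq_le next_ge andbT.
apply: (le_trans (next_le h1)); rewrite ge_max lexx /=; lra.
Qed.

Lemma bigmin_ex (P : pred 'I_n) v0 : P v0 ->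
  exists2 v, P v & \big[Num.min/ctot]_(v | P v) c v = c v.
Proof.
move=> P0; have [v Pv vm] : exists2 v, P v & forall w, P w -> c v <= c w.
  by case: (@arg_minP _ _ _ v0 P (fun v => c v) P0) => v Pv vm; exists v.
exists v => //; apply/eqP; rewrite eq_le; apply/andP; split.
  by rewrite (bigD1 v) //= ge_min lexx.
elim/big_ind: _ => [|x y hx hy|w /vm//]; last by rewrite le_min hx hy.
by rewrite /ctot (bigD1 v) //= lerDl sumr_ge0.
Qed.

Lemma chain_gt0 (v : 'I_n) l : 0 < chain l.
Proof.
elim: l => [|l IH].
  rewrite /chain /=; have [w _ ->] := @bigmin_ex xpredT v isT; exact: vcost_gt0.
by rewrite /chain iterS -/(chain l); apply: lt_le_trans (next_ge _); rewrite pmulr_rgt0.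
Qed.

Lemma chainS l : chain l.+1 = nextB (chain l). Proof. by []. Qed.

Lemma chain_ge0 l : 0 <= chain l.
Proof.
elim: l => [|l IH]; last by rewrite chainS; apply: le_trans (next_ge _); rewrite mulr_ge0.
rewrite /chain /=; elim/big_ind: _ => //; first by apply: sumr_ge0.
by move=> x y x0 y0; rewrite le_min x0.
Qed.

Lemma chain_double l j : 2 ^+ j * chain l <= chain (l + j).
Proof.
elim: j => [|j IH]; first by rewrite mul1r addn0.
rewrite addnS chainS exprS -mulrA; apply: le_trans (next_ge _).
by rewrite ler_pM2l.
Qed.

Lemma chain_mono l j : (l <= j)%N -> chain l <= chain j.
Proof.
move=> lj; rewrite -(subnKC lj); apply: le_trans (chain_double _ _).
by rewrite ler_peMl ?chain_ge0 // exprn_ege1 // ler1n.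
Qed.

Lemma chain_sum l : \sum_(i < l.+1) chain i <= 2 * chain l.
Proof.
elim: l => [|l IH]; first by rewrite big_ord1; have := chain_ge0 0; lra.
rewrite big_ord_recr /=; have := next_ge (chain l); rewrite -chainS; lra.
Qed.

Lemma count_le (P : nat -> bool) (k L : nat) :
  (forall i j, P i -> P j -> (i <= j)%N -> (j <= i + k)%N) ->
  (\sum_(i < L) P i <= k.+1)%N.
Proof.
move=> H; case: (boolP [exists i : 'I_L, P i]) => [/existsP[i0 Pi0]|]; last first.
  rewrite negb_exists => /forallP h; rewrite big1 // => i _.
  by rewrite (negbTE (h i)).
have ex : exists m, P m by exists i0.
case: (ex_minnP ex) => m Pm mn.
have -> : (\sum_(i < L) P i = \sum_(0 <= i < L) P i)%N by rewrite big_mkord.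
apply: (@leq_trans (\sum_(0 <= i < L) (m <= i < m + k.+1))%N).
  apply: leq_sum => i _; case Pi: (P i) => //; rewrite mn //= addnS ltnS.
  by rewrite H // mn.
elim: L {i0 Pi0} => [|L IH]; first by rewrite big_nil.
have aux : (\sum_(0 <= i < L) (m <= i < m + k.+1) <= (minn L (m + k.+1)) - m)%N.
  elim: L {IH} => [|L IH]; first by rewrite big_nil.
  rewrite big_nat_recr //=; apply: (leq_trans (leq_add IH (leqnn _))).
  by case: (leqP m L) => h1 /=; case: (ltnP L (m + k.+1)) => h2 /=; lia.
rewrite big_nat_recr //=; apply: (leq_trans (leq_add aux (leqnn _))).
by case: (leqP m L) => h1 /=; case: (ltnP L (m + k.+1)) => h2 /=; lia.
Qed.

Definition btw (x : R) (k : nat) (y : R) : bool := (x <= y) && (y <= 2 ^+ k * x).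

Lemma count_chain (x : R) (k s L : nat) : 0 < x ->
  (\sum_(i < L) btw x k (chain (s + i)) <= k.+1)%N.
Proof.
move=> x0; apply: (@count_le (fun i => btw x k (chain (s + i)))).
move=> i j /andP[h1 _] /andP[_ h2] ij; rewrite leqNgt; apply/negP => lt.
have h3 : 2 ^+ k.+1 * x <= 2 ^+ k * x.
  apply: le_trans h2; apply: (@le_trans _ _ (2 ^+ (j - i) * chain (s + i))).
    apply: ler_pM; rewrite ?exprn_ge0 ?(ltW x0) //.
    by apply: ler_weXn2l; [rewrite ler1n|lia].
  by have := chain_double (s + i) (j - i); rewrite -addnA subnKC.
move: h3; rewrite ler_pM2r // exprS; have : 0 < 2 ^+ k :> R by exact: exprn_gt0.
lra.
Qed.

Definition lg : nat := (trunc_log 2 (2 * n)).+1.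

Lemma lg_bound : ((2 * n)%:R : R) <= 2 ^+ lg.
Proof. by rewrite -natrX ler_nat ltnW // trunc_log_ltn. Qed.

Lemma lg_le : (lg <= n + 1)%N.
Proof.
rewrite /lg addn1 ltnS; case: n => [|m]; first by [].
rewrite -(@leq_exp2l 2) //; apply: leq_trans (trunc_logP _ _) _ => //.
by elim: m => // m IH; rewrite expnS; lia.
Qed.

(** Assign to each level up to [l] the cheapest vertex that counts there. The next budget lies
    within a factor [2 ^+ lg.+1] of the cost of this vertex, and since budgets double this happens
    at most [lg.+2] times for one vertex. *)
Lemma lev_bound l v : chain l <= (2 * n)%:R * c v -> (l < n * lg.+2)%N.
Proof.
move=> hl; have n0 : (0 < n)%N by apply: leq_ltn_trans (ltn_ord v).
have v0 := vcost_gt0 G.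
apply: (@leq_trans (\sum_(i < l.+1) \sum_(w < n)
    btw (c w) lg.+1 (chain (1 + i)))%N).
  rewrite -[X in (X <= _)%N](card_ord l.+1) -sum1_card leq_sum // => i _.
  have hi : chain i <= (2 * n)%:R * c v.
    by apply: le_trans hl; apply: chain_mono; rewrite -ltnS ltn_ord.
  have [w hw ew] := @bigmin_ex (fun w => chain i <= (2 * n)%:R * c w) v hi.
  have h1 : c w <= chain (1 + i).
    by rewrite add1n chainS /nextB ew le_max lexx orbT.
  have h2 : chain (1 + i) <= 2 ^+ lg.+1 * c w.
    rewrite add1n chainS; apply: (le_trans (next_le hw)).
    have lb := ler_wpM2r (c_ge0 w) lg_bound.
    have c1 : c w <= 2 ^+ lg * c w by rewrite ler_peMl // exprn_ege1 // ler1n.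
    by rewrite ge_max exprS; apply/andP; split; have := c_ge0 w; lra.
  by rewrite (bigD1 w) //= /btw h1 h2.
rewrite exchange_big; apply: (@leq_trans (\sum_(w < n) lg.+2)%N).
  by apply: leq_sum => w _; apply: count_chain; exact: vcost_gt0.
by rewrite sum_nat_const card_ord.
Qed.

Definition Lm : nat := (n * (n + 4))%N.

Lemma lev_Lm l v : chain l <= (2 * n)%:R * c v -> (l < Lm)%N.
Proof.
move=> /lev_bound h; apply: (leq_trans h); rewrite /Lm leq_mul2l; apply/orP; right.
by have := lg_le; lia.
Qed.

(** Budgets below [c v] form a geometric sum of at most [2 * c v]. At most [lg.+1] budgets lie
    between [c v] and [2n * c v], each contributing [c v]; beyond that the vertex is dropped. *)
Lemma trc_sum v L : \sum_(l < L) trc (chain l) v <= (lg + 3)%:R * c v.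
Proof.
have v0 := vcost_gt0 G v.
apply: (@le_trans _ _ (\sum_(l < L | chain l < c v) chain l +
    \sum_(l < L) (btw (c v) lg (chain (0 + l)))%:R * c v)).
  rewrite [X in _ <= X + _]big_mkcond -big_split /=; apply: ler_sum => l _.
  have lb := ler_wpM2r (c_ge0 v) lg_bound.
  have bc : 0 <= (btw (c v) lg (chain l))%:R * c v by rewrite mulr_ge0.
  rewrite add0n /trc; case: ltP => h1; case: ltP => h2 //.
  - by rewrite addr_ge0 ?chain_ge0.
  - by rewrite add0r.
  - by rewrite lerDl.
  - by rewrite /btw h2 (le_trans h1 lb) add0r mul1r.
have -> : (lg + 3)%:R * c v = 2 * c v + lg.+1%:R * c v.
  by rewrite -mulrDl -natrD; congr (_%:R * _); lia.
rewrite lerD //; last first.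
  rewrite -mulr_suml ler_pM2r // -natr_sum ler_nat; exact: count_chain.
elim: L => [|L IH]; first by rewrite big_ord0 mulr_ge0.
rewrite big_mkcond big_ord_recr -big_mkcond /=; case: ltP => h; last by rewrite addr0.
apply: (@le_trans _ _ (2 * chain L)); last by rewrite ler_pM2l // ltW.
apply: le_trans (chain_sum L); rewrite big_ord_recr /= lerD2r big_mkcond.
by apply: ler_sum => i _; case: ifP => // _; exact: chain_ge0.
Qed.

End Levels.

(** * Competitive analysis *)

Section Online.
Variables (R : realType) (n : nat) (G : wgraph R n).
Notation c := (vcost G).
Notation chain := (chain G).
Notation thick := (thick G).
Implicit Types (X Y : {set 'I_n}) (v : 'I_n).
#[local] Hint Extern 0 (is_true (0 <= vcost _ _)) => apply: c_ge0 : core.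

Definition svn (Q : seq (request R n)) Y (i : nat) : bool :=
  oapp (fun q => same_component G Y (endp1 q) (endp2 q)) false (onth Q i).

Definition rel (Q : seq (request R n)) (i : nat) : R :=
  oapp (fun q => release q) 0 (onth Q i).

Definition light B : {set 'I_n} := [set v | c v <= B].

Definition cheap B : {set 'I_n} := [set v | (2 * n)%:R * c v < B].

Lemma svn_sub Q X Y i : X \subset Y -> svn Q X i -> svn Q Y i.
Proof. by rewrite /svn; case: (onth Q i) => //= q; exact: sc_sub. Qed.

Lemma svn_ex Q Y i : svn Q Y i -> exists v, v \in Y.
Proof. by rewrite /svn; case: (onth Q i) => //= q /sc_l; exists (endp1 q). Qed.

(** A vertex of [light B] missing from [X] cannot be cheap, so it witnesses thickness. This puts a
    request that a service leaves behind at a thick level. *)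
Lemma thick_light Q X B i : cheap B \subset X -> ~~ svn Q X i -> svn Q (light B) i ->
  thick B.
Proof.
move=> sX nX lB; have : ~~ (light B \subset X).
  by apply: contra nX => sub; exact: svn_sub lB.
move=> /subsetPn[v]; rewrite inE => vB vX; exists v; split=> //.
rewrite leNgt; apply: contra vX => h; apply: (fintype.subsetP sX).
by rewrite inE.
Qed.

Definition heavy Q i B := forall Y, svn Q Y i -> exists2 v, v \in Y & B / 2 <= c v.

(** Light vertices of the previous level do not connect the pair, so every connecting set has a
    vertex dearer than the previous budget, and the chain never jumps beyond twice such a cost.
    Level 0 is the least vertex cost. *)
Lemma low_heavy Q i L : (forall l, (l < L)%N -> ~~ svn Q (light (chain l)) i) ->
  heavy Q i (chain L) /\ (svn Q (light (chain L)) i -> thick (chain L)).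
Proof.
case: L => [|l] low.
  have n1 v : 1 <= (2 * n)%:R :> R by rewrite ler1n; have := ltn_ord v; lia.
  have cm v : chain 0 <= c v by rewrite /chain /= (bigD1 v) //= ge_min lexx.
  split=> [Y /svn_ex[v vY]|/svn_ex[v]].
    exists v => //; apply: le_trans (cm v); have := chain_ge0 G 0.
    by move: (chain 0) => x; clear; lra.
  rewrite inE => h; exists v; split=> //.
  by apply: (le_trans (cm v)); rewrite ler_peMl ?n1 ?c_ge0.
have key Y : svn Q Y i -> exists2 v, v \in Y & chain l.+1 <= 2 * c v.
  move=> sY; have : ~~ (Y \subset light (chain l)).
    by apply: contra (low l (ltnSn l)) => sub; exact: svn_sub sY.
  move=> /subsetPn[v vY]; rewrite inE -ltNge => lt; exists v => //.
  have v0 := c_ge0 G v.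
  have n1 : 1 <= (2 * n)%:R :> R by rewrite ler1n; have := ltn_ord v; lia.
  rewrite chainS; apply: le_trans (@next_le _ _ _ _ v _) _.
    by apply: (le_trans (ltW lt)); rewrite ler_peMl.
  by rewrite ge_max ler_pM2l // (ltW lt) /=; lra.
split=> [Y /key[v vY h]|/key[v]]; first by exists v => //; lra.
rewrite inE => h1 h2; exists v; split=> //; apply: (le_trans h2).
by rewrite ler_wpM2r // ler_nat; have := ltn_ord v; lia.
Qed.

Lemma light_Lm Q i : svn Q [set: 'I_n] i -> svn Q (light (chain (Lm n))) i.
Proof.
apply: svn_sub; apply/fintype.subsetP => v _; rewrite inE leNgt; apply/negP => lt.
have := @lev_Lm _ _ G (Lm n) v; rewrite ltnn => H; suff : false by [].
apply: H; apply: (le_trans (ltW lt)); rewrite ler_peMl // ler1n.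
by have := ltn_ord v; lia.
Qed.

(** Either one vertex of [Y] is alone worth [B], or truncation merely drops at most [n] vertices of
    cost below [B / 2n], a loss of at most [B / 2]. *)
Lemma trc_lb B Y (q : R) : 0 < B -> 0 <= q -> B < \sum_(v in Y) c v + q ->
  B / 2 <= \sum_(v in Y) trc G B v + q.
Proof.
move=> B0 q0 lt; have t0 v : 0 <= trc G B v by apply: trc_ge0; exact: ltW.
case: (boolP [exists v in Y, B <= c v]) => [/exists_inP[v vY h]|].
  rewrite (bigD1 v) //= /trc ifF; last first.
    apply/negbTE; rewrite -leNgt; apply: (le_trans h).
    by rewrite ler_peMl // ler1n; have := ltn_ord v; lia.
  rewrite min_r //; apply: (@le_trans _ _ B); first by lra.
  by rewrite -addrA lerDl; apply: addr_ge0 => //; apply: sumr_ge0 => w _; exact: t0.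
rewrite negb_exists_in => /forall_inP h.
have H v : v \in Y -> c v <= trc G B v + B / (2 * n)%:R.
  move=> /h; rewrite -ltNge => lt2; rewrite /trc; case: ltP => h2.
    rewrite add0r ler_pdivlMr; first by rewrite mulrC ltW.
    by rewrite ltr0n; have := ltn_ord v; lia.
  by rewrite min_l ?(ltW lt2) // lerDl divr_ge0 // ltW.
have : \sum_(v in Y) c v <= \sum_(v in Y) trc G B v + B / 2.
  apply: (@le_trans _ _ (\sum_(v in Y) (trc G B v + B / (2 * n)%:R))).
    by apply: ler_sum => v /H.
  rewrite big_split /= lerD2l sumr_const -[leLHS]mulr_natl.
  case: (posnP n) => [n0|npos].
    rewrite (_ : #|Y| = 0%N) ?mul0r; first by lra.
    by apply: eq_card0 => v; have := ltn_ord v; rewrite {2}n0.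
  rewrite mulrCA ler_pM2l // natrM invfM mulrCA ler_piMr ?invr_ge0 //.
  rewrite ler_pdivrMr ?ltr0n // mul1r ler_nat.
  by rewrite (leq_trans (max_card _)) // card_ord.
lra.
Qed.

Lemma dl_mono (Q : seq (request R n)) i s t : s <= t -> dl Q i s <= dl Q i t.
Proof.
rewrite /dl; case: (onth Q i) => //= q st; rewrite /delay_at.
apply: delay_homo; [by rewrite in_itv /= andbT le_max lexx..|].
by rewrite !ge_max !le_max !lexx st !orbT.
Qed.

End Online.

(** * Cost of a service, and its charge to an offline schedule *)

Section Charging.
Variables (R : realType) (n : nat) (G : wgraph R n) (Q : seq (request R n)).
Notation c := (vcost G).
Notation chain := (chain G).
Notation thick := (thick G).
Notation svn := (svn G Q).
Notation rel := (rel Q).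
Notation dl := (dl Q).
Notation M := (size Q).
Implicit Types (X Y : {set 'I_n}) (v : 'I_n).
#[local] Hint Extern 0 (is_true (0 <= vcost _ _)) => apply: c_ge0 : core.

(** What the analysis retains of the memory; [hh] is the delay already paid for. Indices are plain
    numbers, so that one state makes sense for the released requests and for the whole sequence. *)
Record astate := AState { pd : nat -> bool; lv : nat -> nat; hh : nat -> R }.
Implicit Types a : astate.

Definition res a t i : R := Num.max (hh a i) (dl i t) - hh a i.

Definition csum a t l : R := \sum_(i < M | pd a i && (lv a i == l)) res a t i.

Definition base m a : Prop :=
  [/\ forall i, pd a i -> (i < m)%N, (m <= M)%N,
      forall i, pd a i -> svn (light G (chain (lv a i))) i &
      forall i, pd a i -> thick (chain (lv a i))].

Definition elig l a i : bool := pd a i && (lv a i <= l.+1)%N.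

(* [X] is bought at time [t] on behalf of the pending requests of level [l].  *)
(* An eligible request that it does not serve moves to level [l.+1], its      *)
(* delay being accounted for in advance up to [u i].  The certificate is the  *)
(* time at which every solution, paying a penalty for the requests that it    *)
(* leaves out, would cost more than [b].                                      *)
Definition serv_rel (t : R) a a' X l (u : nat -> R) (cert : option R) : Prop :=
  let b := chain l.+1 in
  let E := elig l a in
  let g i := Num.max (hh a i) (dl i t) in
  [/\ (exists i, pd a i /\ lv a i = l) /\ chain l / 2 <= csum a t l,
      forall i, if E i then
        if svn X i then pd a' i = false /\ hh a' i = g i
        else [/\ pd a' i, lv a' i = l.+1 & hh a' i = u i]
        else [/\ pd a' i = pd a i, lv a' i = lv a i & hh a' i = hh a i],
      cheap G b \subset X /\
      \sum_(v in X) c v + \sum_(i < M | E i && ~~ svn X i) (u i - g i) <= (gam R n + 1) * b,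
      forall i, E i -> g i <= u i &
      if cert is Some tau then
        [/\ t <= tau, forall i, E i -> u i = Num.max (g i) (dl i tau) &
            forall Y, b < \sum_(v in Y) c v + \sum_(i < M | E i && ~~ svn Y i) (u i - g i)]
      else forall i, E i -> svn X i].

Lemma res_ge0 a t i : 0 <= res a t i.
Proof. by rewrite /res subr_ge0 le_max lexx. Qed.

Lemma serv_base m t a a' X l u ocrt : base m a -> serv_rel t a a' X l u ocrt -> base m a'.
Proof.
move=> [pm mM pl pt] [[[i0 [p0 l0]] _] st [chX _] _ _]; split=> // i.
- have := st i; rewrite /elig; case pi: (pd a i) => /=; first by move=> *; exact: pm.
  by move=> [->].
- have := st i; case: ifP => [|_ [-> -> _]]; last exact: pl.
  move=> /andP[pi le]; case: ifP => [_ [->]//|_ [_ -> _] _].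
  apply: (svn_sub _ (pl i pi)); apply/fintype.subsetP => v; rewrite !inE => h.
  by apply: le_trans h _; exact: chain_mono.
- have := st i; case: ifP => [|_ [-> -> _]]; last exact: pt.
  move=> /andP[pi le]; case: ifP => [_ [->]//|/negbT ns [_ -> _] _].
  apply: (thick_light chX ns).
  apply: (svn_sub _ (pl i pi)); apply/fintype.subsetP => v; rewrite !inE => h.
  by apply: le_trans h _; exact: chain_mono.
Qed.

Lemma serv_double m t a a' X l u ocrt : base m a -> serv_rel t a a' X l u ocrt ->
  chain l.+1 = 2 * chain l /\ (l < Lm n)%N.
Proof.
move=> [_ _ _ pt] [[[i0 [p0 l0]] _] _ _ _ _].
have th := pt i0 p0; rewrite l0 in th; split.
  by rewrite chainS next_thick ?chain_ge0.
by have [v [h _]] := th; exact: (lev_Lm h).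
Qed.

(** A request left unserved has its delay paid in advance, so it brings no unpaid delay to its new
    level. *)
Lemma csum_after t a a' X l u ocrt j : serv_rel t a a' X l u ocrt ->
  (forall j, csum a t j <= chain j) -> csum a' t j <= chain j.
Proof.
move=> [_ st _ gu ce] le; apply: le_trans (le j); rewrite /csum.
rewrite big_mkcond [leRHS]big_mkcond /=; apply: ler_sum => i _.
have := st i; case: ifP => [/andP[pi li]|_ [-> -> hE]]; last by rewrite /res hE.
case: ifP => [_ [-> _]|_ [_ _ hE]] /=.
  by case: ifP => // _; exact: res_ge0.
have -> : res a' t i = 0.
  by rewrite /res hE; apply/eqP; rewrite subr_eq0; apply/eqP/max_idPl;
     apply: le_trans (gu i _); rewrite /elig ?pi ?li // le_max lexx orbT.
by rewrite !if_same; case: ifP => // _; exact: res_ge0.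
Qed.

Lemma elig_sum l a t : (forall j, csum a t j <= chain j) ->
  \sum_(i < M | elig l a i) res a t i <= 2 * chain l.+1.
Proof.
move=> le; apply: le_trans (chain_sum G l.+1).
apply: (@le_trans _ _ (\sum_(j < l.+2) csum a t j)); last by apply: ler_sum.
rewrite /csum; under [leRHS]eq_bigr do rewrite big_mkcond.
rewrite exchange_big /= big_mkcond /=; apply: ler_sum => i _; rewrite /elig.
case pi: (pd a i) => /=; last by rewrite big1.
case: leqP => h /=; last by apply: sumr_ge0 => j _; case: ifP => // _; exact: res_ge0.
rewrite (bigD1 (Ordinal (h : (lv a i < l.+2)%N))) //= eqxx lerDl.
by apply: sumr_ge0 => j _; case: ifP => // _; exact: res_ge0.
Qed.

(** With [b = chain l.+1], the unpaid delays of all levels up to [l.+1] sum to at most [2 * b], and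
    the forest with the delays paid in advance costs [(gam + 1) * b]. As level [l] is thick, [b] is
    four half budgets. *)
Lemma serv_cost m t a a' X l u ocrt : base m a -> serv_rel t a a' X l u ocrt ->
  (forall j, csum a t j <= chain j) ->
  \sum_(v in X) c v + \sum_(i < M) (hh a' i - hh a i) <=
    4 * (gam R n + 3) * (chain l / 2).
Proof.
move=> ba sr le; have [dbl _] := serv_double ba sr.
have [_ st [_ cX] gu _] := sr.
have := elig_sum l le; rewrite dbl => es.
have -> : \sum_(i < M) (hh a' i - hh a i) = \sum_(i < M | elig l a i) res a t i +
    \sum_(i < M | elig l a i && ~~ svn X i) (u i - Num.max (hh a i) (dl i t)).
  rewrite [X in X + _]big_mkcond [X in _ + X]big_mkcond -big_split /=.
  apply: eq_bigr => i _; have := st i; case: (elig l a i) => /=.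
    by case: (svn X i) => /=; [move=> [_ ->]|move=> [_ _ ->]]; rewrite /res; lra.
  by move=> [_ _ ->]; lra.
move: cX es; rewrite dbl; set s1 := \sum_(v in X) c v.
set s2 := \sum_(i < M | elig l a i && _) _; set s3 := \sum_(i < M | elig l a i) _.
by move: s1 s2 s3 (gam R n) (chain l) => s1 s2 s3 g x; clear; lra.
Qed.

(** [ce] selects the requests concerned, [cg] and [cu] are the delay values from which and up to
    which they were paid in advance, and [ct] is the time that was reached. *)
Record cert := Cert { ce : pred nat; cg : nat -> R; cu : nat -> R; ct : R }.

(* [lst l] is the last service at a level at least [l], [crt l] the           *)
(* certificate that it left for level [l], [us i] the delay of [i] charged so *)
(* far, and [wt] the sum of the half budgets to be charged.                   *)
Record ghost := Ghost {
  lst : nat -> R; us : nat -> R; crt : nat -> option cert; wt : R }.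

Variables (S : schedule R n) (ts : nat -> R).
Hypothesis ts_rel : forall i, (i < M)%N -> rel i <= ts i.
Hypothesis ts_sv : forall i, (i < M)%N ->
  exists tr, [/\ tr \in S, tr.1 = ts i & svn tr.2 i].

Definition od i : R := dl i (ts i).

Definition Tc l (x : R) : R :=
  \sum_(tr <- S | tr.1 <= x) \sum_(v in tr.2) trc G (chain l) v.

(** The part of the offline delay that falls between the delay values [x i] and [y i]. Consecutive
    segments of a request add up, so its delay is charged once. *)
Definition seg (E : pred nat) (x y : nat -> R) : R :=
  \sum_(i < M | E i) (Num.min (y i) (od i) - Num.min (x i) (od i)).

Definition live gh l : R :=
  if crt gh l is Some C then seg (ce C) (cg C) (cu C) else 0.

Definition certified l C : Prop :=
  (forall i, ce C i -> cg C i <= cu C i /\ cu C i = Num.max (cg C i) (dl i (ct C))) /\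
  forall Y, chain l < \sum_(v in Y) c v +
    \sum_(i < M | ce C i && ~~ svn Y i) (cu C i - cg C i).

(** A pending request was released after the last service at its level or above. Its unpaid delay
    starts either at its release, and then every way to connect it contains a heavy vertex, or
    beyond a certificate of its level. The last clause is the potential: half budgets charged, plus
    offline delay reserved for live certificates, are covered by truncated purchases and by the
    offline share of the delays charged. *)
Definition ginv m now a gh : Prop :=
  [/\ (forall l l', (l <= l')%N -> lst gh l' <= lst gh l) /\ lst gh 0 <= now,
      forall i, (m <= i < M)%N -> lst gh 0 < rel i /\ us gh i = dl i (rel i),
      forall i, pd a i -> [/\ lst gh (lv a i) < rel i, hh a i = us gh i &
        (hh a i = dl i (rel i) /\ heavy G Q i (chain (lv a i))) \/
        exists C, crt gh (lv a i) = Some C /\ dl i (ct C) <= hh a i],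
      forall l C, crt gh l = Some C ->
        (forall i, ce C i -> lst gh l < rel i) /\ certified l C &
      wt gh + \sum_(l < (Lm n).+1) live gh l <=
        \sum_(l < Lm n) Tc l (lst gh l) +
        \sum_(i < M) (Num.min (us gh i) (od i) - dl i (rel i))].

Lemma seg_ge0 (E : pred nat) (x y : nat -> R) : (forall i, E i -> x i <= y i) -> 0 <= seg E x y.
Proof.
move=> le; apply: sumr_ge0 => i /le h; rewrite subr_ge0 le_min !ge_min h lexx.
by rewrite orbT.
Qed.

Lemma live_ge0 m now a gh l : ginv m now a gh -> 0 <= live gh l.
Proof.
move=> [_ _ _ g4 _]; rewrite /live; case e: (crt gh l) => [C|] //.
by have [_ [h _]] := g4 _ _ e; apply: seg_ge0 => i /h[].
Qed.

Section Interval.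
Variables (l : nat) (s t : R).
Hypothesis st : s <= t.

Definition bought : {set 'I_n} := \bigcup_(tr <- S | s < tr.1 <= t) tr.2.

Lemma bought_cost : \sum_(v in bought) trc G (chain l) v <= Tc l t - Tc l s.
Proof.
have t0 v : 0 <= trc G (chain l) v by apply: trc_ge0; exact: chain_ge0.
have -> : Tc l t - Tc l s =
    \sum_(tr <- S | s < tr.1 <= t) \sum_(v in tr.2) trc G (chain l) v.
  rewrite /Tc (bigID (fun tr : R * {set 'I_n} => tr.1 <= s)) /= addrC.
  rewrite [X in _ + X - _](eq_bigl (fun tr : R * {set 'I_n} => tr.1 <= s)).
    by rewrite addrK; apply: eq_bigl => tr; rewrite -ltNge andbC.
  move=> tr /=; case h: (tr.1 <= s); rewrite ?andbF // andbT.
  exact: le_trans h st.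
rewrite /bought; elim/big_rec2: _ => [|tr x U _ le]; first by rewrite big_set0.
by apply: le_trans (sum_setU _ _ t0) _; rewrite lerD2l.
Qed.

Lemma bought_sv i : (i < M)%N -> s < rel i -> ts i <= t -> svn bought i.
Proof.
move=> iM sr tt; have [tr [trS tr1 trs]] := ts_sv iM.
apply: svn_sub trs; rewrite /bought.
have : s < tr.1 <= t by rewrite tr1 tt (lt_le_trans sr) // ts_rel.
move: (tr) trS => {tr1} tr0; elim: S => //= tr' S' IH.
rewrite inE big_cons => /orP[/eqP<- ->|/IH h /h sub]; first exact: finset.subsetUl.
by case: ifP => // _; apply: fintype.subset_trans sub (finset.subsetUr _ _).
Qed.

End Interval.

(** Offline, the request is served after its release, hence after [s]; if what is bought in []s, t]]
    does not connect it, that happens after [t]. *)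
Lemma unserved_od s t i : (i < M)%N -> s < rel i -> ~~ svn (bought s t) i ->
  forall x, x <= t -> dl i x <= od i.
Proof.
move=> iM sr ns x xt; rewrite /od; apply: dl_mono; apply: (le_trans xt).
by rewrite leNgt; apply: contra ns => /ltW; exact: bought_sv.
Qed.

(* Between two services at level [l], the optimum has bought the certificate  *)
(* of the first one, or a vertex of cost at least [chain l / 2] for a request *)
(* that started at level [l], or else it pays delay like the algorithm.       *)
Lemma charge_key m now t a a' X l u oc gh : base m a -> ginv m now a gh ->
  now <= t -> serv_rel t a a' X l u oc ->
  chain l / 2 <= Tc l t - Tc l (lst gh l) + live gh l +
    seg (elig l a) (hh a) (fun i => Num.max (hh a i) (dl i t)).
Proof.
move=> ba gi nt sr; have [pm mM _ _] := ba.
have [[lm l0n] _ g3 g4 _] := gi.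
have lt : lst gh l <= t by apply: le_trans nt; apply: le_trans l0n; exact: lm.
have bc := bought_cost l lt; set Y := bought _ _ in bc.
have [i0 [p0 l0]] : exists i, pd a i /\ lv a i = l by have [[]] := sr.
have B0 : 0 < chain l.
  by have [_ _ _ /(_ i0 p0) [v _]] := ba; exact: chain_gt0.
have sg0 : 0 <= seg (elig l a) (hh a) (fun i => Num.max (hh a i) (dl i t)).
  by apply: seg_ge0 => i _; rewrite le_max lexx.
have lv0 := live_ge0 l gi.
(* If the time of the certificate has passed, its lower bound applies to the set [Y] bought since:
   half a budget is found in truncated purchases or in the reserved offline delay. *)
case: (boolP (if crt gh l is Some C then ct C <= t else false)) => [|old].
  case e: (crt gh l) => [C|//] tau.
  have [relC [mx cf]] := g4 _ _ e.
  have q0 : 0 <= \sum_(i < M | ce C i && ~~ svn Y i) (cu C i - cg C i).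
    by apply: sumr_ge0 => i /andP[/mx[h _] _]; rewrite subr_ge0.
  have h1 := trc_lb B0 q0 (cf Y).
  have h2 : \sum_(i < M | ce C i && ~~ svn Y i) (cu C i - cg C i) <= live gh l.
    rewrite /live e /seg big_mkcond [leRHS]big_mkcond /=; apply: ler_sum => i _.
    case: (boolP (ce C i)) => //= eC; have [h3 h4] := mx _ eC.
    case: ifP => [ns|_]; last by rewrite subr_ge0 le_min !ge_min h3 lexx orbT.
    have h5 := unserved_od (ltn_ord i) (relC _ eC) ns tau.
    move: h4; case: (leP (cg C i) (dl i (ct C))) => h6 h4; last by rewrite h4 !subrr.
    by rewrite h4 !min_l // (le_trans h6).
  by move: h1 h2 bc sg0 lv0; lra.
have cs : chain l / 2 <= csum a t l by have [[]] := sr.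
(* Otherwise a request under the certificate is paid for beyond [t] and has no unpaid delay, so
   those that have some started at this level. *)
have nf i : pd a i -> lv a i = l -> res a t i != 0 ->
    hh a i = dl i (rel i) /\ heavy G Q i (chain l).
  move=> pi li; have [_ _ [|[C [eC h]]]] := g3 _ pi; first by rewrite li.
  move: old; rewrite li in eC; rewrite eC -ltNge => lt2.
  rewrite /res max_l ?subrr ?eqxx //; apply: le_trans h; exact/dl_mono/ltW.
case: (boolP [exists i : 'I_M, [&& pd a i, lv a i == l, res a t i != 0 & svn Y i]]).
  move=> /existsP[i /and4P[pi /eqP li ri sY]].
  have [_ hv] := nf _ pi li ri; have [v vY cv] := hv _ sY.
  suff : chain l / 2 <= \sum_(v in Y) trc G (chain l) v.
    by move: bc sg0 lv0; lra.
  have t0 w : 0 <= trc G (chain l) w by apply: trc_ge0; exact: chain_ge0.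
  rewrite (bigD1 v) //= -[leLHS]addr0 lerD //; last by apply: sumr_ge0.
  have c0 := c_ge0 G v; rewrite /trc ifF; last first.
    apply/negbTE; rewrite -leNgt natrM.
    have n1 : 1 <= n%:R :> R by rewrite ler1n (leq_ltn_trans _ (ltn_ord v)).
    have : c v <= n%:R * c v by rewrite ler_peMl.
    by move: cv; lra.
  by rewrite le_min cv /=; move: B0; lra.
rewrite negb_exists => /forallP nsv.
(* No request with unpaid delay at this level is connected by [Y], so the offline schedule pays all
   of this delay as well. *)
suff : csum a t l <= seg (elig l a) (hh a) (fun i => Num.max (hh a i) (dl i t)).
  have tc : 0 <= Tc l t - Tc l (lst gh l).
    by apply: le_trans bc; apply: sumr_ge0 => v _; apply: trc_ge0; exact: chain_ge0.
  by move: tc lv0 cs; lra.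
rewrite /csum /seg big_mkcond [leRHS]big_mkcond /=; apply: ler_sum => i _.
rewrite /elig; case: (boolP (pd a i)) => //= pi.
have nn : 0 <= Num.min (Num.max (hh a i) (dl i t)) (od i) - Num.min (hh a i) (od i).
  by rewrite subr_ge0 le_min !ge_min le_max !lexx orbT.
case: eqP => [li|_]; last by case: ifP.
rewrite li leqnSn; case: (eqVneq (res a t i) 0) => [->//|ri].
have := nsv i; rewrite pi li eqxx ri /= => ns.
have [li1 _ _] := g3 _ pi; rewrite li in li1.
have h5 := unserved_od (ltn_ord i) li1 ns (lexx t).
move: ri; rewrite /res; case: (leP (hh a i) (dl i t)) => h6; last by rewrite subrr eqxx.
by move=> _; rewrite !min_l // (le_trans h6).
Qed.

(** Levels up to [l] restart at [t] without certificate; the new certificate goes to level [l.+1],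
    to which all unserved eligible requests have moved. The offline delay up to the present value is
    spent on this charge, and the part from there to [u] is reserved in [live]. *)
Lemma charge m now t a a' X l u oc gh : base m a -> ginv m now a gh ->
  now <= t -> (forall i, (m <= i < M)%N -> t < rel i) ->
  serv_rel t a a' X l u oc ->
  exists gh', ginv m t a' gh' /\ wt gh' = wt gh + chain l / 2.
Proof.
move=> ba gi nt fut sr; have key := charge_key ba gi nt sr.
have [dbl lL] := serv_double ba sr.
have [pm mM _ _] := ba; have lge0 j := live_ge0 j gi.
have [[lm l0n] g2 g3 g4 g5] := gi.
have [_ st _ gu cer] := sr.
have ll j : lst gh j <= t by apply: le_trans nt; apply: le_trans l0n; exact: lm.
pose E := elig l a; pose g i := Num.max (hh a i) (dl i t).
pose C tau := Cert E g u tau.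
pose gh' := Ghost (fun j => if (j <= l)%N then t else lst gh j)
  (fun i => if E i then u i else us gh i)
  (fun j => if (j <= l)%N then None else if j == l.+1 then omap C oc else crt gh j)
  (wt gh + chain l / 2).
exists gh'; split=> //; split=> /=.
- split=> // j j' jj; case: leqP => h1; case: leqP => h2 //; first by lia.
  exact: lm.
- move=> i im; have [_ h2] := g2 i im; split; first exact: fut.
  case: ifP => // /andP[/pm]; move: im; lia.
- move=> i; have := st i; rewrite -/E; case EE: (E i); last first.
    move=> [-> -> ->] pi; have ne : (l.+1 < lv a i)%N.
      by move: EE; rewrite /E /elig pi /= ltnNge => ->.
    have [h1 h2 h3] := g3 _ pi.
    by rewrite leqNgt (ltn_trans (ltnSn l) ne) /= (gtn_eqF ne).
  case: ifP => [_ [->//]|/negbT ns [_ -> ->] _].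
  move: EE => /andP[pi li]; have [h1 _ _] := g3 _ pi.
  rewrite ltnn eqxx; split=> //; first by apply: le_lt_trans h1; exact: lm.
  right; case eo: oc cer => [tau|].
    move=> [_ ut _]; exists (C tau); split=> //=.
    by rewrite ut ?le_max ?lexx ?orbT // /elig pi li.
  by move=> /(_ i); rewrite /elig pi li (negbTE ns) => /(_ isT).
- move=> j D; case: leqP => // lj; case: eqP => [jE|_]; last exact: g4.
  case eo: oc cer => [tau|//] /= [_ ut cf] [<-]; split=> /=.
    move=> i /andP[pi li]; have [h1 _ _] := g3 _ pi.
    by rewrite jE; apply: le_lt_trans h1; exact: lm.
  split=> //=; last by rewrite jE.
  by move=> i Ei; split; [exact: gu|exact: ut].
have liveE : \sum_(j < (Lm n).+1) live gh' j <=
    \sum_(j < (Lm n).+1) live gh j - live gh l + seg E g u.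
  have lL2 : (l.+1 < (Lm n).+1)%N by rewrite ltnS.
  rewrite (bigD1 (Ordinal lL2)) //= [X in _ <= X - _ + _](bigD1 (Ordinal (ltnW lL2))) //=.
  rewrite [X in X - _]addrC addrK addrC lerD //; last first.
    rewrite /live /= ltnn eqxx; case: (oc) => [tau|] //=.
    by apply: seg_ge0 => i; exact: gu.
  rewrite big_mkcond [leRHS]big_mkcond /=; apply: ler_sum => j _.
  rewrite -!val_eqE /=; case: (eqVneq (val j) l.+1) => jl /=; first by case: ifP.
  case: (eqVneq (val j) l) => jl2 /=; first by rewrite /live /= jl2 leqnn.
  by rewrite /live /= (negbTE jl); case: ifP => _ //; exact: lge0.
have TcE : \sum_(j < Lm n) Tc j (lst gh j) + (Tc l t - Tc l (lst gh l)) <=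
    \sum_(j < Lm n) Tc j (if (j <= l)%N then t else lst gh j).
  rewrite (bigD1 (Ordinal lL)) //= [leRHS](bigD1 (Ordinal lL)) //= leqnn.
  rewrite addrAC addrCA subrr addr0 lerD2l; apply: ler_sum => j _.
  case: ifP => // _; rewrite /Tc big_mkcond [leRHS]big_mkcond /=.
  have t0 (v : 'I_n) : 0 <= trc G (chain j) v by apply: trc_ge0; exact: chain_ge0.
  apply: ler_sum => tr _; case: ifP => [h|_]; first by rewrite (le_trans h).
  by case: ifP => // _; exact: sumr_ge0.
have usE : \sum_(i < M) (Num.min (if E i then u i else us gh i) (od i) - dl i (rel i)) =
    \sum_(i < M) (Num.min (us gh i) (od i) - dl i (rel i)) + seg E (hh a) g + seg E g u.
  rewrite /seg -addrA -big_split /= [X in _ + X]big_mkcond -big_split /=.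
  apply: eq_bigr => i _; case: ifP => [/andP[pi _]|_]; last by rewrite addr0.
  by have [_ <- _] := g3 _ pi; ring.
rewrite usE; move: liveE TcE g5 key; rewrite -/g -/E; lra.
Qed.

(** Summing by vertices instead of levels leaves one [trc_sum] for each purchase. *)
Lemma wt_bound m now a gh : ginv m now a gh ->
  wt gh <= (lg n + 3)%:R * transmission_cost G S + \sum_(i < M) (od i - dl i (rel i)).
Proof.
move=> gi; have [_ _ _ _ g5] := gi.
have l0 : 0 <= \sum_(l < (Lm n).+1) live gh l.
  by apply: sumr_ge0 => l _; exact: live_ge0 gi.
apply: (@le_trans _ _ (wt gh + \sum_(l < (Lm n).+1) live gh l)); first by rewrite lerDl.
apply: (le_trans g5); rewrite lerD //; last first.
  by apply: ler_sum => i _; rewrite lerD2r ge_min lexx orbT.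
have t0 (l : nat) (v : 'I_n) : 0 <= trc G (chain l) v by apply: trc_ge0; exact: chain_ge0.
apply: (@le_trans _ _ (\sum_(l < Lm n) \sum_(tr <- S) \sum_(v in tr.2) trc G (chain l) v)).
  apply: ler_sum => l _; rewrite /Tc big_mkcond /=; apply: ler_sum => tr _.
  by case: ifP => // _; exact: sumr_ge0.
rewrite exchange_big /= /transmission_cost mulr_sumr; apply: ler_sum => tr _.
rewrite exchange_big /= mulr_sumr; apply: ler_sum => v _; exact: trc_sum.
Qed.

End Charging.

(** * The program *)

Notation "p ';;' q" := (PSeq p q) (at level 61, right associativity).

(* Integer arrays, then real arrays; scalars are stored at index 0. *)
Notation aTab := 0%N (only parsing).
Notation aCnt := 1%N (only parsing).
Notation aPend := 2%N (only parsing).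
Notation aLev := 3%N (only parsing).
Notation aX := 4%N (only parsing).
Notation aRep := 5%N (only parsing).
Notation aAlive := 6%N (only parsing).
Notation aDone := 7%N (only parsing).
Notation aPath := 8%N (only parsing).
Notation aBest := 9%N (only parsing).
Notation aY := 10%N (only parsing).
Notation aUns := 11%N (only parsing).
Notation aSel := 12%N (only parsing).
Notation aFnd := 13%N (only parsing).
Notation aCur := 14%N (only parsing).
Notation aMode := 15%N (only parsing).
Notation aCen := 16%N (only parsing).
Notation aFar := 17%N (only parsing).
Notation aNum := 18%N (only parsing).
Notation aLvn := 19%N (only parsing).
Notation aEl := 20%N (only parsing).
Notation aFlag := 21%N (only parsing).
Notation rB := 0%N (only parsing).
Notation rH := 1%N (only parsing).
Notation rP := 2%N (only parsing).
Notation rC := 3%N (only parsing).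
Notation rD := 4%N (only parsing).
Notation rSum := 5%N (only parsing).
Notation rTau := 6%N (only parsing).
Notation rTau2 := 7%N (only parsing).
Notation rLev := 8%N (only parsing).
Notation rNxt := 9%N (only parsing).
Notation rK := 10%N (only parsing).
Notation rOpt := 11%N (only parsing).
Notation rGam := 12%N (only parsing).
Notation rG := 13%N (only parsing).
Notation rInc := 14%N (only parsing).
Notation rAcc := 15%N (only parsing).
Notation rTmp := 16%N (only parsing).

Definition HS k := HGet k (HLit 0).
Definition HSR k := HGetR k (HLit 0).
Definition HOr b1 b2 := HNot (HAnd (HNot b1) (HNot b2)).
Definition HPos e := HLeN (HLit 1) e.
Definition HLtR e1 e2 := HNot (HLeR e2 e1).
Definition FV x p := PFor x (1, 0, 0)%N p.
Definition FQ x p := PFor x (0, 1, 0)%N p.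
Definition PS k e := PN k (HLit 0) e.
Definition PSR k e := PR k (HLit 0) e.
Definition ix2 e1 e2 := HAdd (HRow e1) e2.
Definition ix3 e1 e2 e3 := HAdd (HRow (ix2 e1 e2)) e3.

(** * Shortest paths between all pairs *)

Definition argmin : prog :=
  PS aFnd (HLit 0) ;;
  FV 23 (PIf (HAnd (HNot (HPos (HGet aDone (HS 23))))
              (HOr (HNot (HPos (HS aFnd)))
                (HLtR (HGetR rD (ix2 (HS 22) (HS 23)))
                  (HGetR rD (ix2 (HS 22) (HS aCur))))))
         (PS aCur (HS 23) ;; PS aFnd (HLit 1))
         PSkip).

Definition relax : prog :=
  FV 23 (PIf (HAnd (HAdj (HS aCur) (HS 23))
               (HLtR (HAddR (HGetR rD (ix2 (HS 22) (HS aCur))) (HGetR rC (HS aCur)))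
                 (HGetR rD (ix2 (HS 22) (HS 23)))))
         (PR rD (ix2 (HS 22) (HS 23))
            (HAddR (HGetR rD (ix2 (HS 22) (HS aCur))) (HGetR rC (HS aCur))) ;;
          FV 24 (PN aPath (ix3 (HS 22) (HS 23) (HS 24))
            (HGet aPath (ix3 (HS 22) (HS aCur) (HS 24)))) ;;
          PN aPath (ix3 (HS 22) (HS 23) (HS aCur)) (HLit 1))
         PSkip).

Definition dijkstra_init : prog :=
  FV 23 (PR rD (ix2 (HS 22) (HS 23)) (HSR rK) ;; PN aDone (HS 23) (HLit 0) ;;
         FV 24 (PN aPath (ix3 (HS 22) (HS 23) (HS 24)) (HLit 0))) ;;
  PR rD (ix2 (HS 22) (HS 22)) (HNat (HLit 0)).

Definition dijkstra : prog :=
  dijkstra_init ;;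
  FV 25 (argmin ;;
         PIf (HPos (HS aFnd)) (PN aDone (HS aCur) (HLit 1) ;; relax) PSkip).

Definition apsp : prog := FV 22 dijkstra.

Section Denotation.
Variables (R : realType) (n : nat) (G : wgraph R n).
Variables (Q : seq (request R n)) (now : R).
Notation den := (den G Q now).
Implicit Types (s : hstate R n).

Definition fset s k : {set 'I_n} := [set v : 'I_n | na s k v != 0%N].

Lemma denSeq p q s : den (p ;; q) s = den q (den p s). Proof. by []. Qed.
Lemma denN k i e s : den (PN k i e) s = setN s k (eN Q s i) (eN Q s e). Proof. by []. Qed.
Lemma denR k i e s : den (PR k i e) s = setR s k (eN Q s i) (eR G Q now s e). Proof. by []. Qed.
Lemma denIf b p q s : den (PIf b p q) s = if eB G Q now s b then den p s else den q s.
Proof. by []. Qed.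
Lemma denSkip s : den PSkip s = s. Proof. by []. Qed.
Definition denE := (denSeq, denN, denR, denIf, denSkip).
Lemma denT k s :
  den (PTransmit k) s = HState (na s) (ra s) (al s) (rcons (ob s) (fset s k)).
Proof. by []. Qed.

End Denotation.

Fixpoint mute (p : prog) : bool :=
  match p with
  | PSeq p1 p2 | PIf _ p1 p2 => mute p1 && mute p2
  | PFor _ _ p => mute p
  | PTransmit _ => false
  | _ => true
  end.

Lemma den_mute (R : realType) n (G : wgraph R n) Q now p s :
  mute p -> ob (den G Q now p s) = ob s.
Proof.
elim: p s => //= [p1 IH1 p2 IH2|b p1 IH1 p2 IH2|x b p IH] s.
- by move=> /andP[m1 m2]; rewrite IH2 ?IH1.
- by move=> /andP[m1 m2]; case: ifP => _; rewrite ?IH1 ?IH2.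
- by move=> m; elim: (bnd Q b) => //= k IHk; rewrite IH.
Qed.

Opaque den.

Section Paths.
Variables (R : realType) (n : nat) (G : wgraph R n).
Variables (Q : seq (request R n)) (now : R).
Notation den := (den G Q now).
Notation sc := (same_component G).
Implicit Types (s : hstate R n) (u v w x a : 'I_n).

Lemma bndV : bnd Q (1, 0, 0)%N = n. Proof. by rewrite /bnd /= mul1n !addn0. Qed.
Lemma bndQ : bnd Q (0, 1, 0)%N = size Q. Proof. by rewrite /bnd /= mul1n !addn0. Qed.

Lemma adjnE u v : adjn G u v = adj G u v.
Proof. by rewrite /adjn /vertex !valK. Qed.

Lemma vcE v : vc G v = vcost G v.
Proof. by rewrite /vc /vertex valK. Qed.

Lemma FV_ind (I : nat -> hstate R n -> Prop) (J : hstate R n -> Prop) (x : nat) p s :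
  I 0%N s ->
  (forall (i : 'I_n) s1, fr (FV x p) s s1 -> I i s1 -> I i.+1 (den p (setN s1 x 0 i))) ->
  (forall s1, fr (FV x p) s s1 -> I n s1 -> J (setN s1 x 0 n)) ->
  J (den (FV x p) s).
Proof.
move=> I0 IS IJ; apply: (for_ind I0); rewrite bndV // => i s1 ib.
exact: (IS (Ordinal ib)).
Qed.

Lemma FQ_ind (I : nat -> hstate R n -> Prop) (J : hstate R n -> Prop) (x : nat) p s :
  I 0%N s ->
  (forall (i : 'I_(size Q)) s1, fr (FQ x p) s s1 -> I i s1 -> I i.+1 (den p (setN s1 x 0 i))) ->
  (forall s1, fr (FQ x p) s s1 -> I (size Q) s1 -> J (setN s1 x 0 (size Q))) ->
  J (den (FQ x p) s).
Proof.
move=> I0 IS IJ; apply: (for_ind I0); rewrite bndQ // => i s1 ib.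
exact: (IS (Ordinal ib)).
Qed.

Definition dD s a v : R := ra s rD (a * n + v)%N.
Definition zZ s a v : {set 'I_n} := [set x : 'I_n | na s aPath ((a * n + v) * n + x)%N != 0%N].

Arguments dD : simpl never.
Arguments zZ : simpl never.

Lemma eq_ix2 (a b v w : nat) : (v < n)%N -> (w < n)%N ->
  (a * n + v == b * n + w)%N = (a == b) && (v == w).
Proof.
move=> vn wn; apply/eqP/andP => [e|[/eqP-> /eqP->]//].
have n0 : (0 < n)%N by apply: leq_ltn_trans vn.
have e1 : a = b.
  by have := congr1 (divn^~ n) e; rewrite !divnMDl // !divn_small // !addn0.
by move: e; rewrite e1 => /addnI->.
Qed.

Lemma row1 a : (a < n * n)%N.
Proof. by apply: (leq_trans (ltn_ord a)); rewrite leq_pmull //; have := ltn_ord a; lia. Qed.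

Lemma row2 a v : (a * n + v < n * n)%N.
Proof. by have := ltn_ord a; have := ltn_ord v; nia. Qed.

Definition argmin_post s a s' :=
  if na s' aFnd 0 is 0 then forall v, na s aDone v != 0%N
  else exists w, [/\ na s' aCur 0 = w, na s aDone w = 0%N &
         forall v, na s aDone v = 0%N -> dD s a w <= dD s a v].

Lemma argmin_spec s a : na s 22 0 = a -> argmin_post s a (den argmin s).
Proof.
move=> sa; rewrite /argmin denSeq.
set s0 := den _ s.
pose I (i : nat) s1 := if na s1 aFnd 0 is 0 then forall v, (v < i)%N -> na s aDone v != 0%N
  else exists w, [/\ na s1 aCur 0 = w, na s aDone w = 0%N &
         forall v, (v < i)%N -> na s aDone v = 0%N -> dD s a w <= dD s a v].
apply: (@FV_ind I (argmin_post s a)).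
- by rewrite /I /s0 denN /=.
- move=> i s1 [fN fR _] Ii.
  have e22 : na s1 22 0 = a by rewrite fN // /s0 denN.
  have eD : na s1 aDone = na s aDone by rewrite fN.
  have eR : ra s1 rD = ra s rD by rewrite fR.
  rewrite denIf; case: ifP; rewrite !denE /= e22 row1 eD eR.
    rewrite -leqNgt leqn0 => /andP[/eqP di cond]; rewrite /I /=.
    exists i; split=> // v; rewrite ltnS leq_eqVlt => /orP[/eqP/val_inj->//|vi dv].
    move: cond Ii; rewrite /I; case: (na s1 aFnd 0) => [_ /(_ v vi)|m]; first by rewrite dv.
    rewrite /= !negbK -ltNge => lt [w [cw _ le]]; rewrite cw in lt.
    exact: le_trans (ltW lt) (le v vi dv).
  move=> cond; move: cond Ii; rewrite /I /=.
  case: (na s1 aFnd 0) => [|m] /=; rewrite -leqNgt leqn0.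
    rewrite andbT => /negbT di Ii v; rewrite ltnS leq_eqVlt => /orP[/eqP/val_inj->//|].
    exact: Ii.
  move=> cond [w [cw dw le]]; exists w; split=> // v.
  rewrite ltnS leq_eqVlt => /orP[/eqP/val_inj->|]; last exact: le.
  by move=> di; move: cond; rewrite di cw /= => /negbFE/negbNE.
- move=> s1 _; rewrite /I /argmin_post /=; case: (na s1 aFnd 0) => [h v|m [w [h1 h2 h3]]].
    exact: h.
  by exists w; split=> // v; exact: h3.
Qed.

Definition others s a s' := forall b v : 'I_n, b != a -> dD s' b v = dD s b v /\ zZ s' b v = zZ s b v.

Lemma dD_setR s a v (x : R) b w : dD (setR s rD (a * n + v) x) b w =
  if (b == a) && (w == v) then x else dD s b w.
Proof. by rewrite /dD /= eq_ix2 ?ltn_ord // !val_eqE. Qed.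

Lemma zZ_setN s a v x (k : nat) b w : zZ (setN s aPath ((a * n + v) * n + x) k) b w =
  if (b == a) && (w == v) then (if k is 0 then zZ s b w :\ x else x |: zZ s b w) else zZ s b w.
Proof.
apply/setP => y; rewrite !inE /= eq_ix2 ?ltn_ord // eq_ix2 ?ltn_ord //.
rewrite !val_eqE; case: (b == a); case: (w == v); rewrite /= ?inE //.
by case: k => [|k]; rewrite !inE; case: (eqVneq y x) => [->|].
Qed.

Lemma dD_setN s (k i x : nat) b w : dD (setN s k i x) b w = dD s b w. Proof. by []. Qed.
Lemma zZ_setR s (k i : nat) (x : R) b w : zZ (setR s k i x) b w = zZ s b w. Proof. by []. Qed.

Lemma dD_fr p s s' b w : fr p s s' -> rD \notin wR p -> dD s' b w = dD s b w.
Proof. by move=> [_ h _] no; rewrite /dD h. Qed.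
Definition copyp : prog := FV 24 (PN aPath (ix3 (HS 22) (HS 23) (HS 24))
            (HGet aPath (ix3 (HS 22) (HS aCur) (HS 24)))).

Lemma copyp_spec s a v w : na s 22 0 = a -> na s 23 0 = v -> na s aCur 0 = w ->
  let s' := den copyp s in forall b u,
  zZ s' b u = if (b == a) && (u == v) then zZ s a w else zZ s b u.
Proof.
move=> sa sv sw s' b u; rewrite {}/s'.

pose I (i : nat) s1 := forall b u x,
  na s1 aPath ((b * n + u) * n + x)%N =
  if [&& b == a, u == v & (x < i)%N] then na s aPath ((a * n + w) * n + x)%N
  else na s aPath ((b * n + u) * n + x)%N.
apply: (@FV_ind I (fun s' => zZ s' b u = if (b == a) && (u == v) then zZ s a w else zZ s b u)).
- by move=> b' u' x; rewrite !andbF.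
- move=> i s1 [fN fR _] Ii b' u' x.
  have [e22 e23 eC] : [/\ na s1 22 = na s 22, na s1 23 = na s 23 & na s1 aCur = na s aCur].
    by split; apply: fN.
  rewrite !denE /= e22 e23 eC sa sv sw !row1 !row2.
  rewrite eq_ix2 ?ltn_ord // eq_ix2 ?ltn_ord // !val_eqE !Ii.
  rewrite ltnn !andbF ltnS (leq_eqVlt x) val_eqE andbA.
  case: (b' == a) => //=; case: (u' == v) => //=.
  by case: (eqVneq x i) => [->|].
- move=> s1 _ Ii; apply/setP => x; rewrite inE /= Ii ltn_ord andbT.
  by case: ifP; rewrite inE.
Qed.

Lemma relax_spec s a w : na s 22 0 = a -> na s aCur 0 = w ->
  let s' := den relax s in
  let up v := adj G w v && (dD s a w + ra s rC w < dD s a v) in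
  others s a s' /\ forall v,
  dD s' a v = (if up v then dD s a w + ra s rC w else dD s a v) /\
  zZ s' a v = (if up v then w |: zZ s a w else zZ s a v).
Proof.
move=> sa sw s' up; rewrite {}/s'.
pose I (i : nat) s1 := others s a s1 /\ forall v,
  dD s1 a v = (if up v && (v < i)%N then dD s a w + ra s rC w else dD s a v) /\
  zZ s1 a v = (if up v && (v < i)%N then w |: zZ s a w else zZ s a v).
have upw : up w = false by rewrite /up adj_irr.
apply: (@FV_ind I (fun s' => others s a s' /\ forall v,
  dD s' a v = (if up v then dD s a w + ra s rC w else dD s a v) /\
  zZ s' a v = (if up v then w |: zZ s a w else zZ s a v))).
- by split=> // v; rewrite andbF.
- move=> i s1 fr1 [oth Ii]; have [fN fR _] := fr1.
  have [e22 eC eRC] : [/\ na s1 22 = na s 22, na s1 aCur = na s aCur & ra s1 rC = ra s rC].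
    by split; [apply: fN|apply: fN|apply: fR].
  have [eDw eZw] : dD s1 a w = dD s a w /\ zZ s1 a w = zZ s a w.
    by have := Ii w; rewrite upw.
  have eDi : dD s1 a i = dD s a i by have [-> _] := Ii i; rewrite ltnn andbF.
  have cond : eB G Q now (setN s1 23 0 i) (HAnd (HAdj (HS aCur) (HS 23))
               (HLtR (HAddR (HGetR rD (ix2 (HS 22) (HS aCur))) (HGetR rC (HS aCur)))
                 (HGetR rD (ix2 (HS 22) (HS 23))))) = up i.
    rewrite /= e22 eC eRC sa sw adjnE !row1 -/(dD s1 a w) -/(dD s1 a i) eDw eDi.
    by rewrite /up ltNge.
  rewrite denIf cond; case: ifP => ui; last first.
    rewrite denE; split=> [b v|v]; first exact: oth.
    rewrite /dD /zZ /= -/(dD s1 a v) -/(zZ s1 a v); have [-> ->] := Ii v.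
    rewrite ltnS (leq_eqVlt v) val_eqE; case: (eqVneq v i) => [->|] //=.
    by rewrite ui.
  rewrite denSeq denR denSeq -/copyp.
  set s2 := setR _ _ _ _.
  have s2a : na s2 22 0 = a by rewrite /s2 /= fN.
  have s2w : na s2 aCur 0 = w by rewrite /s2 /= fN.
  have s2v : na s2 23 0 = i by [].
  have := copyp_spec s2a s2v s2w; have fc := den_fr G Q now copyp s2.
  set s3 := den copyp s2 in fc * => /= cz.
  have s3i k : k \notin wN copyp -> na s3 k = na s2 k by have [h _ _] := fc; exact: h.
  have D2 b v : dD s2 b v = if (b == a) && (v == i) then dD s a w + ra s rC w else dD s1 b v.
    by rewrite /s2 /= e22 eC eRC sa sw !row1 dD_setR -/(dD s1 a w) eDw.
  have Z2 b v : zZ s2 b v = zZ s1 b v by [].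
  clearbody s3; clearbody s2; rewrite denN /= !s3i // s2a s2w s2v row1 row2.
  split=> [b v ba|v].
    rewrite dD_setN zZ_setN (negbTE ba) /= (dD_fr _ _ fc) // D2 cz !Z2 (negbTE ba) /=.
    exact: (oth b v ba).
  rewrite dD_setN zZ_setN eqxx /= (dD_fr _ _ fc) // D2 cz !Z2 eqxx /= eZw.
  case: (eqVneq v i) => [->|ne]; first by rewrite ui ltnSn.
  by have [-> ->] := Ii v; rewrite ltnS (leq_eqVlt v) val_eqE (negbTE ne).
- move=> s1 _ [oth Ii]; split=> // v.
  by rewrite /dD /zZ /= -/(dD s1 a v) -/(zZ s1 a v); have := Ii v; rewrite ltn_ord andbT.
Qed.

(* Distances from [a] are final on the finished vertices [F].                 *)
Definition dijk (C : 'I_n -> R) (K : R) a (d : 'I_n -> R) (z : 'I_n -> {set 'I_n})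
    (F : {set 'I_n}) : Prop :=
  [/\ d a = 0, forall v, 0 <= d v <= K,
      forall v, d v < K -> sc (z v :|: [set v]) a v /\ \sum_(x in z v) C x <= d v,
      forall u v, u \in F -> adj G u v -> d v <= d u + C u &
      forall u v, u \in F -> v \notin F -> d u <= d v].

(** The vertex [w] is a nearest unfinished one and costs are nonnegative, so no finished distance
    can improve. *)
Lemma dijk_step C K a d z (F : {set 'I_n}) w d' z' : (forall v, 0 <= C v) ->
  dijk C K a d z F -> w \notin F -> (forall v, v \notin F -> d w <= d v) ->
  let up v := adj G w v && (d w + C w < d v) in
  (forall v, d' v = (if up v then d w + C w else d v) /\
     z' v = (if up v then w |: z w else z v)) ->
  dijk C K a d' z' (w |: F).
Proof.
move=> C0 [da dK dz dF dd] wF mw up new.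
have d0 v : 0 <= d v by have /andP[] := dK v.
have le v : d' v <= d v.
  by have [-> _] := new v; rewrite /up; case: ifP => // /andP[_ /ltW].
have ge v : Num.min (d v) (d w + C w) <= d' v.
  by have [-> _] := new v; case: ifP => _; rewrite ge_min lexx ?orbT.
have keep v : v \in F -> d' v = d v.
  move=> vF; have [-> _] := new v; rewrite /up; case: ifP => // /andP[_ lt].
  have := dd v w vF wF; have := C0 w; move: lt => /=; move=> *; lra.
have upw : up w = false by rewrite /up adj_irr.
have dw : d' w = d w by have [-> _] := new w; rewrite upw.
split.
- have [-> _] := new a; rewrite da /up da; case: ifP => // /andP[_].
  by rewrite ltNge addr_ge0.
- move=> v; rewrite (le_trans (le v)) ?andbT; last by have /andP[] := dK v.
  by apply: le_trans (ge v); rewrite le_min d0 addr_ge0.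
- move=> v; have [-> ->] := new v; case: ifP => [/andP[wv lt] lt2|_]; last exact: dz.
  have wK : d w < K by have := C0 w; move: lt2; lra.
  have [h1 h2] := dz w wK; split.
    apply: (@sc_adj _ _ _ _ _ w) => //.
      by apply: sc_sub h1; rewrite finset.setUC finset.subsetUl.
    by rewrite !inE eqxx orbT.
  by apply: (le_trans (sum_setU _ _ C0)); rewrite big_set1 addrC lerD2r.
- move=> u v; rewrite !inE => /orP[/eqP->|uF] wv.
    rewrite dw; have [-> _] := new v; rewrite /up wv /=; by case: ltP.
  by rewrite (keep u uF) (le_trans (le v)) // dF.
- move=> u v; rewrite !inE negb_or => /orP[/eqP->|uF] /andP[vw vF].
    by apply: le_trans (ge v); rewrite dw le_min mw // lerDl C0.
  rewrite (keep u uF); apply: le_trans (ge v); rewrite le_min dd //.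
  by apply: le_trans (dd u w uF wF) _; rewrite lerDl C0.
Qed.

Definition clearp : prog := FV 24 (PN aPath (ix3 (HS 22) (HS 23) (HS 24)) (HLit 0)).

Lemma clearp_spec s a v : na s 22 0 = a -> na s 23 0 = v ->
  forall b u, zZ (den clearp s) b u = if (b == a) && (u == v) then finset.set0 else zZ s b u.
Proof.
move=> sa sv b u.
pose I (i : nat) s1 := forall b u x,
  na s1 aPath ((b * n + u) * n + x)%N =
  if [&& b == a, u == v & (x < i)%N] then 0%N else na s aPath ((b * n + u) * n + x)%N.
apply: (@FV_ind I (fun s' => zZ s' b u = if (b == a) && (u == v) then finset.set0 else zZ s b u)).
- by move=> b' u' x; rewrite !andbF.
- move=> i s1 [fN fR _] Ii b' u' x.
  have [e22 e23] : na s1 22 = na s 22 /\ na s1 23 = na s 23 by split; apply: fN.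
  rewrite !denE /= e22 e23 sa sv !row1 !row2.
  rewrite eq_ix2 ?ltn_ord // eq_ix2 ?ltn_ord // !val_eqE !Ii.
  rewrite ltnS (leq_eqVlt x) val_eqE.
  case: (b' == a) => //=; case: (u' == v) => //=.
  by case: (eqVneq x i) => [->|].
- move=> s1 _ Ii; apply/setP => x; rewrite inE /= Ii ltn_ord andbT.
  by case: ifP; rewrite !inE.
Qed.

Lemma dijkstra_init_spec s a : na s 22 0 = a ->
  let s' := den dijkstra_init s in
  [/\ others s a s', forall v, dD s' a v = if v == a then 0 else ra s rK 0,
      forall v, zZ s' a v = finset.set0 & fset s' aDone = finset.set0].
Proof.
move=> sa s'; rewrite {}/s' /dijkstra_init denSeq denR.
pose J s1 := [/\ others s a s1, forall v, dD s1 a v = ra s rK 0,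
      forall v, zZ s1 a v = finset.set0 & fset s1 aDone = finset.set0].
set p := FV 23 _.
have : J (den p s).
  pose I (i : nat) s1 := [/\ others s a s1, forall v, (v < i)%N -> dD s1 a v = ra s rK 0,
      forall v, (v < i)%N -> zZ s1 a v = finset.set0 &
      forall v, (v < i)%N -> na s1 aDone v = 0%N].
  apply: (@FV_ind I J) => //.
    move=> i s1 fr1 [oth ID IZ IF]; have [fN fR _] := fr1.
    have [e22 eK] : na s1 22 = na s 22 /\ ra s1 rK = ra s rK.
      by split; [apply: fN|apply: fR].
    rewrite denSeq denSeq -/clearp denR denN.
    set s2 := setN _ _ _ _.
    have s2a : na s2 22 0 = a by rewrite /s2 /= e22.
    have s2v : na s2 23 0 = i by [].
    have cz := clearp_spec s2a s2v; have [fcN fcR _] := den_fr G Q now clearp s2.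
    have D2 b v : dD s2 b v = if (b == a) && (v == i) then ra s rK 0 else dD s1 b v.
      rewrite /s2 /= e22 eK sa row1; exact: dD_setR.
    have Z2 b v : zZ s2 b v = zZ s1 b v by [].
    have dn v : na s2 aDone v = if v == i :> nat then 0%N else na s1 aDone v by [].
    have Dc b v : dD (den clearp s2) b v = dD s2 b v by rewrite /dD fcR.
    clearbody s2; split=> [b v ba|v|v|v].
    - by rewrite Dc D2 cz !Z2 (negbTE ba) /=; exact: (oth b v ba).
    - rewrite Dc D2 eqxx /= ltnS leq_eqVlt val_eqE.
      by case: (eqVneq v i) => //= _; exact: ID.
    - rewrite cz Z2 eqxx /= ltnS leq_eqVlt val_eqE.
      by case: (eqVneq v i) => //= _; exact: IZ.
    - rewrite fcN // dn ltnS leq_eqVlt val_eqE.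
      by case: (eqVneq v i) => //= _; exact: IF.
  move=> s1 _ [oth ID IZ IF]; split=> [//|v|v|]; [exact: ID|exact: IZ|].
  by apply/setP => v; rewrite !inE /= IF.
have [fN fR _] := den_fr G Q now p s.
set s1 := den p s in fN fR *; move=> [oth D1 Z1 F1].
have e22 : na s1 22 0 = a by rewrite fN.
rewrite /= e22 row1; split=> [b v ba|v|v|//].
- by rewrite dD_setR zZ_setR (negbTE ba) /=; exact: oth.
- by rewrite dD_setR eqxx D1.
- by rewrite zZ_setR.
Qed.

Lemma dijkstra_spec s a (C : 'I_n -> R) K : na s 22 0 = a ->
  (forall v, ra s rC v = C v) -> ra s rK 0 = K -> (forall v, 0 <= C v) -> 0 <= K ->
  let s' := den dijkstra s in
  others s a s' /\ dijk C K a (dD s' a) (zZ s' a) [set: 'I_n].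
Proof.
move=> sa sC sK C0 K0; rewrite /dijkstra denSeq.
have [oth0 D0 Z0 F0] := dijkstra_init_spec sa.
have [fN0 fR0 _] := den_fr G Q now dijkstra_init s.
set s0 := den dijkstra_init s in oth0 D0 Z0 F0 fN0 fR0 *.
have s0a : na s0 22 0 = a by rewrite fN0.
have s0C : ra s0 rC = ra s rC by rewrite fR0.
clearbody s0.
pose P s1 := others s a s1 /\ dijk C K a (dD s1 a) (zZ s1 a) (fset s1 aDone).
pose I (i : nat) s1 := P s1 /\ (i <= #|fset s1 aDone|)%N.
apply: (@FV_ind I (fun s' => others s a s' /\ dijk C K a (dD s' a) (zZ s' a) [set: 'I_n])).
- split=> //; split=> //; split.
  + by rewrite D0 eqxx.
  + by move=> v; rewrite D0 sK; case: ifP => _; rewrite ?lexx ?K0.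
  + move=> v; rewrite D0 Z0 sK; case: eqP => [-> _|_]; last by rewrite ltxx.
    by rewrite big_set0 finset.set0U sc_refl inE.
  + by move=> u v; rewrite F0 inE.
  + by move=> u v; rewrite F0 inE.
- move=> r s1 [fN fR _] [[oth dj] rF].
  have [e22 eC] : na s1 22 = na s0 22 /\ ra s1 rC = ra s0 rC.
    by split; [apply: fN|apply: fR].
  rewrite denSeq; set s2 := setN s1 25 0 r.
  have s2a : na s2 22 0 = a by rewrite /s2 /= e22.
  have am := argmin_spec s2a; have [fN3 fR3 _] := den_fr G Q now argmin s2.
  have [e3r e3z e3d e3C e3a] : [/\ ra (den argmin s2) rD = ra s1 rD, na (den argmin s2) aPath = na s1 aPath,
      na (den argmin s2) aDone = na s1 aDone, ra (den argmin s2) rC = ra s1 rC &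
      na (den argmin s2) 22 = na s1 22].
    by split; rewrite ?fN3 ?fR3.
  set s3 := den argmin s2 in am fN3 fR3 e3r e3z e3d e3C e3a *.
  have D3 b v : dD s3 b v = dD s1 b v by rewrite /dD e3r.
  have Z3 b v : zZ s3 b v = zZ s1 b v by rewrite /zZ e3z.
  clearbody s3; move: am; rewrite /argmin_post denIf.
  rewrite /=; case em : (na s3 aFnd 0) => [|m] /= am.
    rewrite denE; have FT : fset s1 aDone = [set: 'I_n].
      by apply/setP => v; rewrite !inE; exact: am.
    have F3 : fset s3 aDone = [set: 'I_n] by rewrite /fset e3d.
    rewrite /I /P F3 cardsT card_ord ltn_ord; split=> //.
    split; first by move=> b v ba; rewrite D3 Z3; exact: (oth b v ba).
    rewrite -FT; case: dj => h1 h2 h3 h4 h5; split.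
    + by rewrite D3.
    + by move=> v; rewrite D3.
    + by move=> v; rewrite D3 Z3; exact: h3.
    + by move=> u v; rewrite !D3; exact: h4.
    + by move=> u v; rewrite !D3; exact: h5.
  have [w [cw dw le]] := am; rewrite denSeq denN /= cw.
  set s4 := setN s3 aDone w 1.
  have s4a : na s4 22 0 = a by rewrite /s4 /= e3a e22.
  have s4w : na s4 aCur 0 = w by rewrite /s4 /=.
  have [oth5 r5] := relax_spec s4a s4w; have [fN5 fR5 _] := den_fr G Q now relax s4.
  have F5 : fset (den relax s4) aDone = w |: fset s1 aDone.
    apply/setP => v; rewrite !inE fN5 //= e3d.
    by have -> : (v == w :> nat) = (v == w) by []; case: (v == w).
  have C4 v : ra s4 rC v = C v by rewrite /s4 /= e3C eC s0C.
  have D4 b v : dD s4 b v = dD s1 b v by rewrite -D3.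
  have Z4 b v : zZ s4 b v = zZ s1 b v by rewrite -Z3.
  clearbody s4; rewrite /I /P F5; split; last first.
    rewrite cardsU1 inE /=; have -> : na s1 aDone w = 0%N by [].
    by rewrite eqxx add1n ltnS.
  split; first by move=> b v ba; have [-> ->] := oth5 b v ba; rewrite D4 Z4; exact: (oth b v ba).
  apply: (dijk_step C0 dj (w := w)); first by rewrite inE dw.
    by move=> v; rewrite inE negbK => /eqP; exact: le.
  by move=> v; have [-> ->] := r5 v; rewrite C4 !D4 !Z4.
- move=> s1 _ [[oth dj] nF].
  have FT : fset s1 aDone = [set: 'I_n].
    by apply/eqP; rewrite eqEcard finset.subsetT cardsT card_ord.
  rewrite FT in dj; split=> //.
Qed.

(** A path does not pay for its last vertex, since the legs of a spider share their centre.
    Distances are capped at [K], which stands for infinity, and [Z] holds the vertices of a path. *)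
Definition sp (C : 'I_n -> R) K (D : 'I_n -> 'I_n -> R) (Z : 'I_n -> 'I_n -> {set 'I_n}) :=
  forall a, [/\ D a a = 0, forall v, 0 <= D a v <= K,
      forall v, D a v < K -> sc (Z a v :|: [set v]) a v /\ \sum_(x in Z a v) C x <= D a v &
      forall u v, adj G u v -> D a v <= D a u + C u].

Lemma apsp_spec s (C : 'I_n -> R) K :
  (forall v, ra s rC v = C v) -> ra s rK 0 = K -> (forall v, 0 <= C v) -> 0 <= K ->
  sp C K (dD (den apsp s)) (zZ (den apsp s)).
Proof.
move=> sC sK C0 K0.
pose I (i : nat) s1 := forall a, (a < i)%N -> dijk C K a (dD s1 a) (zZ s1 a) [set: 'I_n].
apply: (@FV_ind I (fun s' => sp C K (dD s') (zZ s'))) => //.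
- move=> i s1 [fN fR _] Ii a ai.
  have [eC eK] : ra s1 rC = ra s rC /\ ra s1 rK = ra s rK by split; apply: fR.
  have sia : na (setN s1 22 0 i) 22 0 = i by [].
  have [||||oth dj] := @dijkstra_spec (setN s1 22 0 i) i C K sia; rewrite /= ?eC ?eK //.
  move: ai; rewrite ltnS leq_eqVlt val_eqE; case: (eqVneq a i) => [->//|ne] /= ai.
  case: (Ii a ai) => h1 h2 h3 h4 h5.
  have Da v : dD (den dijkstra (setN s1 22 0 i)) a v = dD s1 a v by have [-> _] := oth a v ne.
  have Za v : zZ (den dijkstra (setN s1 22 0 i)) a v = zZ s1 a v by have [_ ->] := oth a v ne.
  split.
  + by rewrite Da.
  + by move=> v; rewrite Da.
  + by move=> v; rewrite Da Za; exact: h3.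
  + by move=> u v; rewrite !Da; exact: h4.
  + by move=> u v; rewrite !Da; exact: h5.
- move=> s1 _ Ii a; case: (Ii a (ltn_ord a)) => h1 h2 h3 h4 _; split=> // u v.
  by apply: h4; rewrite inE.
Qed.

End Paths.

(** * The greedy forest as a program *)

Definition HXor b1 b2 := HAnd (HOr b1 b2) (HNot (HAnd b1 b2)).
Definition gN k x := HGet k (HS x).
Definition gR k x := HGetR k (HS x).
Definition zero := HNat (HLit 0).
Definition one := HNat (HLit 1).

(** Connectivity by shortest paths: vertices cost 0 inside the set and 1 outside, so two of its
    vertices are connected when their distance is 0. *)
Definition served : prog :=
  FV 26 (PIf (HPos (gN aY 26)) (PR rC (HS 26) zero) (PR rC (HS 26) one)) ;;
  PSR rK one ;;
  apsp ;;
  FQ 26 (PIf (HAnd (HPos (HGet aY (HE1 (HS 26)))) (HAnd (HPos (HGet aY (HE2 (HS 26))))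
           (HLeR (HGetR rD (ix2 (HE1 (HS 26)) (HE2 (HS 26)))) zero)))
         (PN aUns (HS 26) (HLit 0)) (PN aUns (HS 26) (HLit 1))).

Definition residual_cost : prog :=
  FV 27 (PIf (HPos (gN aX 27)) (PR rC (HS 27) zero) (PR rC (HS 27) (HCost (HS 27)))).

Definition mark_reps : prog :=
  FV 27 (PN aFlag (HS 27) (gN aRep 27) ;;
    FV 28 (PIf (HAnd (HNot (HLeN (HS 27) (HS 28))) (HAnd (HPos (gN aRep 28))
             (HLeR (HGetR rD (ix2 (HS 28) (HS 27))) zero)))
           (PN aFlag (HS 27) (HLit 0)) PSkip)).

Definition filter_reps : prog :=
  mark_reps ;; FV 27 (PN aRep (HS 27) (gN aFlag 27)).

Definition hcross q a : hb :=
  HXor (HLeR (HGetR rD (ix2 a (HE1 q))) zero) (HLeR (HGetR rD (ix2 a (HE2 q))) zero).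

Definition best_penalty : prog :=
  PSR rOpt (HSR rK) ;; PS aMode (HLit 0) ;;
  FV 27 (PIf (HPos (gN aRep 27))
    (PSR rAcc zero ;;
     FQ 28 (PIf (HAnd (HPos (gN aAlive 28)) (hcross (HS 28) (HS 27)))
       (PSR rAcc (HAddR (HSR rAcc) (gR rP 28))) PSkip) ;;
     PIf (HLtR (HDivR (HSR rAcc) (HNat (HLit 2))) (HSR rOpt))
       (PSR rOpt (HDivR (HSR rAcc) (HNat (HLit 2))) ;; PS aMode (HLit 1) ;; PS aCen (HS 27))
       PSkip)
    PSkip).

Definition hnear a v b : hb :=
  HAnd (HPos (HGet aRep a)) (HLeR (HGetR rD (ix2 a v)) (HGetR rD (ix2 b v))).

Definition best_spider : prog :=
  FV 27 (PIf (HPos (gN aRep 27))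
    (FV 28 (PS aNum (HLit 0) ;; PSR rSum (gR rC 28) ;;
       FV 29 (PIf (hnear (HS 29) (HS 28) (HS 27))
         (PS aNum (HAdd (HS aNum) (HLit 1)) ;;
          PSR rSum (HAddR (HSR rSum) (HGetR rD (ix2 (HS 29) (HS 28))))) PSkip) ;;
       PIf (HAnd (HLtR (HGetR rD (ix2 (HS 27) (HS 28))) (HSR rK))
             (HAnd (HLeN (HLit 2) (HS aNum))
               (HLtR (HDivR (HSR rSum) (HNat (HS aNum))) (HSR rOpt))))
         (PSR rOpt (HDivR (HSR rSum) (HNat (HS aNum))) ;;
          PS aMode (HLit 2) ;; PS aCen (HS 28) ;; PS aFar (HS 27)) PSkip))
    PSkip).

Definition drop_pairs : prog :=
  FQ 27 (PIf (hcross (HS 27) (HS aCen)) (PN aAlive (HS 27) (HLit 0)) PSkip) ;;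
  PN aRep (HS aCen) (HLit 0).

Definition buy_spider : prog :=
  FV 27 (PIf (hnear (HS 27) (HS aCen) (HS aFar))
    (FV 28 (PIf (HPos (HGet aPath (ix3 (HS 27) (HS aCen) (HS 28))))
      (PN aX (HS 28) (HLit 1)) PSkip)) PSkip) ;;
  PN aX (HS aCen) (HLit 1).

Definition pc_step : prog :=
  residual_cost ;; apsp ;; filter_reps ;; best_penalty ;; best_spider ;;
  PIf (HLeN (HS aMode) (HLit 1))
    (PIf (HPos (HS aMode)) drop_pairs PSkip) buy_spider.

(** The cap [rK] exceeds the sum of all prizes, hence the price per component of any greedy step, so
    capped distances do not affect the choices. *)
Definition pc_init : prog :=
  FV 27 (PSR rAcc zero ;;
    FQ 28 (PIf (HOr (HAnd (HLeN (HE1 (HS 28)) (HS 27)) (HLeN (HS 27) (HE1 (HS 28))))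
                  (HAnd (HLeN (HE2 (HS 28)) (HS 27)) (HLeN (HS 27) (HE2 (HS 28)))))
      (PSR rAcc (HAddR (HSR rAcc) (gR rP 28))) PSkip) ;;
    PIf (HLtR (HCost (HS 27)) (HSR rAcc)) (PN aX (HS 27) (HLit 1)) (PN aX (HS 27) (HLit 0))) ;;
  FV 27 (PN aRep (HS 27) (gN aX 27)) ;;
  FQ 27 (PIf (HAnd (HPos (HGet aX (HE1 (HS 27)))) (HPos (HGet aX (HE2 (HS 27)))))
    (PN aAlive (HS 27) (HLit 1)) (PN aAlive (HS 27) (HLit 0))) ;;
  PSR rK one ;;
  FQ 27 (PSR rK (HAddR (HSR rK) (gR rP 27))).

Definition pc : prog := pc_init ;; FV 26 pc_step.

Section Loops.
Variables (R : realType) (n : nat) (G : wgraph R n).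
Variables (Q : seq (request R n)) (now : R).
Notation den := (den G Q now).
Implicit Types (s : hstate R n).

Section Bound.
Variables (b : nat * nat * nat) (m : nat).
Hypothesis bm : bnd Q b = m.

Lemma loop_sum x p s k (f : 'I_m -> R) :
  (forall (i : 'I_m) s1, fr (PFor x b p) s s1 ->
     ra (den p (setN s1 x 0 i)) k 0 = ra s1 k 0 + f i) ->
  ra (den (PFor x b p) s) k 0 = ra s k 0 + \sum_i f i.
Proof.
move=> H; pose I (i : nat) s1 := ra s1 k 0 = ra s k 0 + \sum_(j < m | (j < i)%N) f j.
apply: (@for_ind _ _ _ _ _ I (fun s' => ra s' k 0 = ra s k 0 + \sum_i f i)).
- by rewrite /I big_pred0 ?addr0.
- rewrite bm => i s1 im fs1 Ii; rewrite /I (H (Ordinal im)) // Ii -addrA; congr (_ + _).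
  rewrite [RHS](bigD1 (Ordinal im)) //= addrC; congr (_ + _); apply: eq_bigl => j.
  rewrite ltnS -val_eqE /=; lia.
- move=> s1 _; rewrite bm /I /= => ->; congr (_ + _); apply: eq_bigl => j.
  by rewrite ltn_ord.
Qed.

Lemma loop_sumN x p s k (f : 'I_m -> nat) : x != k ->
  (forall (i : 'I_m) s1, fr (PFor x b p) s s1 ->
     na (den p (setN s1 x 0 i)) k 0 = na s1 k 0 + f i)%N ->
  na (den (PFor x b p) s) k 0 = (na s k 0 + \sum_i f i)%N.
Proof.
move=> xk H; pose I (i : nat) s1 := na s1 k 0 = (na s k 0 + \sum_(j < m | (j < i)%N) f j)%N.
apply: (@for_ind _ _ _ _ _ I (fun s' => na s' k 0 = (na s k 0 + \sum_i f i)%N)).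
- by rewrite /I big_pred0 ?addn0.
- rewrite bm => i s1 im fs1 Ii; rewrite /I (H (Ordinal im)) // Ii -addnA; congr (_ + _)%N.
  rewrite [RHS](bigD1 (Ordinal im)) //= addnC; congr (_ + _)%N; apply: eq_bigl => j.
  rewrite ltnS -val_eqE /=; lia.
- move=> s1 _; rewrite bm /I /= eq_sym (negbTE xk) => ->; congr (_ + _)%N; apply: eq_bigl => j.
  by rewrite ltn_ord.
Qed.

Lemma loop_map x p s k (f : 'I_m -> R) :
  (forall (i : 'I_m) s1, fr (PFor x b p) s s1 -> forall j : 'I_m,
     ra (den p (setN s1 x 0 i)) k j = if j == i then f i else ra s1 k j) ->
  forall j : 'I_m, ra (den (PFor x b p) s) k j = f j.
Proof.
move=> H j; pose I (i : nat) s1 := forall j : 'I_m, (j < i)%N -> ra s1 k j = f j.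
apply: (@for_ind _ _ _ _ _ I (fun s' => ra s' k j = f j)) => //.
- rewrite bm => i s1 im fs1 Ii l; rewrite (H (Ordinal im)) // ltnS leq_eqVlt -val_eqE /=.
  by case: eqP => //= [e _|_]; [congr f; exact: val_inj|exact: Ii].
- by move=> s1 _ Ii /=; apply: Ii; rewrite bm.
Qed.

Lemma loop_mapN x p s k (f : 'I_m -> nat) : x != k ->
  (forall (i : 'I_m) s1, fr (PFor x b p) s s1 -> forall j : 'I_m,
     na (den p (setN s1 x 0 i)) k j = if j == i then f i else na s1 k j) ->
  forall j : 'I_m, na (den (PFor x b p) s) k j = f j.
Proof.
move=> xk H j; pose I (i : nat) s1 := forall j : 'I_m, (j < i)%N -> na s1 k j = f j.
apply: (@for_ind _ _ _ _ _ I (fun s' => na s' k j = f j)) => //.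
- rewrite bm => i s1 im fs1 Ii l; rewrite (H (Ordinal im)) // ltnS leq_eqVlt -val_eqE /=.
  by case: eqP => //= [e _|_]; [congr f; exact: val_inj|exact: Ii].
- by move=> s1 _ Ii /=; rewrite eq_sym (negbTE xk); apply: Ii; rewrite bm.
Qed.

End Bound.

Definition FV_sum := loop_sum (@bndV R n Q).
Definition FQ_sum := loop_sum (@bndQ R n Q).
Definition FV_sumN := loop_sumN (@bndV R n Q).
Definition FV_map := loop_map (@bndV R n Q).
Definition FQ_map := loop_map (@bndQ R n Q).
Definition FV_mapN := loop_mapN (@bndV R n Q).
Definition FQ_mapN := loop_mapN (@bndQ R n Q).

End Loops.

(** * Specifications of the pieces of a greedy step *)

Section PCspec.
Variables (R : realType) (n : nat) (G : wgraph R n).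
Variables (Q : seq (request R n)) (now : R).
Notation den := (den G Q now).
Notation sc := (same_component G).
Notation c := (vcost G).
Notation N := (size Q).
Implicit Types (s : hstate R n) (u v w a b : 'I_n) (i : 'I_N).
#[local] Hint Extern 0 (is_true (0 <= vcost _ _)) => apply: c_ge0 : core.

Definition en1 i : 'I_n := endp1 (tnth (in_tuple Q) i).
Definition en2 i : 'I_n := endp2 (tnth (in_tuple Q) i).

Lemma onthQ i : onth Q i = Some (tnth (in_tuple Q) i).
Proof. by apply/(tnth_onth _ (in_tuple Q)). Qed.

Lemma ep1E i : ep1 Q i = en1 i. Proof. by rewrite /ep1 onthQ. Qed.
Lemma ep2E i : ep2 Q i = en2 i. Proof. by rewrite /ep2 onthQ. Qed.

Lemma svnE Y i : svn G Q Y i = sv G en1 en2 Y i.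
Proof. by rewrite /svn onthQ. Qed.

Lemma in_fset s k v : (v \in fset s k) = (na s k v != 0%N).
Proof. by rewrite inE. Qed.

(** A path of cost 0 has only free vertices, which are those of [X]. *)
Lemma sp0 (X : {set 'I_n}) C K D Z u w : sp G C K D Z -> (forall v, 0 <= C v) ->
  0 < K -> (forall v, (C v == 0) = (v \in X)) -> u \in X -> w \in X ->
  (D u w <= 0) = sc X u w.
Proof.
move=> spD C0 K0 CX uX wX; have [D0 DK DZ Dt] := spD u; apply/idP/idP => [le|uw].
  have [h1 h2] := DZ w (le_lt_trans le K0); apply: sc_sub h1.
  apply/fintype.subsetP => x; rewrite !inE => /orP[xZ|/eqP->//].
  rewrite -CX eq_le C0 andbT; apply: le_trans le; apply: le_trans h2.
  by rewrite (bigD1 x) //= lerDl sumr_ge0.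
rewrite -D0; have := @path_cost _ _ G X u w (D u) (fun _ => 0) uw.
rewrite big1 // addr0; apply=> // v x vX xX vx.
have : C v == 0 by rewrite CX.
by move=> /eqP cv; apply: (le_trans (Dt v x vx)); rewrite cv.
Qed.

Lemma posE m : (0 < m)%N = (m != 0)%N. Proof. exact: lt0n. Qed.

Lemma served_spec s i : na (den served s) aUns i = ~~ svn G Q (fset s aY) i :> nat.
Proof.
rewrite /served denSeq; set s1 := den _ s.
have [fN1 fR1 _] : fr (FV 26 (PIf (HPos (gN aY 26)) (PR rC (HS 26) zero) (PR rC (HS 26) one))) s s1
  by exact: den_fr.
have C1 v : ra s1 rC v = (v \notin fset s aY)%:R.
  apply: (FV_map (f := fun v : 'I_n => (v \notin fset s aY)%:R)) => k s2 [fN fR _] j.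
  rewrite denIf /= in_fset fN // posE; case: (na s aY k != 0%N); rewrite !denE /=.
    by rewrite -val_eqE.
  by rewrite -val_eqE.
rewrite denSeq; set s2 := den _ s1.
have [fN2 fR2 _] : fr (PSR rK one) s1 s2 by exact: den_fr.
have K2 : ra s2 rK 0 = 1 by rewrite /s2 denE.
have C2 v : ra s2 rC v = (v \notin fset s aY)%:R by rewrite fR2.
rewrite denSeq; have := @apsp_spec _ _ G Q now s2 _ _ C2 K2 (fun=> ler0n _ _) ler01.
have [fN3 fR3 _] := den_fr G Q now apsp s2.
set s3 := den apsp s2 in fN3 fR3 * => spD.
have Y3 : na s3 aY = na s aY by rewrite fN3 // fN2 // fN1.
clearbody s1 s2 s3.
apply: (FQ_mapN (f := fun i => nat_of_bool (~~ svn G Q (fset s aY) i))) => // k s4 [fN fR _] j.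
have e : eB G Q now (setN s4 26 0 k)
  (HAnd (HPos (HGet 10 (HE1 (HS 26))))
     (HAnd (HPos (HGet 10 (HE2 (HS 26))))
        (HLeR (HGetR 4 (ix2 (HE1 (HS 26)) (HE2 (HS 26)))) zero))) = svn G Q (fset s aY) k.
  rewrite /= ep1E ep2E row1 fN // Y3 !posE -!in_fset fR // -/(dD s3 (en1 k) (en2 k)).
  rewrite svnE /sv; case: (boolP (en1 k \in _)) => e1; last by rewrite /same_component (negbTE e1).
  case: (boolP (en2 k \in _)) => e2; last by rewrite /same_component (negbTE e2) /= andbF.
  rewrite /=; apply: (sp0 spD) => //.
  by move=> v; case: (v \in _); rewrite ?eqxx ?oner_eq0.
by rewrite denIf e; case: (svn G Q (fset s aY) k); rewrite !denE /= -val_eqE.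
Qed.

Lemma residual_cost_spec s v : ra (den residual_cost s) rC v = rc G (fset s aX) v.
Proof.
apply: (FV_map (f := fun v : 'I_n => rc G (fset s aX) v)) => k s2 [fN fR _] j.
rewrite /rc in_fset denIf /= fN // posE; by case: (na s aX k != 0%N); rewrite !denE /= ?vcE -val_eqE.
Qed.

Lemma filter_reps_spec s (X : {set 'I_n}) K : sp G (rc G X) K (dD s) (zZ s) -> 0 < K ->
  fset s aRep \subset X -> fset (den filter_reps s) aRep = filt G X (fset s aRep).
Proof.
move=> spD K0 AX; rewrite /filter_reps denSeq.
pose bad v := [exists b in fset s aRep, (b < v)%N && (dD s b v <= 0)].
have [fN1 fR1 _] := den_fr G Q now mark_reps s.
set s1 := den mark_reps s in fN1 fR1 *.
have F1 v : na s1 aFlag v = if bad v then 0%N else na s aRep v.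
  apply: (FV_mapN (f := fun v : 'I_n => if bad v then 0%N else na s aRep v)) => // i s2 [fN fR _].
  rewrite denSeq denN /=; set s3 := setN _ _ _ _.
  have eD b v' : dD s3 b v' = dD s b v' by rewrite /dD /s3 /= fR.
  have eA : na s3 aRep = na s aRep by rewrite /s3 /= fN.
  have e27 : na s3 27 0 = i by [].
  have eF u : na s3 aFlag u = if u == i :> nat then na s aRep i else na s2 aFlag u.
    by rewrite /s3 /= fN.
  clearbody s3.
  pose bj (j : nat) := [exists b in fset s aRep, (b < j)%N && (b < i)%N && (dD s b i <= 0)].
  pose I (j : nat) s4 := forall u : 'I_n, na s4 aFlag u = if u == i then
    (if bj j then 0%N else na s aRep i) else na s2 aFlag u.
  apply: (@FV_ind _ _ _ _ _ I (fun s' => forall u : 'I_n, na s' aFlag u = if u == i then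
    (if bad i then 0%N else na s aRep i) else na s2 aFlag u)).
  - move=> u; rewrite eF /bj; case: ifP => e; rewrite -val_eqE /= e //.
    by case: existsP => // -[b /andP[_]].
  - move=> j s4 [fN4 fR4 _] Ij.
    have [e274 e4A] : na s4 27 = na s3 27 /\ na s4 aRep = na s3 aRep by split; apply: fN4.
    have e4D : ra s4 rD = ra s3 rD by apply: fR4.
    have E : bj j.+1 = bj j || [&& (j < i)%N, j \in fset s aRep & dD s j i <= 0].
      apply/existsP/orP => [[b /andP[bA /andP[/andP[bj1 bi] bD]]]|[/existsP[b /andP[bA /andP[/andP[bj1 bi] bD]]]|/and3P[ji jA jD]]].
      + move: bj1; rewrite ltnS leq_eqVlt => /orP[/eqP/ord_inj e|lt].
          by right; rewrite -e bi bA bD.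
        by left; apply/existsP; exists b; rewrite bA lt bi bD.
      + by exists b; rewrite bA bi bD (ltn_trans bj1).
      + by exists j; rewrite jA ltnSn ji jD.
    rewrite denIf.
    have -> : eB G Q now (setN s4 28 0 j) (HAnd (HNot (HLeN (HS 27) (HS 28)))
        (HAnd (HPos (gN 5 28)) (HLeR (HGetR 4 (ix2 (HS 28) (HS 27))) zero))) =
        [&& (j < i)%N, j \in fset s aRep & dD s j i <= 0].
      by rewrite /= e274 e4A e27 eA row1 posE -in_fset -ltnNge e4D -/(dD s3 j i) eD.
    move=> u; rewrite E; case: ifP => h; rewrite !denE /=; last by rewrite orbF.
    rewrite orbT e274 e27; have -> : (u == i :> nat) = (u == i) by [].
    by case: (eqVneq u i) => // ne; rewrite Ij (negbTE ne).
  - move=> s4 _ Ij u /=; rewrite Ij; case: ifP => // _.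
    suff -> : bj n = bad i by [].
    by rewrite /bj /bad; apply: eq_existsb => b; rewrite ltn_ord.
clearbody s1; set s2 := den _ s1.
have F2 v : na s2 aRep v = na s1 aFlag v.
  apply: (FV_mapN (f := fun v : 'I_n => na s1 aFlag v)) => // i s3 [fN fR _] j.
  by rewrite denN /= fN.
apply/setP => v; rewrite [in RHS]inE in_fset F2 F1 in_fset.
case: (eqVneq (na s aRep v) 0%N) => [->|vA] /=; first by case: ifP.
have spz b : b \in fset s aRep -> (dD s b v <= 0) = sc X b v.
  move=> bA; apply: (sp0 spD) => //; first exact: rc_ge0.
  - by move=> w; rewrite /rc; case: ifP; rewrite ?eqxx // gt_eqF // vcost_gt0.
  - exact: (fintype.subsetP AX).
  - by apply: (fintype.subsetP AX); rewrite in_fset.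
apply/idP/forall_inP => [|ok]; last first.
  rewrite ifF //; apply/negbTE/negP => /exists_inP[b bA /andP[bv]].
  by rewrite spz // => bD; have := ok b bA; rewrite bv bD.
case: ifP => //= nb _ b bA; apply/implyP => bv; apply/negP => bD.
suff : bad v by rewrite nb.
by apply/exists_inP; exists b => //; rewrite bv spz.
Qed.

Definition hx s i a : bool := (dD s a (en1 i) <= 0) (+) (dD s a (en2 i) <= 0).

Lemma hcrossE s q x i a : eN Q s q = i -> eN Q s x = a ->
  eB G Q now s (hcross q x) = hx s i a.
Proof.
move=> eq ex; rewrite /= eq ex ep1E ep2E row1 -/(dD s a (en1 i)) -/(dD s a (en2 i)) /hx.
by do 2 case: (_ <= _).
Qed.

Definition pen s a : R := \sum_(i < N) (if (na s aAlive i != 0%N) && hx s i a then ra s rP i else 0).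

Definition best_penalty_post s s' : Prop :=
  (na s' aMode 0 = 0%N /\ fset s aRep = finset.set0 /\ ra s' rOpt 0 = ra s rK 0) \/
  (na s' aMode 0 = 1%N /\ exists2 e, e \in fset s aRep &
     [/\ na s' aCen 0 = e, ra s' rOpt 0 = pen s e / 2 &
       forall a, a \in fset s aRep -> ra s' rOpt 0 <= pen s a / 2]).

Lemma best_penalty_spec s : (forall a, a \in fset s aRep -> pen s a / 2 < ra s rK 0) ->
  best_penalty_post s (den best_penalty s).
Proof.
move=> pK; rewrite /best_penalty denSeq denR denSeq denN.
set s0 := setN _ _ _ _.
pose P (i : nat) s1 := (na s1 aMode 0 = 0%N /\ (forall a, (a < i)%N -> a \notin fset s aRep) /\ ra s1 rOpt 0 = ra s rK 0) \/
  (na s1 aMode 0 = 1%N /\ exists2 e, e \in fset s aRep &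
     [/\ na s1 aCen 0 = e, ra s1 rOpt 0 = pen s e / 2 &
       forall a, (a < i)%N -> a \in fset s aRep -> ra s1 rOpt 0 <= pen s a / 2]).
apply: (@FV_ind _ _ _ _ _ P (best_penalty_post s)); first by left.
- move=> a s1 [fN fR _] Pa.
  have [eA eP eAl eK eD] : [/\ na s1 aRep = na s aRep, ra s1 rP = ra s rP,
      na s1 aAlive = na s aAlive, ra s1 rK = ra s rK & ra s1 rD = ra s rD].
    by split; rewrite ?fN ?fR.
  rewrite denIf /= eA posE -in_fset; case: ifP => aA; last first.
    rewrite denE; case: Pa => [[h1 [h2 h3]]|[h1 [e eA' [h2 h3 h4]]]]; [left|right].
      split=> //; split=> // b; rewrite ltnS leq_eqVlt => /orP[/eqP/ord_inj->|]; last exact: h2.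
      by rewrite aA.
    split=> //; exists e => //; split=> // b; rewrite ltnS leq_eqVlt => /orP[/eqP/ord_inj->|]; last exact: h4.
    by rewrite aA.
  rewrite denSeq denR /= denSeq; set s2 := setR _ _ _ _; set p2 := FQ 28 _.
  have [fN2 fR2 _] : fr p2 s2 (den p2 s2) by exact: den_fr.
  have S2 : ra (den p2 s2) rAcc 0 = pen s a.
    rewrite /p2 (FQ_sum (f := fun i => if (na s aAlive i != 0%N) && hx s i a then ra s rP i else 0)).
      by rewrite /s2 /= add0r.
    move=> i s3 [fN3 fR3 _]; rewrite denIf.
    have -> : eB G Q now (setN s3 28 0 i) (HAnd (HPos (gN 6 28)) (hcross (HS 28) (HS 27))) =
        (na s aAlive i != 0%N) && hx s i a.
      have c3 : eB G Q now (setN s3 28 0 i) (hcross (HS 28) (HS 27)) = hx s3 i a.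
        by rewrite (@hcrossE _ _ _ i a) //= fN3.
      rewrite [LHS]/= -[X in _ && X]/(eB G Q now (setN s3 28 0 i) (hcross (HS 28) (HS 27))) c3.
      by rewrite fN3 //= eAl posE /hx /dD fR3 //= eD.
    have e3P : ra s3 rP = ra s rP by rewrite fR3.
    by case: ifP => _; rewrite !denE /= ?addr0 // e3P.
  set s3 := den p2 s2 in fN2 fR2 S2 *.
  have [m3 c3 o3 e27] : [/\ na s3 aMode 0 = na s1 aMode 0, na s3 aCen 0 = na s1 aCen 0,
     ra s3 rOpt 0 = ra s1 rOpt 0 & na s3 27 0 = a].
    by split; rewrite ?fN2 ?fR2.
  clearbody s3; rewrite denIf /= S2 o3 -ltNge; case: ifP => lt; rewrite !denE /=.
    right; split=> //; exists a => //=; rewrite S2; split=> // b.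
    rewrite ltnS leq_eqVlt => /orP[/eqP/ord_inj->//|ba bA].
    case: Pa => [[_ [h2 _]]|[_ [e _ [_ _ h4]]]]; first by rewrite (negbTE (h2 b ba)) in bA.
    by apply: (le_trans (ltW lt)); exact: h4.
  have le : ra s1 rOpt 0 <= pen s a / 2 by rewrite leNgt lt.
  case: Pa => [[h1 [h2 h3]]|[h1 [e eA' [h2 h3 h4]]]].
    by move: lt; rewrite h3 pK.
  right; rewrite m3 c3; split=> //; exists e => //; rewrite o3; split=> // b.
  by rewrite ltnS leq_eqVlt => /orP[/eqP/ord_inj->//|]; exact: h4.
- move=> s1 _ [[h1 [h2 h3]]|[h1 [e eA' [h2 h3 h4]]]]; [left|right].
    split=> //; split=> //; apply/setP => a; rewrite finset.in_set0; apply/negbTE; exact: h2.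
  by split=> //; exists e => //; split=> // a; exact: h4.
Qed.

Definition near s b v : {set 'I_n} := [set a in fset s aRep | dD s a v <= dD s b v].
Definition ratio s b v : R :=
  (ra s rC v + \sum_(a in near s b v) dD s a v) / #|near s b v|%:R.
Definition cand s b v : bool :=
  [&& b \in fset s aRep, dD s b v < ra s rK 0 & (2 <= #|near s b v|)%N].

Lemma hnearE s x y z a v b : eN Q s x = a -> eN Q s y = v -> eN Q s z = b ->
  eB G Q now s (hnear x y z) = (a \in near s b v).
Proof.
by move=> ex ey ez; rewrite /= ex ey ez !row1 posE inE in_fset -/(dD s a v) -/(dD s b v).
Qed.

Definition best_spider_post s s' : Prop :=
  [/\ ra s' rOpt 0 <= ra s rOpt 0,
      forall b v, cand s b v -> ra s' rOpt 0 <= ratio s b v &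
      [/\ na s' aMode 0 = na s aMode 0, na s' aCen 0 = na s aCen 0 & ra s' rOpt 0 = ra s rOpt 0] \/
      (na s' aMode 0 = 2%N /\ exists b v, [/\ na s' aCen 0 = v, na s' aFar 0 = b,
         cand s b v & ra s' rOpt 0 = ratio s b v])].

Definition try_spider : prog :=
  PS aNum (HLit 0) ;; PSR rSum (gR rC 28) ;;
  FV 29 (PIf (hnear (HS 29) (HS 28) (HS 27))
    (PS aNum (HAdd (HS aNum) (HLit 1)) ;;
     PSR rSum (HAddR (HSR rSum) (HGetR rD (ix2 (HS 29) (HS 28))))) PSkip) ;;
  PIf (HAnd (HLtR (HGetR rD (ix2 (HS 27) (HS 28))) (HSR rK))
        (HAnd (HLeN (HLit 2) (HS aNum))
          (HLtR (HDivR (HSR rSum) (HNat (HS aNum))) (HSR rOpt))))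
    (PSR rOpt (HDivR (HSR rSum) (HNat (HS aNum))) ;;
     PS aMode (HLit 2) ;; PS aCen (HS 28) ;; PS aFar (HS 27)) PSkip.

Lemma try_spider_spec s b v : na s 27 0 = b -> na s 28 0 = v -> b \in fset s aRep ->
  let s' := den try_spider s in
  if cand s b v && (ratio s b v < ra s rOpt 0) then
    [/\ na s' aMode 0 = 2%N, na s' aCen 0 = v, na s' aFar 0 = b & ra s' rOpt 0 = ratio s b v]
  else [/\ na s' aMode 0 = na s aMode 0, na s' aCen 0 = na s aCen 0,
    na s' aFar 0 = na s aFar 0 & ra s' rOpt 0 = ra s rOpt 0].
Proof.
move=> sb sv bA s'; rewrite {}/s' /try_spider denSeq denN denSeq denR denSeq.
set s0 := setR _ _ _ _; set p := FV 29 _.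
have D0 a u : dD s0 a u = dD s a u by [].
have A0 : na s0 aRep = na s aRep by [].
have n0 : na s0 aNum 0 = 0%N by [].
have c0 : ra s0 rSum 0 = ra s rC v by rewrite /s0 /= sv.
have near0 a u : near s0 a u = near s a u by [].
have [e0b e0v] : na s0 27 0 = b /\ na s0 28 0 = v by rewrite /s0 /= sb sv.
have [m0 ce0 fa0] : [/\ na s0 aMode 0 = na s aMode 0, na s0 aCen 0 = na s aCen 0 & na s0 aFar 0 = na s aFar 0] by [].
have [K0 o0] : ra s0 rK 0 = ra s rK 0 /\ ra s0 rOpt 0 = ra s rOpt 0 by [].
clearbody s0.
have step (a : 'I_n) s1 : fr p s0 s1 ->
    eB G Q now (setN s1 29 0 a) (hnear (HS 29) (HS 28) (HS 27)) = (a \in near s b v) /\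
    ra s1 rD (a * n + na s1 28 0)%N = dD s a v.
  move=> [fN fR _]; have [e27 e28 eA] : [/\ na s1 27 = na s0 27, na s1 28 = na s0 28 & na s1 aRep = na s0 aRep].
    by split; apply: fN.
  have eD : ra s1 rD = ra s0 rD by apply: fR.
  rewrite (@hnearE _ _ _ _ a v b) //= ?e28 ?e27 //; split; last by rewrite eD e0v -D0.
  by rewrite -near0 /near /fset /dD /= eA eD.
have [fN fR _] := den_fr G Q now p s0.
have num : na (den p s0) aNum 0 = #|near s b v|.
  rewrite /p (FV_sumN (f := fun a => nat_of_bool (a \in near s b v))) //.
    by rewrite n0 add0n -sum1_card [RHS]big_mkcond /=; apply: eq_bigr => a _; case: (_ \in _).
  move=> a s1 f1; have [ec eD] := step a s1 f1; rewrite denIf ec.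
  by case: ifP => _; rewrite !denE /= ?addn0.
have sum : ra (den p s0) rSum 0 = ra s rC v + \sum_(a in near s b v) dD s a v.
  rewrite /p (FV_sum (f := fun a => if a \in near s b v then dD s a v else 0)) //.
    by rewrite c0 -big_mkcond.
  move=> a s1 f1; have [ec eD] := step a s1 f1; rewrite denIf ec.
  by case: ifP => _; rewrite !denE /= ?addr0 // row1 eD.
set s1 := den p s0 in fN fR num sum *.
have [e27 e28 eM eC eF] : [/\ na s1 27 = na s0 27, na s1 28 = na s0 28, na s1 aMode = na s0 aMode,
  na s1 aCen = na s0 aCen & na s1 aFar = na s0 aFar] by split; apply: fN.
have [eK eo eD] : [/\ ra s1 rK = ra s0 rK, ra s1 rOpt = ra s0 rOpt & ra s1 rD = ra s0 rD].
  by split; apply: fR.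
clearbody s1; rewrite denIf /= e27 e28 e0b e0v row1 eD -/(dD s0 b v) D0 eK K0 eo o0 num sum.
rewrite -!ltNge -/(ratio s b v).
have -> : cand s b v && (ratio s b v < ra s rOpt 0) =
    [&& dD s b v < ra s rK 0, (2 <= #|near s b v|)%N & ratio s b v < ra s rOpt 0].
  by rewrite /cand bA /= -andbA.
case: [&& _, _ & _]; rewrite !denE /=.
  by rewrite e27 e28 e0b e0v num sum.
by rewrite eM eC eF eo m0 ce0 fa0 o0.
Qed.

Lemma best_spider_spec s : best_spider_post s (den best_spider s).
Proof.
pose P (B : 'I_n -> 'I_n -> bool) s1 :=
  [/\ ra s1 rOpt 0 <= ra s rOpt 0,
      forall b v, B b v -> cand s b v -> ra s1 rOpt 0 <= ratio s b v &
      [/\ na s1 aMode 0 = na s aMode 0, na s1 aCen 0 = na s aCen 0 & ra s1 rOpt 0 = ra s rOpt 0] \/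
      (na s1 aMode 0 = 2%N /\ exists b v, [/\ na s1 aCen 0 = v, na s1 aFar 0 = b,
         cand s b v & ra s1 rOpt 0 = ratio s b v])].
have Psub (B B' : 'I_n -> 'I_n -> bool) s1 : (forall b v, B' b v -> cand s b v -> B b v) -> P B s1 -> P B' s1.
  by move=> sub [h1 h2 h3]; split=> // b v bb cc; apply: h2 => //; exact: sub.
apply: (@FV_ind _ _ _ _ _ (fun k s1 => P (fun b _ => (b < k)%N) s1) (best_spider_post s)).
- by split; [|move=> b v; rewrite ltn0|left].
- move=> b s1 fr1 Pb; have [fN fR _] := fr1.
  have [eA eK eD eC] : [/\ na s1 aRep = na s aRep, ra s1 rK = ra s rK, ra s1 rD = ra s rD & ra s1 rC = ra s rC].
    by split; rewrite ?fN ?fR.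
  rewrite denIf /= eA posE -in_fset; case: ifP => bA; last first.
    rewrite denE; apply: Psub Pb => b' v; rewrite ltnS leq_eqVlt => /orP[/eqP/ord_inj->|//].
    by rewrite /cand bA.
  rewrite -/try_spider; set s2 := setN s1 27 0 b.
  apply: (@FV_ind _ _ _ _ _ (fun k s3 => P (fun b' v => (b' < b)%N || (b' == b) && (v < k)%N) s3)
    (fun s' => P (fun b' _ => (b' < b.+1)%N) s')).
  + apply: Psub Pb => b' v; by rewrite ltn0 andbF orbF.
  + move=> v s3 [fN3 fR3 _] [h1 h2 h3].
    set s4 := setN s3 28 0 v.
    have [e27 eA4] : na s4 27 0 = b /\ na s4 aRep = na s aRep.
      by split; rewrite /s4 /= fN3 // /s2 /= ?eA.
    have [eK4 eD4 eC4 eO4] : [/\ ra s4 rK = ra s rK, ra s4 rD = ra s rD, ra s4 rC = ra s rC & ra s4 rOpt = ra s3 rOpt].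
      by split=> //; rewrite /s4 /= fR3 // /s2 /= ?eK ?eD ?eC.
    have bA4 : b \in fset s4 aRep by rewrite in_fset eA4 -in_fset.
    have := @try_spider_spec s4 b v e27 erefl bA4.
    have nE a u : near s4 a u = near s a u by rewrite /near /fset /dD eA4 eD4.
    have cE : cand s4 b v = cand s b v by rewrite /cand nE /dD in_fset eA4 -in_fset eD4 eK4.
    have rE : ratio s4 b v = ratio s b v by rewrite /ratio nE eC4 /dD eD4.
    rewrite cE rE eO4 /=; set s5 := den try_spider s4.
    case: ifP => [/andP[cbv lt] [h4 h5 h6 h7]|nl [h4 h5 h6 h7]].
      split.
      * by rewrite h7 (le_trans (ltW lt)).
      * move=> b' v'; rewrite ltnS (leq_eqVlt v') andb_orr orbA orbAC orbC.
        move=> /orP[/andP[/eqP-> /eqP/ord_inj->]|old] cc; rewrite h7 //.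
        by apply: (le_trans (ltW lt)); apply: h2.
      * by right; split=> //; exists b, v.
    split.
    * by rewrite h7 h1.
    * move=> b' v'; rewrite ltnS (leq_eqVlt v') andb_orr orbA orbAC orbC.
      move=> /orP[/andP[/eqP-> /eqP/ord_inj->]|old] cc; rewrite h7; last exact: h2.
      by move: nl; rewrite cc /= => /negbT; rewrite -leNgt.
    * by rewrite h4 h5 h6 h7; exact: h3.
  + move=> s3 _ Pn; apply: (Psub _ _ _ _ Pn) => b' v.
    by rewrite ltnS leq_eqVlt ltn_ord andbT orbC.
- by move=> s1 _ [h1 h2 h3]; split=> // b v; apply: h2; exact: ltn_ord.
Qed.

Lemma drop_spec s (e : 'I_n) : na s aCen 0 = e ->
  let s' := den drop_pairs s in
  [/\ fset s' aRep = fset s aRep :\ e, fset s' aX = fset s aX &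
    forall i, (na s' aAlive i != 0%N) = (na s aAlive i != 0%N) && ~~ hx s i e].
Proof.
move=> se s'; rewrite {}/s' /drop_pairs denSeq denN; set p := FQ 27 _.
have [fN fR _] := den_fr G Q now p s.
have al i : na (den p s) aAlive i = if hx s i e then 0%N else na s aAlive i.
  pose I (k : nat) s1 := forall i, na s1 aAlive i = if (i < k)%N && hx s i e then 0%N else na s aAlive i.
  apply: (@FQ_ind _ _ _ _ _ I (fun s' => na s' aAlive i = if hx s i e then 0%N else na s aAlive i)) => //.
    move=> k s1 [fN1 fR1 _] Ik j.
    have e1 : na s1 aCen 0 = e by rewrite fN1.
    rewrite denIf (@hcrossE _ _ _ k e) //.
    have -> : hx (setN s1 27 0 k) k e = hx s k e by rewrite /hx /dD /= fR1.
    case: ifP => h; rewrite !denE /= Ik ltnS (leq_eqVlt j).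
      have -> : (j == k :> nat) = (j == k) by [].
      by case: (eqVneq j k) => [->|] //=; rewrite h.
    have -> : (j == k :> nat) = (j == k) by [].
    by case: (eqVneq j k) => [->|] //=; rewrite h andbF.
  by move=> s1 _ Ik /=; rewrite Ik ltn_ord.
set s1 := den p s in fN fR al *.
have e1 : na s1 aCen 0 = e by rewrite fN.
have [eA eX] : na s1 aRep = na s aRep /\ na s1 aX = na s aX by split; apply: fN.
clearbody s1; rewrite /= e1; split.
- apply/setP => a; rewrite !inE /= eA; have -> : (a == e :> nat) = (a == e) by [].
  by case: (a == e).
- by rewrite /fset /= eX.
- by move=> i; rewrite al; case: (hx s i e); rewrite ?andbT ?andbF.
Qed.

Lemma buy_spec s b v : na s aCen 0 = v -> na s aFar 0 = b ->
  let s' := den buy_spider s in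
  [/\ fset s' aRep = fset s aRep,
    fset s' aX = fset s aX :|: ([set v] :|: \bigcup_(a in near s b v) zZ s a v) &
    forall i, na s' aAlive i = na s aAlive i].
Proof.
move=> sv sb s'; have [fN fR _] := den_fr G Q now buy_spider s.
split; [by rewrite /fset fN| |by move=> i; rewrite /s' fN].
rewrite {}/s' /buy_spider denSeq denN; set p := FV 27 _.
have [fN1 fR1 _] := den_fr G Q now p s.
have eX x : (x \in fset (den p s) aX) = (x \in fset s aX) || (x \in \bigcup_(a in near s b v) zZ s a v).
  pose I (k : nat) s1 := forall x, (x \in fset s1 aX) = (x \in fset s aX) ||
     [exists a in near s b v, (a < k)%N && (x \in zZ s a v)].
  apply: (@FV_ind _ _ _ _ _ I (fun s' => (x \in fset s' aX) = (x \in fset s aX) ||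
     (x \in \bigcup_(a in near s b v) zZ s a v))).
  - by move=> y; case: exists_inP => [[a _]|]; rewrite ?andbF ?orbF.
  - move=> a s1 [fN2 fR2 _] Ia.
    have [e1v e1b eA] : [/\ na s1 aCen 0 = v, na s1 aFar 0 = b & na s1 aRep = na s aRep].
      by split; rewrite fN2.
    have [eD eZ] : ra s1 rD = ra s rD /\ na s1 aPath = na s aPath by split; rewrite ?fN2 ?fR2.
    rewrite denIf (@hnearE _ _ _ _ a v b) //.
    have -> : near (setN s1 27 0 a) b v = near s b v by rewrite /near /fset /dD /= eA eD.
    have ex y : [exists a0 in near s b v, (a0 < a.+1)%N && (y \in zZ s a0 v)] =
        [exists a0 in near s b v, (a0 < a)%N && (y \in zZ s a0 v)] ||
        (a \in near s b v) && (y \in zZ s a v).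
      apply/exists_inP/orP => [[a0 a0n /andP[]]|[/exists_inP[a0 a0n /andP[lt yZ]]|/andP[h1 h2]]].
      + rewrite ltnS leq_eqVlt => /orP[/eqP/ord_inj e|lt] yZ.
          by right; rewrite -e a0n yZ.
        by left; apply/exists_inP; exists a0; rewrite // lt.
      + by exists a0 => //; rewrite yZ (ltn_trans lt).
      + by exists a => //; rewrite ltnSn.
    case: ifP => an; last by rewrite denE => y; rewrite ex an /= orbF; exact: Ia.
    set s2 := setN s1 27 0 a.
    have e2v : na s2 aCen 0 = v by [].
    have e2a : na s2 27 0 = a by [].
    have e2Z : na s2 aPath = na s aPath by [].
    have X2 y : (y \in fset s2 aX) = (y \in fset s1 aX) by rewrite !inE.
    clearbody s2.
    pose I2 (k : nat) s3 := forall y, (y \in fset s3 aX) = (y \in fset s1 aX) ||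
      (y < k)%N && (y \in zZ s a v).
    apply: (@FV_ind _ _ _ _ _ I2 (fun s' => I a.+1 s')).
    + by move=> y; rewrite X2 ltn0 orbF.
    + move=> k s3 [fN3 fR3 _] Ik y.
      have [e3v e3a e3Z] : [/\ na s3 aCen 0 = v, na s3 27 0 = a & na s3 aPath = na s aPath].
        by split; rewrite fN3.
      rewrite denIf /= e3v e3a e3Z row1 row2 posE.
      have -> : (na s aPath ((a * n + v) * n + k)%N != 0%N) = (k \in zZ s a v) by rewrite inE.
      have kk : (y == k :> nat) = (y == k) by [].
      case: ifP => h; rewrite !denE; last first.
        have -> : (y \in fset (setN s3 28 0 k) aX) = (y \in fset s3 aX) by rewrite !inE.
        by rewrite Ik ltnS (leq_eqVlt y) kk; case: (eqVneq y k) => [->|] //=; rewrite h !andbF.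
      rewrite in_fset /= ltnS (leq_eqVlt y) kk; case: (eqVneq y k) => [->|] //=.
        by rewrite h orbT.
      by rewrite -in_fset Ik.
    + move=> s3 _ Ik y; have -> : (y \in fset (setN s3 28 0 n) aX) = (y \in fset s3 aX) by rewrite !inE.
      by rewrite Ik ltn_ord /= Ia ex an /= orbA.
  - move=> s1 _ In.
    have -> : (x \in fset (setN s1 27 0 n) aX) = (x \in fset s1 aX) by rewrite !inE.
    rewrite In; congr (_ || _); apply/exists_inP/bigcupP => [[a h1 /andP[_ h2]]|[a h1 h2]].
      by exists a.
    by exists a; rewrite // ltn_ord.
set s1 := den p s in fN1 fR1 eX *.
have e1 : na s1 aCen 0 = v by rewrite fN1.
clearbody s1; apply/setP => x; rewrite in_fset /= e1 !inE.
have -> : (x == v :> nat) = (x == v) by [].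
case: (eqVneq x v) => [->|_] /=; first by rewrite orbT.
by rewrite -in_fset eX in_fset.
Qed.

End PCspec.

(** * Guarantee of the greedy forest *)

Section PCalg.
Variables (R : realType) (n : nat) (G : wgraph R n).
Variables (Q : seq (request R n)) (now : R).
Notation den := (den G Q now).
Notation sc := (same_component G).
Notation c := (vcost G).
Notation N := (size Q).
Notation en1 := (@en1 R n Q).
Notation en2 := (@en2 R n Q).
Implicit Types (s : hstate R n) (u v w a b : 'I_n) (i : 'I_N).
#[local] Hint Extern 0 (is_true (0 <= vcost _ _)) => apply: c_ge0 : core.

Definition alv s i : bool := na s aAlive i != 0%N.
Definition prz s i : R := ra s rP i.

Definition pcok s := pcinv G en1 en2 (prz s) (fset s aX) (fset s aRep) (alv s).

Lemma filt_id (X A : {set 'I_n}) : filt G X (filt G X A) = filt G X A.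
Proof.
apply/eqP; rewrite finset.eqEsubset filt_sub; apply/fintype.subsetP => a aF.
rewrite inE aF; apply/forall_inP => b bF; apply/implyP => ba; apply/negP => sba.
by move: ba; rewrite (filt_sep bF aF sba) ltnn.
Qed.

(** The price [r] is the minimum over giving up a component and buying a spider, so both hypotheses
    of [spider_lb] hold at [r]. The choice that attains [r] is carried out and makes a component
    disappear. *)
Lemma pc_step_spec s : (forall i, 0 <= prz s i) -> \sum_i prz s i < ra s rK 0 ->
  pcok s ->
  let s' := den pc_step s in
  [/\ pcok s', prz s' =1 prz s, ra s' rK 0 = ra s rK 0 &
    (#|filt G (fset s' aX) (fset s' aRep)| <= #|filt G (fset s aX) (fset s aRep)|.-1)%N].
Proof.
move=> p0 pK ok s'.
have [_ frR _] := den_fr G Q now pc_step s.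
have ep : prz s' =1 prz s by move=> i; rewrite /prz frR.
have eK : ra s' rK 0 = ra s rK 0 by rewrite frR.
suff : pcok s' /\ (#|filt G (fset s' aX) (fset s' aRep)| <= #|filt G (fset s aX) (fset s aRep)|.-1)%N.
  by case.
rewrite /pcok (funext ep) {frR ep eK}; rewrite {}/s' /pc_step.
set X := fset s aX in ok *; set A := fset s aRep in ok *.
set al := alv s in ok; set p := prz s in p0 pK ok *; set K := ra s rK 0 in pK.
have K0 : 0 < K by apply: le_lt_trans pK; exact: sumr_ge0.
rewrite denSeq; have C1 := residual_cost_spec G Q now s; have [fN1 fR1 _] := den_fr G Q now residual_cost s.
set s1 := den residual_cost s in C1 fN1 fR1 *.
have K1 : ra s1 rK 0 = K by rewrite fR1.
rewrite denSeq; have sp2 := @apsp_spec _ _ G Q now s1 _ _ C1 K1 (rc_ge0 G X) (ltW K0).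
have [fN2 fR2 _] := den_fr G Q now apsp s1.
set s2 := den apsp s1 in sp2 fN2 fR2 *.
have C2 v : ra s2 rC v = rc G X v by rewrite fR2.
have AX : A \subset X by case: ok.
have A2 : fset s2 aRep = A by rewrite /A /fset fN2 // fN1.
rewrite denSeq; have F3 := @filter_reps_spec _ _ G Q now s2 X K sp2 K0; rewrite A2 in F3; move: (F3 AX) => {}F3.
have [fN3 fR3 _] := den_fr G Q now filter_reps s2.
set s3 := den filter_reps s2 in F3 fN3 fR3 *.
set F := filt G X A in F3.
have D3 a v : dD s3 a v = dD s2 a v by rewrite /dD fR3.
have Z3 a v : zZ s3 a v = zZ s2 a v by rewrite /zZ fN3.
have sp3 : sp G (rc G X) K (dD s3) (zZ s3).
  have -> : dD s3 = dD s2 by apply/funext => a; apply/funext => v; exact: D3.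
  by have -> : zZ s3 = zZ s2 by apply/funext => a; apply/funext => v; exact: Z3.
have [X3 al3 p3 K3] : [/\ fset s3 aX = X, forall i, (na s3 aAlive i != 0%N) = al i,
   forall i, ra s3 rP i = p i & ra s3 rK 0 = K].
  split.
  - by rewrite /X /fset fN3 // fN2 // fN1.
  - by move=> i; rewrite fN3 // fN2 // fN1.
  - by move=> i; rewrite fR3 // fR2 // fR1.
  - by rewrite fR3 // fR2.
have C3 v : ra s3 rC v = rc G X v by rewrite fR3.
have okF := pcinv_filt p0 ok; rewrite -/F in okF.
have FX : F \subset X by case: okF.
have Xal i : al i -> (en1 i \in X) && (en2 i \in X) by case: ok => _ h _ _; exact: h.
clearbody s1 s2; clear fN1 fR1 fN2 fR2 fN3 fR3 C1 K1 sp2 D3 Z3 C2 A2.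
clearbody s3.
have CX v : (rc G X v == 0) = (v \in X).
  by rewrite /rc; case: ifP; rewrite ?eqxx // gt_eqF // vcost_gt0.
have hxE i a : al i -> a \in F -> hx s3 i a = cross G en1 en2 X i a.
  move=> ai aF; have aX := fintype.subsetP FX _ aF; have /andP[e1X e2X] := Xal i ai.
  by rewrite /hx /cross !(sp0 sp3 (rc_ge0 G X) K0 CX).
have penE a : a \in F -> pen Q s3 a = \sum_(i | al i && cross G en1 en2 X i a) p i.
  move=> aF; rewrite /pen [RHS]big_mkcond /=; apply: eq_bigr => i _; rewrite al3 p3.
  by case: (boolP (al i)) => //= ai; rewrite hxE.
have pen0 a : 0 <= pen Q s3 a.
  by apply: sumr_ge0 => i _; case: ifP => // _; rewrite p3.
have penK a : pen Q s3 a / 2 < K.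
  have : pen Q s3 a <= \sum_i p i.
    by apply: ler_sum => i _; rewrite p3; case: ifP.
  move: (pen0 a) pK => /=; lra.
rewrite denSeq; have P4 : best_penalty_post Q s3 (den best_penalty s3).
  by apply: best_penalty_spec => a _; rewrite K3.
have [fN4 fR4 _] := den_fr G Q now best_penalty s3.
set s4 := den best_penalty s3 in P4 fN4 fR4 *.
rewrite denSeq; have P5 := best_spider_spec G Q now s4.
have [fN5 fR5 _] := den_fr G Q now best_spider s4.
set s5 := den best_spider s4 in P5 fN5 fR5 *.
have [A4 X4 al4 Z4] : [/\ na s4 aRep = na s3 aRep, na s4 aX = na s3 aX,
   na s4 aAlive = na s3 aAlive & na s4 aPath = na s3 aPath] by split; apply: fN4.
have [p4 K4 D4 C4] : [/\ ra s4 rP = ra s3 rP, ra s4 rK = ra s3 rK,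
   ra s4 rD = ra s3 rD & ra s4 rC = ra s3 rC] by split; apply: fR4.
have [A5 X5 al5 Z5] : [/\ na s5 aRep = na s3 aRep, na s5 aX = na s3 aX,
   na s5 aAlive = na s3 aAlive & na s5 aPath = na s3 aPath] by split; rewrite fN5.
have D5 : ra s5 rD = ra s3 rD by rewrite fR5.
clearbody s4 s5; clear fN4 fR4 fN5 fR5.
have nE a v : near s4 a v = [set b in F | dD s3 b v <= dD s3 a v].
  by rewrite /near /fset /dD A4 D4 -F3.
have nE5 a v : near s5 a v = [set b in F | dD s3 b v <= dD s3 a v].
  by rewrite /near /fset /dD A5 D5 -F3.
have cE b v : cand s4 b v = [&& b \in F, dD s3 b v < K & (2 <= #|[set a in F | (dD s3 a v <= dD s3 b v)%R]|)%N].
  by rewrite /cand nE in_fset A4 -in_fset F3 K4 K3 /dD D4.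
have rE b v : ratio s4 b v = (rc G X v + \sum_(a in [set a in F | dD s3 a v <= dD s3 b v]) dD s3 a v)
    / #|[set a in F | dD s3 a v <= dD s3 b v]|%:R.
  by rewrite /ratio nE C4 C3 /dD D4.
have [P51 P52 P53] := P5; rewrite denIf /=.
case: (set_0Vmem F) => [F0|[a0 a0F]].
  have [m4 o4] : na s4 aMode 0 = 0%N /\ ra s4 rOpt 0 = K.
    case: P4 => [[h1 [_ h2]]|[_ [e]]]; first by rewrite h2 K3.
    by rewrite F3 F0 inE.
  have m5 : na s5 aMode 0 = 0%N.
    case: P53 => [[-> _ _]//|[_ [b [v [_ _]]]]].
    by rewrite cE F0 inE.
  rewrite m5 /= denIf /= m5 denSkip.
  have -> : fset s5 aX = X by rewrite /fset X5.
  have -> : fset s5 aRep = F by rewrite /fset A5.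
  have -> : alv s5 = al by apply/funext => i; rewrite /alv al5 al3.
  split=> //; rewrite {1}F0.
  have -> : filt G X (finset.set0 : {set 'I_n}) = finset.set0.
    by apply/eqP; rewrite -finset.subset0 filt_sub.
  by rewrite cards0.
have [m4 [e eF [c4 o4 min4]]] : na s4 aMode 0 = 1%N /\ exists2 e, e \in F &
     [/\ na s4 aCen 0 = e, ra s4 rOpt 0 = pen Q s3 e / 2 &
       forall a, a \in F -> ra s4 rOpt 0 <= pen Q s3 a / 2].
  by rewrite -F3; case: P4 => // -[_ [h _]]; move: a0F; rewrite -F3 h inE.
set r := ra s5 rOpt 0 in P51 P52 P53.
have r0 : 0 <= r.
  case: P53 => [[_ _ ->]|[_ [b [v [_ _ _ ->]]]]]; first by rewrite o4 divr_ge0.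
  rewrite rE divr_ge0 // addr_ge0 ?rc_ge0 // sumr_ge0 // => a _.
  by have [_ h _ _] := sp3 a; have /andP[] := h v.
have rK : r < K by rewrite (le_lt_trans P51) // o4.
have lb Y : r * #|F|%:R <= pcc G en1 en2 p Y.
  have [_ _ cov _] := okF.
  apply: (spider_lb p0 FX (alive := al) (D := dD s3) (K := K)) => //.
  - by move=> a b aF bF; exact: filt_sep aF bF.
  - by move=> a _; have [] := sp3 a.
  - by move=> a v _; have [_ h _ _] := sp3 a; have /andP[] := h v.
  - by move=> a v w _; have [_ _ _ h] := sp3 a; exact: h.
  - by rewrite r0 rK.
  - move=> v b bF bK c2; have cb : cand s4 b v by rewrite cE bF bK c2.
    have := P52 b v cb; rewrite rE ler_pdivlMr // ltr0n; exact: ltnW c2.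
  - move=> a aF; rewrite -penE //; have := min4 a aF; move: P51; lra.
have F1 : (#|F|.-1.+1 = #|F|)%N by rewrite prednK //; apply/card_gt0P; exists a0.
case: P53 => [[m5 c5 r5]|[m5 [b [v [c5 f5 cb rr]]]]]; rewrite ?m5 ?m4 /= ?denIf /= ?m5 ?m4 /=.
  have c5e : na s5 aCen 0 = e by rewrite c5.
  have [hA hX hal] := @drop_spec _ _ G Q now s5 e c5e.
  have pe : \sum_(i | al i && cross G en1 en2 X i e) p i = 2 * r.
    by rewrite -penE // r5 o4 mulrC divfK.
  have [k1 k2] := pcinv_drop okF (filt_id X A) eF r0 lb pe.
  rewrite hA hX; have -> : fset s5 aX = X by rewrite /fset X5.
  have -> : fset s5 aRep = F by rewrite /fset A5.
  split; last by rewrite -ltnS F1.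
  have -> : alv (den drop_pairs s5) = (fun i => al i && ~~ cross G en1 en2 X i e); last exact: k1.
  apply/funext => i; rewrite /alv hal al5 al3; case: (boolP (al i)) => //= ai.
  by rewrite -hxE // /hx /dD D5.
have [hA hX hal] := @buy_spec _ _ G Q now s5 b v c5 f5.
rewrite hA hX nE5; have -> : fset s5 aX = X by rewrite /fset X5.
have -> : fset s5 aRep = F by rewrite /fset A5.
have -> : alv (den buy_spider s5) = al by apply/funext => i; rewrite /alv hal al5 al3.
move: cb rr; rewrite cE rE => /and3P[bF bK c2] rr.
have Zs a w : a \in F -> dD s3 a w < K -> sc (zZ s3 a w :|: [set w]) a w /\
    \sum_(x in zZ s3 a w) rc G X x <= dD s3 a w.
  by move=> _; have [_ _ h _] := sp3 a; exact: h.
have [|k1 k2] := pcinv_spider okF (filt_id X A) r0 lb Zs bF bK c2.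
  by rewrite rr divfK // pnatr_eq0 -lt0n (ltnW c2).
have Zeq : \bigcup_(a in [set a in F | dD s3 a v <= dD s3 b v]) zZ s5 a v =
    \bigcup_(a in [set a in F | dD s3 a v <= dD s3 b v]) zZ s3 a v.
  by apply: eq_bigr => a _; rewrite /zZ Z5.
by rewrite Zeq; split; [exact: k1|rewrite -ltnS F1].
Qed.

Lemma eqnE (x y : nat) : (x <= y)%N && (y <= x)%N = (x == y).
Proof. by rewrite eqn_leq. Qed.

Lemma pc_init_spec s : (forall i, 0 <= prz s i) ->
  let s' := den pc_init s in
  [/\ pcok s', prz s' =1 prz s & ra s' rK 0 = 1 + \sum_i prz s i].
Proof.
move=> p0 s'.
have [_ frR _] := den_fr G Q now pc_init s.
have ep : prz s' =1 prz s by move=> i; rewrite /prz frR.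
suff : pcok s' /\ ra s' rK 0 = 1 + \sum_i prz s i by case.
rewrite /pcok (funext ep) {frR ep}; rewrite {}/s' /pc_init.
rewrite denSeq; set p1 := FV 27 (_ ;; _).
have [fN1 fR1 _] := den_fr G Q now p1 s.
have X1 v : na (den p1 s) aX v = (c v < pay en1 en2 (prz s) v).
  apply: (FV_mapN (f := fun v : 'I_n => nat_of_bool (c v < pay en1 en2 (prz s) v))) => // k s2 [fN fR _] j.
  rewrite denSeq denR /= denSeq; set s3 := setR _ _ _ _; set p3 := FQ 28 _.
  have [fN4 fR4 _] := den_fr G Q now p3 s3.
  have S4 : ra (den p3 s3) rAcc 0 = pay en1 en2 (prz s) k.
    rewrite /p3 (FQ_sum (f := fun i => if (en1 i == k) || (en2 i == k) then prz s i else 0)).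
      by rewrite /s3 /= add0r /pay -big_mkcond.
    move=> i s5 [fN5 fR5 _].
    have e27 : na s5 27 0 = k by rewrite fN5.
    have eP : ra s5 rP = ra s rP by rewrite fR5 // /s3 /= fR.
    rewrite denIf /= e27 ep1E ep2E !eqnE negb_and !negbK !val_eqE.
    by case: ifP => _; rewrite !denE /= ?eP ?addr0.
  set s4 := den p3 s3 in fN4 fR4 S4 *.
  have e27 : na s4 27 0 = k by rewrite fN4.
  have eX : na s4 aX = na s2 aX by rewrite fN4.
  clearbody s4; rewrite denIf /= e27 vcE S4 -ltNge.
  have kk : (j == k :> nat) = (j == k) by [].
  by case: ifP => _; rewrite !denE /= e27 eX kk.
set s1 := den p1 s in fN1 fR1 X1 *; clearbody s1.
rewrite denSeq; set p2 := FV 27 _; have [fN2 fR2 _] := den_fr G Q now p2 s1.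
have A2 v : na (den p2 s1) aRep v = na s1 aX v.
  apply: (FV_mapN (f := fun v : 'I_n => na s1 aX v)) => // k s2 [fN fR _] j.
  by rewrite denN /= fN.
set s2 := den p2 s1 in fN2 fR2 A2 *.
have X2 : na s2 aX = na s1 aX by rewrite fN2.
clearbody s2.
rewrite denSeq; set p3 := FQ 27 (PIf _ _ _); have [fN3 fR3 _] := den_fr G Q now p3 s2.
have al3 i : na (den p3 s2) aAlive i = (en1 i \in fset s1 aX) && (en2 i \in fset s1 aX).
  apply: (FQ_mapN (f := fun i => nat_of_bool ((en1 i \in fset s1 aX) && (en2 i \in fset s1 aX)))) => // k s3 [fN fR _] j.
  rewrite denIf /= ep1E ep2E fN // X2 !posE -!in_fset.
  have kk : (j == k :> nat) = (j == k) by [].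
  by case: ifP => _; rewrite !denE /= kk.
set s3 := den p3 s2 in fN3 fR3 al3 *.
have [X3 A3] : na s3 aX = na s1 aX /\ na s3 aRep = na s2 aRep by split; rewrite fN3.
have P3 : ra s3 rP = ra s rP by rewrite fR3 // fR2 // fR1.
clearbody s3; rewrite denSeq denR /=; set s4 := setR _ _ _ _.
have [fN4 fR4 _] := den_fr G Q now (FQ 27 (PSR rK (HAddR (HSR rK) (gR rP 27)))) s4.
split; last first.
  rewrite (FQ_sum (f := prz s)) //= => i s5 [fN5 fR5 _].
  have eP : ra s5 rP = ra s rP by rewrite fR5.
  by rewrite denR /= eP.
set s5 := den _ s4 in fN4 fR4 *.
have [X5 A5 al5] : [/\ na s5 aX = na s1 aX, na s5 aRep = na s2 aRep & na s5 aAlive = na s3 aAlive].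
  by split; rewrite fN4.
have eX : fset s5 aX = [set u | c u < pay en1 en2 (prz s) u].
  by apply/setP => u; rewrite in_fset X5 X1 inE; case: (_ < _).
have eX1 : fset s1 aX = [set u | c u < pay en1 en2 (prz s) u].
  by rewrite -eX /fset X5.
have eA : fset s5 aRep = fset s5 aX.
  by apply/setP => u; rewrite !in_fset A5 A2 X5.
have eal : alv s5 = (fun i => (en1 i \in fset s1 aX) && (en2 i \in fset s1 aX)).
  by apply/funext => i; rewrite /alv al5 al3; case: (_ && _).
rewrite eA eX eal eX1; exact: pcinv_init.
Qed.

Lemma pc_spec s : (forall i, 0 <= prz s i) ->
  let s' := den pc s in
  prz s' =1 prz s /\
  forall Y, pcc G en1 en2 (prz s) (fset s' aX) <= gam R n * pcc G en1 en2 (prz s) Y.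
Proof.
move=> p0; rewrite /pc denSeq; have [ok1 p1 K1] := pc_init_spec p0.
set s1 := den pc_init s in ok1 p1 K1 *; clearbody s1.
(* There are at most [n] components and every round removes one while any is left, so [n] rounds
   suffice. *)
pose I (k : nat) s2 := [/\ pcok s2, prz s2 =1 prz s, ra s2 rK 0 = 1 + \sum_i prz s i &
  (#|filt G (fset s2 aX) (fset s2 aRep)| <= n - k)%N].
apply: (@FV_ind _ _ _ _ _ I (fun s' => prz s' =1 prz s /\
  forall Y, pcc G en1 en2 (prz s) (fset s' aX) <= gam R n * pcc G en1 en2 (prz s) Y)).
- by split=> //; rewrite subn0 (leq_trans (max_card _)) // card_ord.
- move=> k s2 _ [ok2 p2 K2 c2]; set s3 := setN s2 26 0 k.
  have ok3 : pcok s3 by [].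
  have p3 i : prz s3 i = prz s i by exact: p2.
  have [] := @pc_step_spec s3 _ _ ok3.
  + by move=> i; rewrite p3.
  + have -> : \sum_i prz s3 i = \sum_i prz s i by apply: eq_bigr => i _; exact: p3.
    by rewrite [ra s3 rK 0]K2 ltrDr.
  + move=> ok4 p4 K4 c4; split=> //.
    * by move=> i; rewrite p4 p3.
    * by rewrite K4.
    apply: (leq_trans c4); have : (#|filt G (fset s3 aX) (fset s3 aRep)| <= n - k)%N by [].
    lia.
- move=> s2 _ [ok2 p2 K2 c2]; split; first exact: p2.
  move=> Y; have -> : fset (setN s2 26 0 n) aX = fset s2 aX by [].
  move: ok2; rewrite /pcok (funext p2) => ok2.
  apply: (pcinv_end p0 ok2); apply/eqP; rewrite -cards_eq0 -leqn0.
  by move: c2; rewrite subnn.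
Qed.

End PCalg.

(** * The query for the time at which a delay is reached *)

Section Reach.
Local Open Scope classical_set_scope.
Local Open Scope ring_scope.
Variables (R : realType) (n : nat) (q : request R n).

Lemma delay_le s t : release q <= s -> s <= t -> delay q s <= delay q t.
Proof.
move=> rs st; apply: delay_homo => //; rewrite in_itv /= andbT //.
exact: le_trans rs st.
Qed.

Lemma delay_ivt s y : release q <= s -> delay q s <= y ->
  exists2 t, s <= t & delay q t = y.
Proof.
move=> rs dy; have [T sT yT] : exists2 T, s <= T & y <= delay q T.
  have /cvgryPge /(_ y) [M [_ H]] := @delay_infty _ _ q.
  exists (Num.max s (M + 1)); first by rewrite le_max lexx.
  by apply: H; rewrite lt_max ltrDl ltr01 orbT.
have cont : {within `[s, T], continuous (delay q)}.
  apply: continuous_subspaceW (@delay_cont _ _ q) => t /=.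
  by rewrite !in_itv /= => /andP[st _]; rewrite andbT (le_trans rs).
have [|c cT dc] := IVT sT cont (v := y).
  by rewrite ge_min le_max dy yT orbT.
by exists c => //; move: cT; rewrite in_itv /= => /andP[].
Qed.

Lemma reach_spec s y : release q <= s -> delay q s < y ->
  s <= reach_time q y /\ delay q (reach_time q y) = y.
Proof.
move=> rs dy; rewrite /reach_time; set E := [set t | _].
have [t0 st0 dt0] := delay_ivt rs (ltW dy).
have Et0 : E t0 by split; rewrite ?dt0 // (le_trans rs).
have lbE b : (forall t, release q <= t -> t < b -> delay q t < y) -> lbound E b.
  by move=> h t [rt yt]; rewrite leNgt; apply/negP => /(h t rt); rewrite ltNge yt.
have sE : s <= inf E.
  apply: lb_le_inf; first by exists t0.
  apply: lbE => t rt ts; apply: le_lt_trans dy; apply: delay_le => //; exact: ltW.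
have hE : has_lbound E.
  by exists s; apply: lbE => t rt ts; apply: le_lt_trans dy; apply: delay_le => //; exact: ltW.
split=> //; apply/eqP; rewrite eq_le -{2}dt0; apply/andP; split.
  rewrite -dt0; apply: delay_le; first exact: le_trans rs sE.
  exact: ge_inf.
rewrite dt0 leNgt; apply/negP => lt.
have rE : release q <= inf E by exact: le_trans rs sE.
(* If the delay at the infimum were below [y], continuity would give a later time [t1] with the
   intermediate value [z]; by monotonicity [E] does not start before [t1]. *)
pose z := (delay q (inf E) + y) / 2.
have [z1 z2] : delay q (inf E) < z /\ z < y by rewrite /z; split; lra.
have [t1 it1 dt1] := delay_ivt rE (ltW z1).
have it2 : inf E < t1.
  by rewrite lt_neqAle it1 andbT; apply: contraTneq z1 => ->; rewrite dt1 ltxx.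
have : t1 <= inf E.
  apply: lb_le_inf; first by exists t0.
  apply: lbE => t rt tt; apply: le_lt_trans z2; rewrite -dt1; apply: delay_le => //.
  exact: ltW.
by rewrite leNgt it2.
Qed.

End Reach.

Section ReachIndex.
Variables (R : realType) (n : nat) (Q : seq (request R n)).
Implicit Types (i : 'I_(size Q)).

Lemma rch_spec i s x : rel Q i <= s -> dl Q i s < x ->
  s <= rch Q i x /\ dl Q i (rch Q i x) = x.
Proof.
rewrite /rel /dl /rch onthQ /= /delay_at => rs; rewrite (max_idPr rs) => lt.
have [h1 h2] := reach_spec rs lt; split=> //.
by rewrite (max_idPr (le_trans rs h1)).
Qed.

End ReachIndex.

Definition aStop := 30%N.

Definition next : prog :=
  PSR rTmp zero ;; FV 26 (PSR rTmp (HAddR (HSR rTmp) (HCost (HS 26)))) ;;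
  FV 26 (PIf (HAnd (HLeR (HSR rLev) (HMulR (HNat (HAdd HV HV)) (HCost (HS 26))))
                (HLtR (HCost (HS 26)) (HSR rTmp)))
           (PSR rTmp (HCost (HS 26))) PSkip) ;;
  PIf (HLeR (HAddR (HSR rLev) (HSR rLev)) (HSR rTmp)) (PSR rNxt (HSR rTmp))
    (PSR rNxt (HAddR (HSR rLev) (HSR rLev))).

Definition light_served : prog :=
  FV 26 (PIf (HLeR (HCost (HS 26)) (HSR rLev)) (PN aY (HS 26) (HLit 1)) (PN aY (HS 26) (HLit 0))) ;;
  served.

Definition newq : hn := HSub HQ (HLit 1).

(** The nested loops make [Lm n] rounds, enough to find a level for any pair connected in the graph.
    A pair that is still not served can be served by no schedule, and never becomes pending. *)
Definition init_level : prog :=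
  PSR rLev zero ;; next ;; PSR rLev (HSR rNxt) ;; PS aLvn (HLit 0) ;;
  FV 27 (PFor 28 (1, 0, 4)%N (light_served ;;
    PIf (HPos (HGet aUns newq))
      (next ;; PSR rLev (HSR rNxt) ;; PS aLvn (HAdd (HS aLvn) (HLit 1))) PSkip)) ;;
  light_served ;;
  PIf (HPos (HGet aUns newq)) (PN aPend newq (HLit 0)) (PN aPend newq (HLit 1)) ;;
  PN aLev newq (HS aLvn) ;; PR rB newq (HSR rLev) ;; PR rH newq (HDelay newq HNow).

(** This discretises time: the next moment considered is the first at which a selected request has
    gained its increment [rInc]. *)
Definition advance : prog :=
  PS aFnd (HLit 0) ;;
  FQ 26 (PIf (HPos (gN aSel 26))
    (PIf (HLeR (gR rG 26) (HDelay (HS 26) (HSR rTau)))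
       (PSR rTmp (HDelay (HS 26) (HSR rTau))) (PSR rTmp (gR rG 26)) ;;
     PSR rTmp (HReach (HS 26) (HAddR (HSR rTmp) (gR rInc 26))) ;;
     PIf (HOr (HNot (HPos (HS aFnd))) (HLtR (HSR rTmp) (HSR rTau2)))
       (PSR rTau2 (HSR rTmp) ;; PS aFnd (HLit 1)) PSkip)
    PSkip).

Section Programs.
Variables (R : realType) (n : nat) (G : wgraph R n).
Variables (Q : seq (request R n)) (now : R).
Notation den := (den G Q now).
Notation c := (vcost G).
Notation N := (size Q).
Notation chain := (chain G).
Notation svn := (svn G Q).
Notation dl := (dl Q).
Implicit Types (s : hstate R n) (u v w a b : 'I_n) (i : 'I_N).
#[local] Hint Extern 0 (is_true (0 <= vcost _ _)) => apply: c_ge0 : core.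

Lemma next_spec s : ra (den next s) rNxt 0 = nextB G (ra s rLev 0).
Proof.
rewrite /next denSeq denR denSeq; set s0 := setR _ _ _ _.
set p1 := FV 26 (PSR _ _); have [fN1 fR1 _] := den_fr G Q now p1 s0.
have S1 : ra (den p1 s0) rTmp 0 = ctot G.
  by rewrite /p1 (FV_sum (f := fun v => c v)) /= ?add0r // => v s1 _; rewrite denR /= vcE.
set s1 := den p1 s0 in fN1 fR1 S1 *.
have L1 : ra s1 rLev 0 = ra s rLev 0 by rewrite fR1.
clearbody s1; clear fN1 fR1; set B := ra s rLev 0 in L1 *.
rewrite denSeq; set p2 := FV 26 _; have [fN2 fR2 _] := den_fr G Q now p2 s1.
have S2 : ra (den p2 s1) rTmp 0 = \big[Num.min/ctot G]_(v | B <= (2 * n)%:R * c v) c v.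
  pose I (k : nat) s2 := ra s2 rTmp 0 =
    \big[Num.min/ctot G]_(v < n | (v < k)%N && (B <= (2 * n)%:R * c v)) c v.
  apply: (@FV_ind _ _ _ _ _ I (fun s' => ra s' rTmp 0 = _)).
  - by rewrite /I big_pred0.
  - move=> v s2 [fN fR _] Iv.
    have L2 : ra s2 rLev 0 = B by rewrite fR.
    have E x : \big[Num.min/ctot G]_(w < n | (w < v.+1)%N && (B <= (2 * n)%:R * c w)) c w =
      if B <= (2 * n)%:R * c v then Num.min (c v) (\big[Num.min/ctot G]_(w < n | (w < v)%N && (B <= (2 * n)%:R * c w)) c w)
      else \big[Num.min/ctot G]_(w < n | (w < v)%N && (B <= (2 * n)%:R * c w)) c w + x * 0.
      rewrite mulr0 addr0; case: ifP => h.
        rewrite (bigD1 v) ?ltnSn //=; congr Num.min; apply: eq_bigl => w.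
        by rewrite ltnS -val_eqE /=; case: (ltngtP w v); rewrite ?andbF ?andbT.
      apply: eq_bigl => w; rewrite ltnS leq_eqVlt val_eqE.
      by case: (eqVneq w v) => [->|] //=; rewrite h andbF.
    rewrite denIf /I (E 0) mulr0 addr0 /= vcE L2 Iv addnn -mul2n.
    case: (B <= _) => /=; last by rewrite denE.
    by rewrite -ltNge; case: ltP => _; rewrite !denE /= ?vcE.
  - by move=> s2 _; rewrite /I /= => ->; apply: eq_bigl => v; rewrite ltn_ord.
set s2 := den p2 s1 in fN2 fR2 S2 *.
have L2 : ra s2 rLev 0 = B by rewrite fR2.
clearbody s2; have e2 : B + B = 2 * B by ring.
rewrite denIf /= L2 S2 /nextB e2.
by case: leP => _; rewrite !denE /= ?S2 ?L2.
Qed.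

(** So the program can start from the budget 0 and obtain the first level by [next] too. *)
Lemma chain0E : nextB G 0 = chain 0.
Proof.
rewrite /nextB mulr0 /chain /=; rewrite (eq_bigl xpredT); last first.
  by move=> v; rewrite mulr_ge0.
by apply/max_idPr; rewrite -[X in _ <= X]/(chain 0) chain_ge0.
Qed.

Lemma light_served_spec s i :
  na (den light_served s) aUns i = ~~ svn (light G (ra s rLev 0)) i :> nat.
Proof.
rewrite /light_served denSeq served_spec; congr (nat_of_bool (~~ svn _ _)).
apply/setP => v; rewrite in_fset inE.
rewrite (FV_mapN (f := fun v : 'I_n => nat_of_bool (c v <= ra s rLev 0))) //; first by case: (_ <= _).
move=> k s1 [fN fR _] j; rewrite denIf /= vcE fR //.
have kk : (j == k :> nat) = (j == k) by [].
by case: (_ <= _); rewrite !denE /= kk.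
Qed.

(** For loops that merely repeat: nested ones reach a polynomial number of repetitions, counted by
    [m]. *)
Lemma rep_ind (I : nat -> hstate R n -> Prop) x (b : nat * nat * nat) (k : nat) (p : prog) m0 s :
  (forall m s1 y, I m s1 -> I m (setN s1 x 0 y)) ->
  (forall m s1, fr (PFor x b p) s s1 -> I m s1 -> I (m + k)%N (den p s1)) ->
  I m0 s -> I (m0 + bnd Q b * k)%N (den (PFor x b p) s).
Proof.
move=> Ix IS I0; apply: (@for_ind _ _ _ _ _ (fun j s1 => I (m0 + j * k)%N s1)
  (fun s1 => I (m0 + bnd Q b * k)%N s1)).
- by rewrite addn0.
- move=> j s1 jb fs1 Ij; rewrite mulSnr addnA; apply: IS; last exact: Ix.
  apply: fr_trans fs1 (fr_setN _ _ _ _); by rewrite /= inE eqxx.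
- by move=> s1 _ In; exact: Ix.
Qed.

Lemma init_level_spec s : (0 < N)%N ->
  let j := N.-1 in let s' := den init_level s in
  [/\ forall i, i != j :> nat -> [/\ na s' aPend i = na s aPend i, na s' aLev i = na s aLev i,
        ra s' rB i = ra s rB i & ra s' rH i = ra s rH i],
      [/\ (forall l, (l < na s' aLev j)%N -> ~~ svn (light G (chain l)) j),
        ra s' rB j = chain (na s' aLev j), ra s' rH j = dl j now &
        (na s' aPend j != 0%N) = svn (light G (chain (na s' aLev j))) j] &
      svn [set: 'I_n] j -> na s' aPend j != 0%N].
Proof.
move=> N0 j s'; rewrite {}/s' /init_level.
have jN : (j < N)%N by rewrite prednK.
rewrite denSeq denR denSeq; set s0 := setR _ _ _ _.
have := next_spec s0; have [fN1 fR1 _] := den_fr G Q now next s0.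
set s1 := den next s0 in fN1 fR1 * => L1.
rewrite [ra s0 _ _]/= chain0E in L1.
have [P1 E1 B1 H1] : [/\ na s1 aPend = na s aPend, na s1 aLev = na s aLev, ra s1 rB = ra s rB & ra s1 rH = ra s rH].
  by split; rewrite ?fN1 ?fR1.
clearbody s1; clear fN1 fR1 s0.
rewrite denSeq denR denSeq denN /= L1; set s2 := setN _ _ _ _.
pose I (m : nat) s3 := exists l, [/\ na s3 aLvn 0 = l, ra s3 rLev 0 = chain l, (l <= m)%N,
  (forall l', (l' < l)%N -> ~~ svn (light G (chain l')) j) &
  ((l < m)%N -> svn (light G (chain l)) j)].
rewrite denSeq; set p := FV 27 _; have [fN3 fR3 _] := den_fr G Q now p s2.
have I3 : I (Lm n) (den p s2).
  have -> : Lm n = (0 + bnd Q (1,0,0)%N * (bnd Q (1, 0, 4)%N * 1))%N.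
    by rewrite /bnd /= /Lm; lia.
  apply: rep_ind; first by [].
    move=> m s3 _ I0; apply: rep_ind I0; first by [].
    move=> {}m s4 _ [l [l1 l2 l3 l4 l5]]; rewrite denSeq.
    have U := light_served_spec s4 (Ordinal jN); rewrite l2 /= in U.
    have [fN5 fR5 _] := den_fr G Q now light_served s4.
    set s5 := den light_served s4 in U fN5 fR5 *.
    have [e1 e2] : na s5 aLvn 0 = l /\ ra s5 rLev 0 = chain l by rewrite fN5 // fR5.
    clearbody s5; rewrite denIf; have -> : eB G Q now s5 (HPos (HGet aUns newq)) = ~~ svn (light G (chain l)) j.
      by rewrite /= subn1 -/j U; case: (svn _ _).
    case: (boolP (svn (light G (chain l)) j)) => [sl|ns]; rewrite /=.
      rewrite denSkip; exists l; split=> //; lia.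
    rewrite denSeq denSeq denR; have := next_spec s5; have [fN6 fR6 _] := den_fr G Q now next s5.
    set s6 := den next s5 in fN6 fR6 *; rewrite e2 -chainS => e3.
    rewrite denN /= -/s6; exists l.+1; split=> //=.
    - by rewrite fN6 // e1 addn1.
    - have : ~~ (l < m)%N by apply: contra ns.
      by rewrite -leqNgt => ml; rewrite addn1 ltnS.
    - move=> l'; rewrite ltnS leq_eqVlt => /orP[/eqP->//|]; exact: l4.
    - have : ~~ (l < m)%N by apply: contra ns.
      by rewrite addn1 ltnS -leqNgt => h1 h2; lia.
  by exists 0%N; split.
set s3 := den p s2 in fN3 fR3 I3 *.
have [P3 E3 B3 H3] : [/\ na s3 aPend = na s aPend, na s3 aLev = na s aLev, ra s3 rB = ra s rB & ra s3 rH = ra s rH].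
  by split; rewrite ?fN3 ?fR3.
clearbody s3; clear fN3 fR3.
have [l [l1 l2 l3 l4 l5]] := I3.
have fin : svn [set: 'I_n] j -> svn (light G (chain l)) j.
  move=> h; move: l3; rewrite leq_eqVlt => /orP[/eqP->|]; last exact: l5.
  exact: light_Lm.
rewrite denSeq; have U := light_served_spec s3 (Ordinal jN); rewrite l2 /= in U.
have [fN5 fR5 _] := den_fr G Q now light_served s3.
set s5 := den light_served s3 in U fN5 fR5 *.
have [e1 e2] : na s5 aLvn 0 = l /\ ra s5 rLev 0 = chain l by rewrite fN5 // fR5.
have [P5 E5 B5 H5] : [/\ na s5 aPend = na s aPend, na s5 aLev = na s aLev, ra s5 rB = ra s rB & ra s5 rH = ra s rH].
  by split; rewrite ?fN5 ?fR5.
clearbody s5; clear fN5 fR5.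
rewrite denSeq denIf; have -> : eB G Q now s5 (HPos (HGet aUns newq)) = ~~ svn (light G (chain l)) j.
  by rewrite /= subn1 -/j U; case: (svn _ _).
set s6 := if _ then _ else _.
have s6P k : na s6 aPend k = if k == j then nat_of_bool (svn (light G (chain l)) j) else na s aPend k.
  by rewrite /s6; case: (svn _ _) => /=; rewrite denN /= subn1 P5.
have [s6a s6b s6c s6d s6e] : [/\ na s6 aLvn = na s5 aLvn, ra s6 rLev = ra s5 rLev, na s6 aLev = na s aLev, ra s6 rB = ra s rB & ra s6 rH = ra s rH].
  by rewrite /s6; case: ifP => _; rewrite denN.
clearbody s6; rewrite denSeq denN denSeq !denR /= subn1 -/j s6a s6b e1 e2.
split.
- by move=> i /negbTE ij; rewrite ij s6P ij s6c s6d s6e.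
- by rewrite !eqxx s6P eqxx; split=> //; case: (svn _ _).
- by move=> /fin h; rewrite s6P eqxx h.
Qed.

Definition goalv s i : R := Num.max (ra s rG i) (dl i (ra s rTau 0)) + ra s rInc i.

Definition advance_post s s' : Prop :=
  if na s' aFnd 0 is 0 then forall i, na s aSel i = 0%N
  else [/\ ra s rTau 0 <= ra s' rTau2 0,
    forall i, na s aSel i != 0%N -> dl i (ra s' rTau2 0) <= goalv s i &
    exists2 i : 'I_N, na s aSel i != 0%N & dl i (ra s' rTau2 0) = goalv s i].

Lemma advance_spec s : (forall i, rel Q i <= ra s rTau 0) ->
  (forall i, na s aSel i != 0%N -> 0 < ra s rInc i) ->
  advance_post s (den advance s).
Proof.
move=> rt inc; rewrite /advance denSeq denN /=; set s0 := setN _ _ _ _.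
pose x i := goalv s i.
pose I (k : nat) s1 := if na s1 aFnd 0 is 0 then forall i : 'I_N, (i < k)%N -> na s aSel i = 0%N
  else [/\ ra s rTau 0 <= ra s1 rTau2 0,
    forall i : 'I_N, (i < k)%N -> na s aSel i != 0%N -> dl i (ra s1 rTau2 0) <= x i &
    exists2 i : 'I_N, na s aSel i != 0%N & dl i (ra s1 rTau2 0) = x i].
apply: (@FQ_ind _ _ _ _ _ I (advance_post s)).
- by rewrite /I /=.
- move=> k s1 [fN fR _] Ik.
  have [eS eG eI eT] : [/\ na s1 aSel = na s aSel, ra s1 rG = ra s rG, ra s1 rInc = ra s rInc & ra s1 rTau = ra s rTau].
    by split; rewrite ?fN ?fR.
  rewrite denIf /= eS posE; case: ifP => sk; last first.
    rewrite denSkip /I /=; move: Ik; rewrite /I.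
    case: (na s1 aFnd 0) => [|m].
      by move=> h i; rewrite ltnS leq_eqVlt => /orP[/eqP->|]; [move/negbFE: sk => /eqP|exact: h].
    move=> [h1 h2 h3]; split=> // i; rewrite ltnS leq_eqVlt => /orP[/eqP->|]; last exact: h2.
    by rewrite sk.
  rewrite denSeq denIf /= eG eT.
  set s2 := if _ then _ else _.
  have [t2 [p1 p2 p3]] : ra s2 rTmp 0 = Num.max (ra s rG k) (dl k (ra s rTau 0)) /\
     [/\ na s2 aFnd 0 = na s1 aFnd 0, ra s2 rTau2 0 = ra s1 rTau2 0 &
       (na s2 26 0 = k /\ ra s2 rInc = ra s rInc)].
    by rewrite /s2; case: leP => h; rewrite denR /= ?eT ?eG eI.
  have [p5 p4] := p3; clearbody s2.
  rewrite denSeq denR /= t2 p5 p4 -/(x k).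
  have xk : dl k (ra s rTau 0) < x k.
    by rewrite /x /goalv (le_lt_trans (y := Num.max (ra s rG k) (dl k (ra s rTau 0)))) ?le_max ?lexx ?orbT // ltrDl inc.
  have [r1 r2] := rch_spec (rt k) xk.
  set tk := rch Q k (x k) in r1 r2 *.
  rewrite denIf /= p1 p2 !negbK.
  case: (posnP (na s1 aFnd 0)) => f1.
    rewrite /= denSeq denR denN /I /=; split=> //; last by exists k.
    move: Ik; rewrite /I f1 => Ik i; rewrite ltnS leq_eqVlt => /orP[/eqP/ord_inj->|ik].
      by rewrite r2.
    by rewrite Ik.
  move: Ik; rewrite /I; case: (na s1 aFnd 0) f1 p1 => // m _ p1 [h1 h2 [i0 h3 h4]].
  rewrite /= -ltNge; case: ltP => lt; rewrite ?denSeq ?denR ?denN ?denSkip /=.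
    split=> //; last by exists k.
    move=> i; rewrite ltnS leq_eqVlt => /orP[/eqP/ord_inj->|ik si]; first by rewrite r2.
    by apply: le_trans (h2 i ik si); apply: dl_mono; exact: ltW.
  rewrite p1 /= p2; split=> //; last by exists i0.
  move=> i; rewrite ltnS leq_eqVlt => /orP[/eqP/ord_inj->|ik si]; last exact: h2.
  by move=> _; rewrite -r2; exact: dl_mono.
- move=> s1 _; rewrite /I /advance_post /=; case: (na s1 aFnd 0) => [|m].
    by move=> h i; apply: h.
  by move=> [h1 h2 h3]; split=> // i; apply: h2.
Qed.

End Programs.

(** * Setting the alarm *)

Definition criticalp : prog :=
  PS aMode (HLit 0) ;;
  FQ 26 (PIf (HPos (gN aPend 26))
    (PSR rAcc zero ;;
     FQ 27 (PIf (HAnd (HPos (gN aPend 27))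
                  (HAnd (HLeN (gN aLev 27) (gN aLev 26)) (HLeN (gN aLev 26) (gN aLev 27))))
       (PIf (HLeR (gR rH 27) (HDelay (HS 27) (HSR rTau)))
          (PSR rAcc (HAddR (HSR rAcc) (HSubR (HDelay (HS 27) (HSR rTau)) (gR rH 27)))) PSkip)
       PSkip) ;;
     PIf (HLeR (HDivR (gR rB 26) (HNat (HLit 2))) (HSR rAcc))
       (PS aMode (HLit 1) ;; PS aCur (HS 26)) PSkip)
    PSkip).

Definition twoN : hr := HNat (HAdd HQ HQ).

Definition alarm_setup : prog :=
  FQ 26 (PN aSel (HS 26) (gN aPend 26) ;; PR rG (HS 26) (gR rH 26) ;;
         PR rInc (HS 26) (HDivR (gR rB 26) twoN)).

Definition alarm_step : prog :=
  criticalp ;;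
  PIf (HPos (HS aMode)) PSkip
    (alarm_setup ;; advance ;; PIf (HPos (HS aFnd)) (PSR rTau (HSR rTau2)) PSkip).

Definition any_pending : prog :=
  PS aFnd (HLit 0) ;; FQ 26 (PIf (HPos (gN aPend 26)) (PS aFnd (HLit 1)) PSkip).

(** The exact moment at which a level becomes critical is not sought. Jumps by a fraction [1 / 2N]
    of a budget overshoot it by at most half a budget, which [serv_cost] tolerates. *)
Definition next_alarm : prog :=
  PSR rTau HNow ;; FQ 28 (FQ 29 alarm_step) ;;
  any_pending ;; PIf (HPos (HS aFnd)) (PAlarm (HSR rTau)) PSkip.

Section Alarm.
Variables (R : realType) (n : nat) (G : wgraph R n).
Variables (Q : seq (request R n)) (now : R).
Notation den := (den G Q now).
Notation N := (size Q).
Notation chain := (chain G).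
Notation svn := (svn G Q).
Notation dl := (dl Q).
Implicit Types (s : hstate R n) (u v w a b : 'I_n) (i : 'I_N).

Definition abst s : astate R :=
  AState (fun k => (k < N)%N && (na s aPend k != 0%N))
    (fun k => if (k < N)%N then na s aLev k else 0%N)
    (fun k => if (k < N)%N then ra s rH k else 0).

Lemma resE s t i : res Q (abst s) t i = Num.max (ra s rH i) (dl i t) - ra s rH i.
Proof. by rewrite /res /= ltn_ord. Qed.

Definition csm s t l : R := csum Q (abst s) t l.

Lemma csmE s t l : csm s t l =
  \sum_(i < N) (if (na s aPend i != 0%N) && (na s aLev i == l) then res Q (abst s) t i else 0).
Proof. by rewrite /csm /csum big_mkcond /=; apply: eq_bigr => i _; rewrite ltn_ord. Qed.

Definition critical_post s s' : Prop :=
  if na s' aMode 0 is 0 then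
    forall i, na s aPend i != 0%N -> csm s (ra s rTau 0) (na s aLev i) < ra s rB i / 2
  else exists i, [/\ na s' aCur 0 = i, na s aPend i != 0%N &
    ra s rB i / 2 <= csm s (ra s rTau 0) (na s aLev i)].

Lemma criticalp_spec s : critical_post s (den criticalp s).
Proof.
rewrite /criticalp denSeq denN /=; set s0 := setN _ _ _ _.
pose I (k : nat) s1 := if na s1 aMode 0 is 0 then
    forall i : 'I_N, (i < k)%N -> na s aPend i != 0%N -> csm s (ra s rTau 0) (na s aLev i) < ra s rB i / 2
  else exists i, [/\ na s1 aCur 0 = i, na s aPend i != 0%N &
    ra s rB i / 2 <= csm s (ra s rTau 0) (na s aLev i)].
apply: (@FQ_ind _ _ _ _ _ I (critical_post s)).
- by rewrite /I.
- move=> k s1 [fN fR _] Ik.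
  have [eP eL eB eH eT] : [/\ na s1 aPend = na s aPend, na s1 aLev = na s aLev, ra s1 rB = ra s rB, ra s1 rH = ra s rH & ra s1 rTau = ra s rTau].
    by split; rewrite ?fN ?fR.
  rewrite denIf /= eP posE; case: ifP => pk; last first.
    rewrite denSkip /I /=; move: Ik; rewrite /I; case: (na s1 aMode 0) => // h i.
    by rewrite ltnS leq_eqVlt => /orP[/eqP->|]; [rewrite pk|exact: h].
  rewrite denSeq denR /= denSeq; set s2 := setR _ _ _ _; set p := FQ 27 _.
  have [fN3 fR3 _] := den_fr G Q now p s2.
  have S3 : ra (den p s2) rAcc 0 = csm s (ra s rTau 0) (na s aLev k).
    rewrite csmE /p (FQ_sum (f := fun i => if (na s aPend i != 0%N) && (na s aLev i == na s aLev k)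
      then res Q (abst s) (ra s rTau 0) i else 0)); first by rewrite /s2 /= add0r.
    move=> i s4 [fN4 fR4 _].
    have [e4P e4L e4H e4T e26] : [/\ na s4 aPend = na s aPend, na s4 aLev = na s aLev, ra s4 rH = ra s rH, ra s4 rTau = ra s rTau & na s4 26 0 = k].
      by split; rewrite ?fN4 ?fR4.
    rewrite denIf /= e4P e4L e26 posE -eqn_leq; case: ifP => _; last by rewrite denSkip addr0.
    rewrite denIf /= e4H e4T resE; case: leP => _; rewrite ?denR ?denSkip /= ?subrr ?addr0 //.
    by rewrite e4H e4T.
  set s3 := den p s2 in fN3 fR3 S3 *.
  have [e26 eM eC eB3] : [/\ na s3 26 0 = k, na s3 aMode 0 = na s1 aMode 0, na s3 aCur 0 = na s1 aCur 0 & ra s3 rB = ra s rB].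
    by split; rewrite ?fN3 ?fR3.
  clearbody s3; rewrite denIf /= e26 eB3 S3; case: ifP => h.
    by rewrite denSeq !denN /I /= e26; exists k.
  rewrite denSkip /I eM eC; move: Ik; rewrite /I; case: (na s1 aMode 0) => // hh i.
  rewrite ltnS leq_eqVlt => /orP[/eqP/ord_inj-> _|]; last exact: hh.
  by rewrite ltNge h.
- move=> s1 _; rewrite /I /critical_post /=; case: (na s1 aMode 0) => // h i; exact: h.
Qed.

Definition keep s s' : Prop :=
  [/\ na s' aPend = na s aPend, na s' aLev = na s aLev, ra s' rB = ra s rB,
    ra s' rH = ra s rH & na s' aCnt = na s aCnt].

Lemma keep_fr p s s' : fr p s s' -> aPend \notin wN p -> aLev \notin wN p ->
  rB \notin wR p -> rH \notin wR p -> aCnt \notin wN p -> keep s s'.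
Proof. by move=> [fN fR _] h1 h2 h3 h4 h5; split; rewrite ?fN ?fR. Qed.

Lemma keep_trans s1 s2 s3 : keep s1 s2 -> keep s2 s3 -> keep s1 s3.
Proof. by move=> [a1 a2 a3 a4 a5] [b1 b2 b3 b4 b5]; split; rewrite ?b1 ?b2 ?b3 ?b4 ?b5. Qed.

Lemma keep_abst s s' : keep s s' -> abst s' = abst s.
Proof. by move=> [e1 e2 _ e3 _]; rewrite /abst e1 e2 e3. Qed.

Lemma alarm_setup_spec s : let s' := den alarm_setup s in forall i,
  [/\ na s' aSel i = na s aPend i, ra s' rG i = ra s rH i &
     ra s' rInc i = ra s rB i / (N + N)%:R].
Proof.
move=> s' i; rewrite {}/s'; split.
- apply: (FQ_mapN (f := fun i => na s aPend i)) => // k s1 [fN fR _] j.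
  by rewrite !denE /= fN.
- apply: (FQ_map (f := fun i => ra s rH i)) => // k s1 [fN fR _] j.
  by rewrite !denE /= fR.
- apply: (FQ_map (f := fun i => ra s rB i / (N + N)%:R)) => // k s1 [fN fR _] j.
  by rewrite !denE /= fR.
Qed.

Section Step.
Variable s0 : hstate R n.
Hypothesis rel_now : forall i, rel Q i <= now.
Hypothesis B_gt0 : forall i, na s0 aPend i != 0%N -> 0 < ra s0 rB i.
Hypothesis B_lev : forall i, na s0 aPend i != 0%N -> ra s0 rB i = chain (na s0 aLev i).

(** The unit is the increment of one jump, so a jump adds at least 1. While no level is critical a
    request accounts for less than [N], hence [N * N] jumps suffice. *)
Definition prog_measure (t : R) : R :=
  \sum_(i < N) (if na s0 aPend i != 0%N then res Q (abst s0) t i * (N + N)%:R / ra s0 rB i else 0).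

Definition crit_at (t : R) : Prop :=
  exists i, na s0 aPend i != 0%N /\ ra s0 rB i / 2 <= csm s0 t (na s0 aLev i).

Lemma res_csm t i : na s0 aPend i != 0%N -> res Q (abst s0) t i <= csm s0 t (na s0 aLev i).
Proof.
move=> pi; rewrite csmE (bigD1 i) //= pi eqxx /= lerDl; apply: sumr_ge0 => j _.
by case: ifP => // _; exact: res_ge0.
Qed.

Lemma res_mono t t' i : t <= t' -> res Q (abst s0) t i <= res Q (abst s0) t' i.
Proof. by move=> tt; rewrite !resE lerD2r ge_max !le_max lexx (dl_mono _ _ tt) orbT. Qed.

Lemma measure_small t : ~ crit_at t -> (exists i, na s0 aPend i != 0%N) ->
  prog_measure t < (N * N)%:R.
Proof.
move=> nc [i0 p0]; have N0 : (0 < N)%N by apply: leq_ltn_trans (ltn_ord i0).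
have Nr : 0 < N%:R :> R by rewrite ltr0n.
have small i : na s0 aPend i != 0%N -> res Q (abst s0) t i * (N + N)%:R / ra s0 rB i < N%:R.
  move=> pi; have B0 := B_gt0 pi; rewrite ltr_pdivrMr //.
  have : res Q (abst s0) t i < ra s0 rB i / 2.
    apply: le_lt_trans (res_csm t pi) _; rewrite ltNge; apply/negP => h.
    by apply: nc; exists i.
  rewrite natrD => lt; nra.
have -> : (N * N)%:R = \sum_(i < N) N%:R :> R by rewrite sumr_const card_ord natrM mulr_natr.
rewrite /prog_measure.
rewrite (bigD1 i0) //= [ltRHS](bigD1 i0) //= p0; apply: ltr_leD; first exact: small.
by apply: ler_sum => i _; case: ifP => [/small/ltW|_] //; exact: ler0n.
Qed.

Definition alarm_inv m s : Prop :=
  [/\ keep s0 s, now <= ra s rTau 0, forall l, csm s0 (ra s rTau 0) l <= chain l &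
    (exists i, na s0 aPend i != 0%N) -> crit_at (ra s rTau 0) \/ m%:R <= prog_measure (ra s rTau 0)].

Lemma alarm_step_spec m s : alarm_inv m s -> alarm_inv (m + 1)%N (den alarm_step s).
Proof.
move=> [kp nt cs pm]; rewrite /alarm_step denSeq.
have C1 := criticalp_spec s; have f1 := den_fr G Q now criticalp s.
have k1 : keep s (den criticalp s) by apply: (keep_fr f1).
set s1 := den criticalp s in C1 f1 k1 *; have [_ fR1 _] := f1.
have T1 : ra s1 rTau 0 = ra s rTau 0 by rewrite fR1.
have kp1 := keep_trans kp k1.
have csE t l : csm s t l = csm s0 t l by rewrite /csm (keep_abst kp).
have [eP eL eB eH _] := kp.
set t := ra s rTau 0 in nt cs pm T1 *.
clearbody s1; move: C1; rewrite /critical_post -/t denIf /=; case: (na s1 aMode 0) => [|q] C1 /=; last first.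
  rewrite denSkip; split; rewrite ?T1 // => _; left; move: C1 => [i [_ h1 h2]].
  by exists i; rewrite -eP -eB -eL -csE.
have nc : ~ crit_at t.
  move=> [i [pi]]; rewrite leNgt -csE -eB -eL; apply/negP/negPn; apply: C1; by rewrite eP.
rewrite denSeq; have S2 := alarm_setup_spec s1; have f2 := den_fr G Q now alarm_setup s1.
have k2 : keep s1 (den alarm_setup s1) by apply: (keep_fr f2).
set s2 := den alarm_setup s1 in S2 f2 k2 *; have [_ fR2 _] := f2.
have T2 : ra s2 rTau 0 = t by rewrite fR2.
have kp2 := keep_trans kp1 k2.
have [P1 L1 B1 H1 _] := kp1.
have S2' i : [/\ na s2 aSel i = na s0 aPend i, ra s2 rG i = ra s0 rH i & ra s2 rInc i = ra s0 rB i / (N + N)%:R].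
  by have [-> -> ->] := S2 i; rewrite P1 B1 H1.
clearbody s2; rewrite denSeq; have A3 : advance_post Q s2 (den advance s2).
  apply: advance_spec => i; first by rewrite T2 (le_trans (rel_now i)).
  have [-> _ ->] := S2' i => pi; rewrite divr_gt0 ?B_gt0 // ltr0n addn_gt0.
  by rewrite (leq_ltn_trans _ (ltn_ord i)).
have f3 := den_fr G Q now advance s2; have k3 : keep s2 (den advance s2) by apply: (keep_fr f3).
set s3 := den advance s2 in A3 f3 k3 *; have [_ fR3 _] := f3.
have T3 : ra s3 rTau 0 = t by rewrite fR3.
have kp3 := keep_trans kp2 k3; clearbody s3.
move: A3; rewrite /advance_post T2 denIf /=; case: (na s3 aFnd 0) => [|q] A3 /=.
  rewrite denSkip; split; rewrite ?T3 // => -[i]; have [e _ _] := S2' i.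
  by rewrite -e A3.
rewrite denR /=; set t' := ra s3 rTau2 0 in A3 *.
have gE i : goalv s2 i = Num.max (ra s0 rH i) (dl i t) + ra s0 rB i / (N + N)%:R.
  by rewrite /goalv T2; have [_ -> ->] := S2' i.
have [tt up [i0 p0 eq0]] := A3.
have {}up i : na s0 aPend i != 0%N -> res Q (abst s0) t' i <= res Q (abst s0) t i + ra s0 rB i / (N + N)%:R.
  move=> pi; have [e _ _] := S2' i; have := up i; rewrite e gE => /(_ pi) le.
  rewrite !resE addrAC lerD2r ge_max le // andbT.
  rewrite (le_trans (y := Num.max (ra s0 rH i) (dl i t))) ?le_max ?lexx //.
  by rewrite lerDl divr_ge0 // ltW // B_gt0.
have {}p0 : na s0 aPend i0 != 0%N by have [e _ _] := S2' i0; rewrite -e.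
have {}eq0 : res Q (abst s0) t' i0 = res Q (abst s0) t i0 + ra s0 rB i0 / (N + N)%:R.
  apply/eqP; rewrite eq_le up //= !resE eq0 gE addrAC lerD2r le_max lexx ?orbT //.
have N0 : (0 < N)%N by apply: leq_ltn_trans (ltn_ord i0).
have NN : 0 < (N + N)%:R :> R by rewrite ltr0n addn_gt0 N0.
have T4 : ra (setR s3 rTau 0 t') rTau 0 = t' by [].
have k4 : keep s0 (setR s3 rTau 0 t') by [].
split; rewrite ?T4 //.
- exact: le_trans nt tt.
- move=> l; case: (boolP [exists i : 'I_N, (na s0 aPend i != 0%N) && (na s0 aLev i == l)]); last first.
    move=> no; rewrite csmE big1 ?chain_ge0 // => i _; rewrite ifF //.
    by apply/negbTE; move: no; rewrite negb_exists => /forallP.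
  move=> /existsP[i1 /andP[p1 /eqP l1]].
  have lt : csm s0 t l < chain l / 2.
    by rewrite -csE -l1 -(B_lev p1) -eB -eL; apply: C1; rewrite eP.
  (* At most [N] requests gain at most [chain l / 2N] each, on top of less than half the budget. *)
  suff : csm s0 t' l <= csm s0 t l + chain l / 2 by move: lt; lra.
  apply: (@le_trans _ _ (csm s0 t l + \sum_(i < N) (chain l / (N + N)%:R))).
    rewrite !csmE -big_split /=; apply: ler_sum => i _; case: ifP => [/andP[pi /eqP li]|_].
      by have := up i pi; rewrite (B_lev pi) li.
    by rewrite add0r divr_ge0 ?chain_ge0.
  rewrite lerD2l sumr_const card_ord -[leLHS]mulr_natr.
  have -> : chain l / (N + N)%:R * N%:R = chain l / 2; last by [].
    have Nr : 0 < N%:R :> R by rewrite ltr0n.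
    by rewrite natrD; move: (N%:R : R) Nr => m' Nr; field; apply: lt0r_neq0; move: Nr; lra.
- move=> ex; right; have [//|mt] := pm ex.
  rewrite addn1 -natr1; apply: (le_trans (lerD mt (lexx 1))).
  rewrite /prog_measure (bigD1 i0) //= [leRHS](bigD1 i0) //= p0 addrAC.
  apply: lerD; last first.
    apply: ler_sum => i _; case: ifP => // pi; rewrite ler_pM2r ?invr_gt0 ?B_gt0 //.
    by rewrite ler_pM2r // res_mono.
  rewrite eq0 !mulrDl lerD2l; have B0 : ra s0 rB i0 != 0 by rewrite gt_eqF // B_gt0.
  by rewrite divfK ?gt_eqF // divff.
Qed.

End Step.

Lemma any_pending_spec s : (na (den any_pending s) aFnd 0 != 0%N) = [exists i : 'I_N, na s aPend i != 0%N].
Proof.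
rewrite /any_pending denSeq denN /=; set s0 := setN _ _ _ _.
pose I (k : nat) s1 := (na s1 aFnd 0 != 0%N) = [exists i : 'I_N, (i < k)%N && (na s aPend i != 0%N)].
apply: (@FQ_ind _ _ _ _ _ I (fun s' => (na s' aFnd 0 != 0%N) = _)).
- by rewrite /I /=; apply/esym/existsP => -[i].
- move=> k s1 [fN fR _] Ik.
  have eP : na s1 aPend = na s aPend by rewrite fN.
  have E : [exists i : 'I_N, (i < k.+1)%N && (na s aPend i != 0%N)] =
      (na s aPend k != 0%N) || [exists i : 'I_N, (i < k)%N && (na s aPend i != 0%N)].
    apply/existsP/orP => [[i /andP[]]|[pk|/existsP[i /andP[ik pi]]]].
    + rewrite ltnS leq_eqVlt => /orP[/eqP/ord_inj-> ->|ik pi]; first by left.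
      by right; apply/existsP; exists i; rewrite ik.
    + by exists k; rewrite ltnSn.
    + by exists i; rewrite pi (ltn_trans ik).
  rewrite denIf /I E /= eP posE; case: ifP => pk; first by rewrite denN.
  by rewrite denSkip.
- move=> s1 _ h; rewrite /= h; apply: eq_existsb => i; by rewrite ltn_ord.
Qed.

Lemma next_alarm_spec s : (forall i, rel Q i <= now) ->
  (forall i, na s aPend i != 0%N -> ra s rB i = chain (na s aLev i) /\ 0 < ra s rB i) ->
  (forall l, csm s now l <= chain l) ->
  let s' := den next_alarm s in keep s s' /\
  if [exists i : 'I_N, na s aPend i != 0%N] then exists t, [/\ al s' = Some t, now <= t,
    exists i, na s aPend i != 0%N /\ chain (na s aLev i) / 2 <= csm s t (na s aLev i) &
    forall l, csm s t l <= chain l]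
  else al s' = al s.
Proof.
move=> rn hB cs s'; rewrite {}/s' /next_alarm denSeq denR /=; set s0 := setR _ _ _ _.
have B0 i : na s aPend i != 0%N -> 0 < ra s rB i by case/hB.
have BL i : na s aPend i != 0%N -> ra s rB i = chain (na s aLev i) by case/hB.
rewrite denSeq; set p := FQ 28 _.
have [fN1 fR1 fO1] := den_fr G Q now p s0.
have I1 : alarm_inv s (N * N) (den p s0).
  have -> : (N * N = 0 + bnd Q (0,1,0) * (bnd Q (0,1,0) * 1))%N by rewrite !bndQ; lia.
  apply: rep_ind; first by [].
    move=> m s1 _ I0; apply: rep_ind I0; first by [].
    by move=> {}m s2 _; exact: alarm_step_spec.
  split; [by []|by rewrite /s0 /= lexx|by move=> l; exact: cs|].
  move=> _; right; apply: sumr_ge0 => i _; case: ifP => // pi.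
  by rewrite divr_ge0 ?mulr_ge0 ?res_ge0 // ltW // B0.
set s1 := den p s0 in fN1 fR1 fO1 I1 *.
have A1 : al s1 = al s by have [->] := fO1 isT.
clearbody s1; have [kp nt cst pm] := I1; set t := ra s1 rTau 0 in nt cst pm *.
rewrite denSeq; have an := any_pending_spec s1; have f2 := den_fr G Q now any_pending s1.
have k2 : keep s1 (den any_pending s1) by apply: (keep_fr f2).
set s2 := den any_pending s1 in an f2 k2 *; have [fN2 fR2 fO2] := f2.
have T2 : ra s2 rTau 0 = t by rewrite fR2.
have A2 : al s2 = al s by have [-> _] := fO2 isT.
have [e1 _ _ _ _] := kp; rewrite e1 in an.
have kp2 := keep_trans kp k2; clearbody s2.
have -> : den (PIf (HPos (HS aFnd)) (PAlarm (HSR rTau)) PSkip) s2 =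
  if [exists i : 'I_N, na s aPend i != 0%N] then HState (na s2) (ra s2) (Some (Num.max now t)) (ob s2) else s2.
  by rewrite denIf /= posE an; case: ifP => _; rewrite ?denSkip // -T2.
case: ifP => ex; last by split.
split; first by case: kp2.
exists t; rewrite /= (max_idPr nt); split=> //.
have ex' : exists i, na s aPend i != 0%N by move/existsP: ex.
have [[i [pi h]]|le] := pm ex'; first by exists i; rewrite -(BL _ pi).
have [[i [pi h]]|nc] := pselect (crit_at s t); first by exists i; rewrite -(BL _ pi).
by have := measure_small B0 nc ex'; rewrite ltNge le.
Qed.

End Alarm.

(** * One service *)

Definition cheapb : hb := HLtR (HMulR (HNat (HAdd HV HV)) (HCost (HS 26))) (HSR rNxt).

Definition cover k : prog :=
  FV 26 (PIf (HOr (HPos (gN k 26)) cheapb) (PN aY (HS 26) (HLit 1)) (PN aY (HS 26) (HLit 0))) ;;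
  served.

Definition gamma : prog :=
  PSR rTmp zero ;;
  FV 26 (PSR rTmp (HAddR (HSR rTmp) (HDivR one (HNat (HAdd (HS 26) (HLit 1)))))) ;;
  PSR rGam (HAddR (HNat (HLit 2)) (HMulR (HNat (HLit 2)) (HSR rTmp))).

Definition mark_eligible : prog :=
  FQ 26 (PIf (HAnd (HPos (gN aPend 26)) (HLeN (gN aLev 26) (HS aLvn)))
           (PN aEl (HS 26) (HLit 1)) (PN aEl (HS 26) (HLit 0)) ;;
         PIf (HLeR (gR rH 26) (HDelay (HS 26) HNow))
           (PR rG (HS 26) (HDelay (HS 26) HNow)) (PR rG (HS 26) (gR rH 26)) ;;
         PR rInc (HS 26) (HDivR (HSR rNxt) twoN)).

Definition service_init : prog :=
  PSR rTau HNow ;; criticalp ;; PSR rLev (HGetR rB (HS aCur)) ;;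
  PS aLvn (HAdd (HGet aLev (HS aCur)) (HLit 1)) ;;
  next ;; gamma ;; mark_eligible ;; FV 26 (PN aBest (HS 26) (HLit 0)) ;; PS aStop (HLit 0).

Definition prizes : prog :=
  FQ 26 (PIf (HAnd (HPos (gN aEl 26)) (HLeR (gR rG 26) (HDelay (HS 26) (HSR rTau2))))
    (PR rP (HS 26) (HSubR (HDelay (HS 26) (HSR rTau2)) (gR rG 26)))
    (PR rP (HS 26) zero)).

Definition pc_cost : prog :=
  PSR rAcc zero ;;
  FV 26 (PIf (HPos (gN aX 26)) (PSR rAcc (HAddR (HSR rAcc) (HCost (HS 26)))) PSkip) ;;
  FQ 26 (PIf (HPos (gN aUns 26)) (PSR rAcc (HAddR (HSR rAcc) (gR rP 26))) PSkip).

Definition mark_unserved : prog :=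
  FQ 26 (PIf (HAnd (HPos (gN aEl 26)) (HPos (gN aUns 26)))
    (PN aSel (HS 26) (HLit 1)) (PN aSel (HS 26) (HLit 0))).

Definition try_cover : prog :=
  prizes ;; pc ;; cover aX ;; pc_cost ;;
  PIf (HLeR (HSR rAcc) (HMulR (HSR rGam) (HSR rNxt)))
    (FV 26 (PN aBest (HS 26) (gN aX 26)) ;; PSR rTau (HSR rTau2))
    (PS aStop (HLit 2)).

(* Forward time advances until some unserved request has gained [b / 2N], and *)
(* stops when serving would exceed the budget.                                *)
Definition service_step : prog :=
  PIf (HPos (HS aStop)) PSkip
    (cover aBest ;; mark_unserved ;; advance ;;
     PIf (HPos (HS aFnd)) try_cover (PS aStop (HLit 1))).

Definition settle : prog :=
  cover aBest ;;
  FQ 26 (PIf (HPos (gN aEl 26))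
    (PIf (HPos (gN aUns 26))
      (PN aLev (HS 26) (HS aLvn) ;; PR rB (HS 26) (HSR rNxt) ;;
       PIf (HLeR (gR rG 26) (HDelay (HS 26) (HSR rTau2)))
         (PR rH (HS 26) (HDelay (HS 26) (HSR rTau2))) (PR rH (HS 26) (gR rG 26)))
      (PN aPend (HS 26) (HLit 0) ;; PR rH (HS 26) (gR rG 26)))
    PSkip) ;;
  PTransmit aY.

Definition service : prog :=
  service_init ;; FQ 31 (FQ 32 (PFor 33 (4, 0, 6)%N service_step)) ;; settle.

Section Service.
Variables (R : realType) (n : nat) (G : wgraph R n).
Variables (Q : seq (request R n)) (now : R).
Notation den := (den G Q now).
Notation N := (size Q).
Notation c := (vcost G).
Notation chain := (chain G).
Notation svn := (svn G Q).
Notation dl := (dl Q).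
Notation en1 := (@en1 R n Q).
Notation en2 := (@en2 R n Q).
Implicit Types (s : hstate R n) (u v w a b : 'I_n) (i : 'I_N) (X Y : {set 'I_n}).
#[local] Hint Extern 0 (is_true (0 <= vcost _ _)) => apply: c_ge0 : core.

Lemma cover_spec k s : k != 26%N -> k != aY ->
  let s' := den (cover k) s in
  fset s' aY = fset s k :|: cheap G (ra s rNxt 0) /\
  forall i, na s' aUns i = ~~ svn (fset s k :|: cheap G (ra s rNxt 0)) i :> nat.
Proof.
move=> k26 kY s'; rewrite {}/s' /cover denSeq; set p := FV 26 _.
have e : fset (den p s) aY = fset s k :|: cheap G (ra s rNxt 0).
  apply/setP => v; rewrite in_fset.
  rewrite (FV_mapN (f := fun v : 'I_n => nat_of_bool (v \in fset s k :|: cheap G (ra s rNxt 0)))) //.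
    by case: (_ \in _).
  move=> w s1 [fN fR _] j.
  have eK : na s1 k = na s k by rewrite fN //= !inE /= (negbTE k26) (negbTE kY).
  have eX : ra s1 rNxt = ra s rNxt by rewrite fR.
  rewrite denIf; have -> : eB G Q now (setN s1 26 0 w) (HOr (HPos (gN k 26)) cheapb) =
      (w \in fset s k :|: cheap G (ra s rNxt 0)).
    rewrite /= (negbTE k26) vcE eK eX negb_and !negbK posE -ltNge addnn -mul2n.
    by rewrite !inE.
  have kk : (j == w :> nat) = (j == w) by [].
  by case: (_ \in _); rewrite !denE /= kk.
have [fN _ _] := den_fr G Q now served (den p s); split.
  by rewrite -e /fset fN.
by move=> i; rewrite served_spec e.
Qed.

Lemma gamma_spec s : ra (den gamma s) rGam 0 = gam R n.
Proof.
rewrite /gamma denSeq denR denSeq denR /=; congr (_ + _ * _).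
rewrite (FV_sum (f := fun v : 'I_n => (v.+1%:R)^-1)) /= ?add0r // => v s1 _.
by rewrite denR /= mul1r addn1.
Qed.

Definition stable s s' : Prop :=
  keep s s' /\ [/\ na s' aEl = na s aEl, na s' aLvn = na s aLvn, ra s' rG = ra s rG,
    ra s' rInc = ra s rInc & ra s' rNxt = ra s rNxt] /\ ra s' rGam = ra s rGam.

Lemma stable_trans s1 s2 s3 : stable s1 s2 -> stable s2 s3 -> stable s1 s3.
Proof.
move=> [k1 [[a1 a2 a3 a4 a5] a6]] [k2 [[b1 b2 b3 b4 b5] b6]].
by split; [exact: keep_trans k1 k2|split; [split|]; rewrite ?b1 ?b2 ?b3 ?b4 ?b5 ?b6].
Qed.

Definition inert (p : prog) : bool :=
  [&& all (fun k => k \notin wN p) [:: aPend; aLev; aCnt; aEl; aLvn] &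
      all (fun k => k \notin wR p) [:: rB; rH; rG; rInc; rNxt; rGam]].

Lemma stable_fr p s s' : fr p s s' -> inert p -> stable s s'.
Proof.
move=> [fN fR _] /andP[/allP hN /allP hR].
by split; [split|split; [split|]]; rewrite ?fN ?fR ?hN ?hR ?inE.
Qed.

Section Search.
Variables (s0 : hstate R n) (b : R).
Hypothesis b_gt0 : 0 < b.
Hypothesis b_nxt : ra s0 rNxt 0 = b.
Hypothesis gam0 : ra s0 rGam 0 = gam R n.
Hypothesis inc0 : forall i, ra s0 rInc i = b / (N + N)%:R.
Hypothesis rel_now : forall i, rel Q i <= now.

Definition El i : bool := na s0 aEl i != 0%N.
Definition gv i : R := ra s0 rG i.
Definition prize t i : R := if El i then Num.max (gv i) (dl i t) - gv i else 0.

Lemma prize_ge0 t i : 0 <= prize t i.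
Proof. by rewrite /prize; case: ifP => // _; rewrite subr_ge0 le_max lexx. Qed.

Lemma prize_mono t t' i : t <= t' -> prize t i <= prize t' i.
Proof.
move=> tt; rewrite /prize; case: ifP => // _.
by rewrite lerD2r ge_max !le_max lexx (dl_mono _ _ tt) orbT.
Qed.

(* Truncation bounds the number of steps: the request that advances has a     *)
(* prize of at most [gam * b], since the cover in hand leaves it unserved.    *)
Definition wt_of t i : R := Num.min (prize t i * (N + N)%:R / b) ((N + N)%:R * gam R n + 1).
Definition search_measure t : R := \sum_(i < N) wt_of t i.

Definition covers X : {set 'I_n} := X :|: cheap G b.

Definition paid X (p : 'I_N -> R) : R := \sum_(v in X) c v + \sum_(i < N | ~~ svn (covers X) i) p i.

(** The flag [aStop] is 0 during the search, 1 when the cover serves every eligible request, and 2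
    when the next moment is too expensive, which is the certificate. *)
Definition search_inv m s : Prop :=
  [/\ stable s0 s, now <= ra s rTau 0,
    paid (fset s aBest) (prize (ra s rTau 0)) <= gam R n * b &
    match na s aStop 0 with
    | 0%N => m%:R <= search_measure (ra s rTau 0)
    | 1%N => forall i, El i -> svn (covers (fset s aBest)) i
    | _ => [/\ ra s rTau 0 <= ra s rTau2 0,
        forall i, El i -> ~~ svn (covers (fset s aBest)) i ->
          dl i (ra s rTau2 0) <= Num.max (gv i) (dl i (ra s rTau 0)) + b / (N + N)%:R &
        forall Y, b < \sum_(v in Y) c v + \sum_(i < N | ~~ svn Y i) prize (ra s rTau2 0) i]
    end].

Lemma gam_gt0 : 0 < gam R n.
Proof. by rewrite /gam; have := harm_ge0 R n; lra. Qed.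

Lemma prizes_spec s : stable s0 s -> forall i, prz (den prizes s) i = prize (ra s rTau2 0) i.
Proof.
move=> [_ [[eE _ eG _ _] _]] i; rewrite /prz.
apply: (FQ_map (f := fun i => prize (ra s rTau2 0) i)) => k s1 [fN fR _] j.
have [e1 e2 e3] : [/\ na s1 aEl = na s0 aEl, ra s1 rG = ra s0 rG & ra s1 rTau2 = ra s rTau2].
  by split; rewrite ?fN ?fR.
rewrite denIf /= e1 e2 e3 posE /prize /El /gv.
have kk : (j == k :> nat) = (j == k) by [].
case: (na s0 aEl k != 0%N) => /=; last by rewrite !denE /= kk.
case: leP => h; rewrite !denE /= kk ?subrr //.
by rewrite e2 e3.
Qed.

Lemma pc_cost_spec s : ra (den pc_cost s) rAcc 0 =
  \sum_(v in fset s aX) c v + \sum_(i < N) (if na s aUns i != 0%N then ra s rP i else 0).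
Proof.
rewrite /pc_cost denSeq denR denSeq /=; set s1 := setR _ _ _ _; set p := FV 26 _.
have [fN fR _] := den_fr G Q now p s1.
rewrite (FQ_sum (f := fun i => if na s aUns i != 0%N then ra s rP i else 0)); last first.
  move=> i s2 [fN2 fR2 _]; have [e1 e2] : na s2 aUns = na s aUns /\ ra s2 rP = ra s rP.
    by split; [rewrite fN2 // fN|rewrite fR2 // fR].
  by rewrite denIf /= e1 posE; case: ifP => _; rewrite !denE /= ?e2 ?addr0.
congr (_ + _); rewrite /p (FV_sum (f := fun v => if v \in fset s aX then c v else 0)).
  by rewrite /s1 /= add0r -big_mkcond.
move=> v s2 [fN2 fR2 _]; have e1 : na s2 aX = na s aX by rewrite fN2.
rewrite denIf /= e1 posE -in_fset.
by case: ifP => _; rewrite !denE /= ?vcE ?addr0.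
Qed.

Lemma measure_step t t' i0 X : t <= t' -> El i0 -> ~~ svn (covers X) i0 ->
  paid X (prize t) <= gam R n * b ->
  dl i0 t' = Num.max (gv i0) (dl i0 t) + b / (N + N)%:R ->
  search_measure t + 1 <= search_measure t'.
Proof.
move=> tt E0 ns pd e0; have N0 : (0 < N)%N by apply: leq_ltn_trans (ltn_ord i0).
have NN : 0 < (N + N)%:R :> R by rewrite ltr0n addn_gt0 N0.
have p0 : prize t i0 <= gam R n * b.
  apply: le_trans pd; rewrite /paid (bigD1 i0 ns) /= addrCA lerDl addr_ge0 //.
    by apply: sumr_ge0.
  by apply: sumr_ge0 => i _; exact: prize_ge0.
have p1 : prize t' i0 = prize t i0 + b / (N + N)%:R.
  rewrite /prize E0 e0 addrAC; congr (_ - _); apply/max_idPr.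
  by rewrite (le_trans (y := Num.max (gv i0) (dl i0 t))) ?le_max ?lexx // lerDl divr_ge0 // ltW.
rewrite /search_measure (bigD1 i0) //= [leRHS](bigD1 i0) //= addrAC lerD //.
  have le1 : prize t i0 * (N + N)%:R / b <= (N + N)%:R * gam R n.
    by rewrite ler_pdivrMr // mulrC -mulrA ler_pM2l.
  have -> : wt_of t i0 = prize t i0 * (N + N)%:R / b.
    by apply/min_idPl; apply: (le_trans le1); rewrite lerDl.
  have e1 : prize t' i0 * (N + N)%:R / b = prize t i0 * (N + N)%:R / b + 1.
    by rewrite p1 !mulrDl divfK ?gt_eqF // divff // gt_eqF.
  by rewrite /wt_of e1 le_min lexx lerD2r.
apply: ler_sum => i _; rewrite /wt_of le_min !ge_min lexx orbT andbT.
by rewrite ler_pM2r ?invr_gt0 // ler_pM2r // prize_mono.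
Qed.

Lemma measure_le t : search_measure t <= N%:R * ((N + N)%:R * gam R n + 1).
Proof.
rewrite /search_measure; apply: (@le_trans _ _ (\sum_(i < N) ((N + N)%:R * gam R n + 1))).
  by apply: ler_sum => i _; rewrite /wt_of ge_min lexx orbT.
by rewrite sumr_const card_ord -[leLHS]mulr_natl.
Qed.

Lemma paid_le X p : (forall i, 0 <= p i) -> paid X p <= pcc G en1 en2 p X.
Proof.
move=> p0; rewrite /paid /pcc lerD2l big_mkcond [leRHS]big_mkcond /=; apply: ler_sum => i _.
rewrite -svnE; case: ifP => h; last by case: ifP.
by rewrite ifT //; apply: contra h; apply: svn_sub; exact: finset.subsetUl.
Qed.

Lemma try_cover_spec m s : stable s0 s -> na s aStop 0 = 0%N -> now <= ra s rTau 0 ->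
  paid (fset s aBest) (prize (ra s rTau 0)) <= gam R n * b ->
  ra s rTau 0 <= ra s rTau2 0 ->
  (forall i, El i -> ~~ svn (covers (fset s aBest)) i ->
      dl i (ra s rTau2 0) <= Num.max (gv i) (dl i (ra s rTau 0)) + b / (N + N)%:R) ->
  m%:R <= search_measure (ra s rTau2 0) ->
  search_inv m (den try_cover s).
Proof.
move=> st s00 nt pdt tt up ms; rewrite /try_cover denSeq.
have P1 := prizes_spec st; have f1 := den_fr G Q now prizes s.
set s1 := den prizes s in P1 f1 *.
have st1 := stable_trans st (stable_fr f1 isT).
rewrite denSeq; have [|P2 C2] := @pc_spec _ _ G Q now s1.
  by move=> i; rewrite P1 prize_ge0.
have f2 := den_fr G Q now pc s1; set s2 := den pc s1 in P2 C2 f2 *.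
have st2 := stable_trans st1 (stable_fr f2 isT).
rewrite denSeq; have [Y3 U3] := @cover_spec aX s2 isT isT.
have f3 := den_fr G Q now (cover aX) s2; set s3 := den (cover aX) s2 in Y3 U3 f3 *.
have st3 := stable_trans st2 (stable_fr f3 isT).
rewrite denSeq; have C4 := pc_cost_spec s3.
have f4 := den_fr G Q now pc_cost s3; set s4 := den pc_cost s3 in C4 f4 *.
have st4 := stable_trans st3 (stable_fr f4 isT).
have [fN1 fR1 _] := f1; have [fN2 fR2 _] := f2; have [fN3 fR3 _] := f3; have [fN4 fR4 _] := f4.
set t := ra s rTau 0 in nt pdt tt up *; set t' := ra s rTau2 0 in P1 tt up ms *.
have [T4 T4' S4 B4] : [/\ ra s4 rTau 0 = t, ra s4 rTau2 0 = t', na s4 aStop 0 = 0%N & na s4 aBest = na s aBest].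
  by split; rewrite ?fR4 ?fR3 ?fR2 ?fR1 ?fN4 ?fN3 ?fN2 ?fN1.
have X4 : na s4 aX = na s2 aX by rewrite fN4 // fN3.
have bE : ra s2 rNxt 0 = b by have [_ [[_ _ _ _ ->] _]] := st2.
rewrite bE in U3.
have Acc : ra s4 rAcc 0 = paid (fset s2 aX) (prize t').
  have eX : fset s3 aX = fset s2 aX by rewrite /fset fN3.
  rewrite C4 eX /paid; congr (_ + _); rewrite [RHS]big_mkcond /=; apply: eq_bigr => i _.
  rewrite U3; have -> : ra s3 rP i = prize t' i by rewrite fR3 // -[LHS]/(prz s2 i) P2 P1.
  by case: (svn _ i).
have [nG nB] : ra s4 rGam 0 = gam R n /\ ra s4 rNxt 0 = b.
  by have [_ [[_ _ _ _ ->] ->]] := st4.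
have P1' : prz s1 = prize t' by apply/funext => i; exact: P1.
rewrite P1' in C2.
clearbody s1 s2 s3 s4; rewrite denIf /= Acc nG nB; case: leP => h; last first.
  rewrite denN /=; split.
  - exact: stable_trans st4 _.
  - by rewrite T4.
  - rewrite T4; have -> : fset (setN s4 aStop 0 2) aBest = fset s aBest by rewrite /fset /= B4.
    exact: pdt.
  - rewrite /= T4 T4'; have -> : fset (setN s4 aStop 0 2) aBest = fset s aBest by rewrite /fset /= B4.
    (* The forest found is within the factor [gam] of every solution, so a cost above [gam * b]
       means that every solution costs more than [b]. *)
    split=> // Y; have lt : gam R n * b < gam R n * pcc G en1 en2 (prize t') Y.
      apply: lt_le_trans h _; apply: le_trans (C2 Y); apply: paid_le => i; exact: prize_ge0.
    move: lt; rewrite ltr_pM2l ?gam_gt0 // /pcc => lt; apply: (lt_le_trans lt).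
    by rewrite lerD2l le_eqVlt; apply/orP; left; apply/eqP; apply: eq_bigl => i; rewrite svnE.
rewrite denSeq denR /=; set p := FV 26 _.
have B5 v : na (den p s4) aBest v = na s2 aX v.
  apply: (FV_mapN (f := fun v : 'I_n => na s2 aX v)) => // k s5 [fN fR _] j.
  by rewrite denN /= fN // X4.
have f5 := den_fr G Q now p s4; set s5 := den p s4 in B5 f5 *.
have st5 := stable_trans st4 (stable_fr f5 isT); have [fN5 fR5 _] := f5.
have [T5 S5] : ra s5 rTau2 0 = t' /\ na s5 aStop 0 = 0%N by rewrite fR5 // fN5.
clearbody s5; have eB : fset (setR s5 rTau 0 (ra s5 rTau2 0)) aBest = fset s2 aX.
  by apply/setP => v; rewrite !in_fset /= B5.
split; rewrite ?eB /= ?T5 //.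
- exact: le_trans nt tt.
- by rewrite S5.
Qed.

Lemma service_step_spec m s : search_inv m s -> search_inv (m + 1)%N (den service_step s).
Proof.
move=> [st nt pdt br]; rewrite /service_step denIf /=.
case e0 : (na s aStop 0) br => [|q] /=; last first.
  by move=> br; rewrite denSkip; split=> //; rewrite e0.
move=> ms; rewrite denSeq; have [Y1 U1] := @cover_spec aBest s isT isT.
have f1 := den_fr G Q now (cover aBest) s; set s1 := den (cover aBest) s in Y1 U1 f1 *.
have st1 := stable_trans st (stable_fr f1 isT); have [fN1 fR1 _] := f1.
have bE : ra s rNxt 0 = b by have [_ [[_ _ _ _ ->] _]] := st.
rewrite bE in U1.
have [T1 B1 S1] : [/\ ra s1 rTau 0 = ra s rTau 0, na s1 aBest = na s aBest & na s1 aStop 0 = 0%N].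
  by split; rewrite ?fR1 ?fN1.
set t := ra s rTau 0 in nt pdt ms T1 *; set X := fset s aBest in pdt U1 *.
rewrite denSeq; have f2 := den_fr G Q now mark_unserved s1.
have SE i : na (den mark_unserved s1) aSel i = (El i && ~~ svn (covers X) i).
  apply: (FQ_mapN (f := fun i => nat_of_bool (El i && ~~ svn (covers X) i))) => // k s2 [fN fR _] j.
  have [e1 e2] : na s2 aEl = na s0 aEl /\ na s2 aUns = na s1 aUns.
    by split; rewrite fN //; have [_ [[-> _ _ _ _] _]] := st1.
  rewrite denIf /= e1 e2 U1 !posE -/(El k).
  have kk : (j == k :> nat) = (j == k) by [].
  by case: (El k); case: (svn _ _); rewrite /= !denE /= kk.
set s2 := den mark_unserved s1 in f2 SE *.
have st2 := stable_trans st1 (stable_fr f2 isT); have [fN2 fR2 _] := f2.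
have [T2 B2 S2] : [/\ ra s2 rTau 0 = t, na s2 aBest = na s aBest & na s2 aStop 0 = 0%N].
  by split; rewrite ?fR2 ?fN2.
have N0 i : (0 < N)%N by apply: leq_ltn_trans (ltn_ord i).
rewrite denSeq; have A3 : advance_post Q s2 (den advance s2).
  apply: advance_spec => i; first by rewrite T2 (le_trans (rel_now i)).
  move=> _; have [_ [[_ _ _ -> _] _]] := st2; rewrite inc0 divr_gt0 // ltr0n addn_gt0 (N0 i) //.
have f3 := den_fr G Q now advance s2; set s3 := den advance s2 in A3 f3 *.
have st3 := stable_trans st2 (stable_fr f3 isT); have [fN3 fR3 _] := f3.
have [T3 B3 S3] : [/\ ra s3 rTau 0 = t, na s3 aBest = na s aBest & na s3 aStop 0 = 0%N].
  by split; rewrite ?fR3 ?fN3.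
have X3 : fset s3 aBest = X by rewrite /fset B3.
have gE i : goalv s2 i = Num.max (gv i) (dl i t) + b / (N + N)%:R.
  by rewrite /goalv T2; have [_ [[_ _ -> -> _] _]] := st2; rewrite inc0.
move: A3; rewrite /advance_post T2 denIf /=; clearbody s1 s2 s3.
case: (na s3 aFnd 0) => [|q] A3 /=.
  rewrite denN; split=> /=.
  - exact: stable_trans st3 _.
  - by rewrite T3.
  - by rewrite T3; have -> : fset (setN s3 aStop 0 1) aBest = X by rewrite -X3 /fset.
  - have -> : fset (setN s3 aStop 0 1) aBest = X by rewrite -X3 /fset.
    by move=> i Ei; have := A3 i; rewrite SE Ei /=; case: (svn _ _).
have [tt up [i0 sel0 eq0]] := A3.
move: sel0; rewrite SE; case: andP => // -[E0 ns0] _.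
apply: try_cover_spec => //; rewrite ?T3 ?X3 //.
- by move=> i Ei ns; rewrite -gE; apply: up; rewrite SE Ei ns.
- rewrite addn1 -natr1; apply: le_trans (lerD ms (lexx 1)) _.
  by apply: (measure_step tt E0 ns0 pdt); rewrite -gE.
Qed.

End Search.

End Service.

Lemma harm_le (R : realType) k : harm R k <= k%:R.
Proof.
elim: k => [|k IH]; first by rewrite /harm big_ord0.
by rewrite harmS -natr1 lerD // natr1 invf_le1 ?ler1n ?ltr0n.
Qed.

Section ServiceSpec.
Variables (R : realType) (n : nat) (G : wgraph R n).
Variables (Q : seq (request R n)) (now : R).
Notation den := (den G Q now).
Notation N := (size Q).
Notation c := (vcost G).
Notation chain := (chain G).
Notation svn := (svn G Q).
Notation dl := (dl Q).
Implicit Types (s : hstate R n) (v : 'I_n) (i : 'I_N) (X Y : {set 'I_n}).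
#[local] Hint Extern 0 (is_true (0 <= vcost _ _)) => apply: c_ge0 : core.

Lemma mark_eligible_spec s : let s' := den mark_eligible s in forall i,
  [/\ na s' aEl i = (na s aPend i != 0%N) && (na s aLev i <= na s aLvn 0)%N :> nat,
     ra s' rG i = Num.max (ra s rH i) (dl i now) &
     ra s' rInc i = ra s rNxt 0 / (N + N)%:R].
Proof.
move=> s' i; rewrite {}/s'; split.
- apply: (FQ_mapN (f := fun i => nat_of_bool ((na s aPend i != 0%N) && (na s aLev i <= na s aLvn 0)%N))) => // k s1 [fN fR _] j.
  have [e1 e2 e3] : [/\ na s1 aPend = na s aPend, na s1 aLev = na s aLev & na s1 aLvn = na s aLvn].
    by split; rewrite ?fN.
  have kk : (j == k :> nat) = (j == k) by [].
  rewrite denSeq denIf /= e1 e2 e3 posE.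
  by case: ifP => _; rewrite denSeq denN denIf denR; case: ifP => _; rewrite denR /= kk.
- apply: (FQ_map (f := fun i => Num.max (ra s rH i) (dl i now))) => // k s1 [fN fR _] j.
  have e1 : ra s1 rH = ra s rH by rewrite fR.
  have kk : (j == k :> nat) = (j == k) by [].
  rewrite denSeq denIf denSeq denR; set s2 := if _ then _ else _.
  have [e2 e3 e4] : [/\ ra s2 rH = ra s rH, ra s2 rG = ra s1 rG & na s2 26 0 = k].
    by rewrite /s2; case: ifP => _; rewrite denN /= e1.
  by clearbody s2; rewrite denIf /= e2 e4; case: leP => h; rewrite !denR /= ?e2 e3 e4 kk.
- apply: (FQ_map (f := fun i => ra s rNxt 0 / (N + N)%:R)) => // k s1 [fN fR _] j.
  have e1 : ra s1 rNxt = ra s rNxt by rewrite fR.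
  have kk : (j == k :> nat) = (j == k) by [].
  rewrite denSeq denIf denSeq denR; set s2 := if _ then _ else _.
  have [e2 e3 e4] : [/\ ra s2 rNxt = ra s rNxt, ra s2 rInc = ra s1 rInc & na s2 26 0 = k].
    by rewrite /s2; case: ifP => _; rewrite denN /= e1.
  clearbody s2; rewrite denIf; set s3 := if _ then _ else _.
  have [e5 e6 e7] : [/\ ra s3 rNxt = ra s rNxt, ra s3 rInc = ra s1 rInc & na s3 26 0 = k].
    by rewrite /s3; case: ifP => _; rewrite denR /= e2 e3 e4.
  by clearbody s3; rewrite /= e5 e6 e7 kk.
Qed.

Definition init_post s s' : Prop := exists l,
  [/\ exists i, [/\ na s aPend i != 0%N, na s aLev i = l & chain l / 2 <= csm Q s now l],
    [/\ ra s' rNxt 0 = chain l.+1, na s' aLvn 0 = l.+1 & ra s' rGam 0 = gam R n],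
    forall i, [/\ na s' aEl i = elig l (abst Q s) i :> nat,
      ra s' rG i = Num.max (ra s rH i) (dl i now) & ra s' rInc i = chain l.+1 / (N + N)%:R],
    [/\ ra s' rTau 0 = now, fset s' aBest = finset.set0 & na s' aStop 0 = 0%N] &
    keep s s'].

Lemma service_init_spec s :
  (forall i, na s aPend i != 0%N -> ra s rB i = chain (na s aLev i)) ->
  (exists i, na s aPend i != 0%N /\ chain (na s aLev i) / 2 <= csm Q s now (na s aLev i)) ->
  init_post s (den service_init s).
Proof.
move=> BL [i1 [p1 c1]]; rewrite /service_init denSeq denR; set s0 := setR _ _ _ _.
have T0 : ra s0 rTau 0 = now by [].
have k0 : keep s s0 by [].
rewrite denSeq; have C1 := @criticalp_spec _ _ G Q now s0; have f1 := den_fr G Q now criticalp s0.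
have k1 : keep s (den criticalp s0) by apply: (keep_trans k0); apply: (keep_fr f1).
set s1 := den criticalp s0 in C1 f1 k1 *; have [_ fR1 _] := f1.
have T1 : ra s1 rTau 0 = now by rewrite fR1.
have csE l : csm Q s0 now l = csm Q s now l by rewrite /csm (keep_abst Q k0).
have {C1} [i0 [cE p0 h0]] : exists i, [/\ na s1 aCur 0 = i, na s aPend i != 0%N &
    ra s rB i / 2 <= csm Q s now (na s aLev i)].
  move: C1; rewrite /critical_post T0; case: (na s1 aMode 0) => [|q].
    by move=> /(_ i1 p1); rewrite csE /= BL // ltNge c1.
  by move=> [i [e1 e2 e3]]; exists i; split=> //; rewrite -csE.
rewrite (BL _ p0) in h0; set l := na s aLev i0 in h0.
exists l; clearbody s1; have [P1 L1 B1 H1 _] := k1.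
rewrite denSeq denR denSeq denN; set s2 := setN _ _ _ _.
have [L2 V2] : ra s2 rLev 0 = chain l /\ na s2 aLvn 0 = l.+1.
  by rewrite /s2 /= cE B1 L1 BL // addn1.
have T2 : ra s2 rTau 0 = now by [].
have k2 : keep s s2 by [].
clearbody s2; rewrite denSeq; have X3 := @next_spec _ _ G Q now s2.
have f3 := den_fr G Q now next s2; have k3 : keep s (den next s2) by apply: (keep_trans k2); apply: (keep_fr f3).
set s3 := den next s2 in X3 f3 k3 *; have [fN3 fR3 _] := f3.
have [V3 T3] : na s3 aLvn 0 = l.+1 /\ ra s3 rTau 0 = now by rewrite fN3 // fR3.
rewrite L2 -chainS in X3; clearbody s3.
rewrite denSeq; have X4 := @gamma_spec _ _ G Q now s3.
have f4 := den_fr G Q now gamma s3; have k4 : keep s (den gamma s3) by apply: (keep_trans k3); apply: (keep_fr f4).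
set s4 := den gamma s3 in X4 f4 k4 *; have [fN4 fR4 _] := f4.
have [V4 T4 B4] : [/\ na s4 aLvn 0 = l.+1, ra s4 rTau 0 = now & ra s4 rNxt 0 = chain l.+1].
  by split; [rewrite fN4|rewrite fR4|rewrite fR4].
clearbody s4; rewrite denSeq; have X5 := mark_eligible_spec s4.
have f5 := den_fr G Q now mark_eligible s4; have k5 : keep s (den mark_eligible s4) by apply: (keep_trans k4); apply: (keep_fr f5).
set s5 := den mark_eligible s4 in X5 f5 k5 *; have [fN5 fR5 _] := f5.
have [V5 T5 B5 G5] : [/\ na s5 aLvn 0 = l.+1, ra s5 rTau 0 = now, ra s5 rNxt 0 = chain l.+1 & ra s5 rGam 0 = gam R n].
  by split; [rewrite fN5|rewrite fR5|rewrite fR5|rewrite fR5].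
have [P4 L4 _ H4 _] := k4.
have {}X5 i : [/\ na s5 aEl i = elig l (abst Q s) i :> nat,
      ra s5 rG i = Num.max (ra s rH i) (dl i now) & ra s5 rInc i = chain l.+1 / (N + N)%:R].
  have [-> -> ->] := X5 i; rewrite P4 L4 H4 V4 B4; split=> //.
  by rewrite /elig /= ltn_ord.
clearbody s5; rewrite denSeq; set p := FV 26 _.
have f6 := den_fr G Q now p s5; have k6 : keep s (den p s5) by apply: (keep_trans k5); apply: (keep_fr f6).
have X6 v : na (den p s5) aBest v = 0%N.
  by apply: (FV_mapN (f := fun=> 0%N)) => // k s6 _ j; rewrite denN.
set s6 := den p s5 in X6 f6 k6 *; have [fN6 fR6 _] := f6.
have [V6 T6 B6 G6] : [/\ na s6 aLvn = na s5 aLvn, ra s6 rTau = ra s5 rTau, ra s6 rNxt = ra s5 rNxt & ra s6 rGam = ra s5 rGam].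
  by split; rewrite ?fN6 ?fR6.
have [E6 G6' I6] : [/\ na s6 aEl = na s5 aEl, ra s6 rG = ra s5 rG & ra s6 rInc = ra s5 rInc].
  by split; rewrite ?fN6 ?fR6.
clearbody s6; rewrite denN; split=> //.
- by exists i0; split.
- by rewrite /= V6 B6 G6.
- by move=> i; rewrite /= E6 G6' I6.
- split=> //=; first by rewrite T6.
  by apply/setP => v; rewrite in_fset /= X6 inE.
Qed.

Definition search : prog := FQ 31 (FQ 32 (PFor 33 (4, 0, 6)%N service_step)).

(** The number of repetitions exceeds the bound on the measure: [gam R n <= 2 + 2n] gives
    [N * (2N * gam + 1) < N * N * (4n + 6)]. So the search has stopped. *)
Lemma search_spec s b : 0 < b -> ra s rNxt 0 = b -> ra s rGam 0 = gam R n ->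
  (forall i, ra s rInc i = b / (N + N)%:R) -> (forall i, rel Q i <= now) ->
  (0 < N)%N -> ra s rTau 0 = now -> fset s aBest = finset.set0 -> na s aStop 0 = 0%N ->
  (forall i, El s i -> dl i now <= ra s rG i) ->
  exists m, search_inv G Q now s b m (den search s) /\ na (den search s) aStop 0 != 0%N.
Proof.
move=> b0 bN gE iE rn N0 tE bE sE hG.
have pr0 i : prize s now i = 0.
  by rewrite /prize; case: ifP => // /hG h; rewrite /gv max_l ?subrr.
have I0 : search_inv G Q now s b 0 s.
  split; rewrite ?tE ?sE //.
  - by rewrite /paid bE big_set0 big1 ?addr0 ?mulr_ge0 ?(ltW b0) ?ltW ?gam_gt0.
  - apply: sumr_ge0 => i _; rewrite /wt_of le_min pr0 !mul0r lexx addr_ge0 ?mulr_ge0 //.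
    by rewrite ltW // gam_gt0.
have I1 : search_inv G Q now s b (N * N * (4 * n + 6)) (den search s).
  have -> : (N * N * (4 * n + 6) = 0 + bnd Q (0,1,0) * (bnd Q (0,1,0) * (bnd Q (4,0,6) * 1)))%N.
    by rewrite !bndQ /bnd /=; lia.
  apply: rep_ind; [by []| |exact: I0] => m s1 _ H1.
  apply: rep_ind; [by []| |exact: H1] => {H1} m' s2 _ H2.
  apply: rep_ind; [by []| |exact: H2] => {H2} m2 s3 _ H3.
  exact: service_step_spec.
exists (N * N * (4 * n + 6))%N; split=> //; have [_ _ _] := I1.
case: (na _ aStop 0) => // le.
have := le_trans le (measure_le _ _ _ _); rewrite leNgt; move/negP; case.
have g2 : gam R n <= 2 + 2 * n%:R by rewrite /gam lerD2l ler_pM2l // harm_le.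
have N1 : 1 <= N%:R :> R by rewrite ler1n.
rewrite !natrD !natrM natrD natrM; move: g2 N1; move: (gam R n) (N%:R : R) (n%:R : R) => g x y g2 x1.
apply: (@le_lt_trans _ _ (x * ((x + x) * (2 + 2 * y) + 1))).
  by rewrite ler_pM2l ?lerD2r ?ler_pM2l //; lra.
rewrite -subr_gt0; have -> : x * x * (4 * y + 6) - x * ((x + x) * (2 + 2 * y) + 1) = x * (2 * x - 1) by ring.
by rewrite mulr_gt0 //; lra.
Qed.

End ServiceSpec.

Section Settle.
Variables (R : realType) (n : nat) (G : wgraph R n).
Variables (Q : seq (request R n)) (now : R).
Notation den := (den G Q now).
Notation N := (size Q).
Notation c := (vcost G).
Notation chain := (chain G).
Notation svn := (svn G Q).
Notation dl := (dl Q).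
Implicit Types (s : hstate R n) (v : 'I_n) (i : 'I_N) (X Y : {set 'I_n}).
#[local] Hint Extern 0 (is_true (0 <= vcost _ _)) => apply: c_ge0 : core.

Definition settle_post s s' : Prop :=
  let X := fset s aBest :|: cheap G (ra s rNxt 0) in
  (forall i, if na s aEl i != 0%N then
    if svn X i then na s' aPend i = 0%N /\ ra s' rH i = ra s rG i
    else [/\ na s' aPend i = na s aPend i, na s' aLev i = na s aLvn 0, ra s' rB i = ra s rNxt 0 &
           ra s' rH i = Num.max (ra s rG i) (dl i (ra s rTau2 0))]
    else [/\ na s' aPend i = na s aPend i, na s' aLev i = na s aLev i, ra s' rB i = ra s rB i &
           ra s' rH i = ra s rH i]) /\
  [/\ al s' = al s, ob s' = rcons (ob s) X & na s' aCnt = na s aCnt].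

Lemma settle_spec s : settle_post s (den settle s).
Proof.
rewrite /settle denSeq; have [Y1 U1] := @cover_spec _ _ G Q now aBest s isT isT.
have f1 := den_fr G Q now (cover aBest) s; set s1 := den (cover aBest) s in Y1 U1 f1 *.
rewrite /settle_post; set X := _ :|: _ in Y1 U1 *.
have [fN1 fR1 fO1] := f1.
have [e1 e2 e3 e4] : [/\ na s1 aPend = na s aPend, na s1 aLev = na s aLev, na s1 aEl = na s aEl & na s1 aLvn = na s aLvn].
  by split; rewrite fN1.
have [e5 e6 e7 [e8 e9]] : [/\ ra s1 rB = ra s rB, ra s1 rH = ra s rH, ra s1 rG = ra s rG & ra s1 rNxt = ra s rNxt /\ ra s1 rTau2 = ra s rTau2].
  by split; rewrite ?fR1.
have [e10 [e11 e12]] : na s1 aCnt = na s aCnt /\ al s1 = al s /\ ob s1 = ob s.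
  by rewrite fN1 //; split=> //; exact: fO1.
clearbody s1; rewrite denSeq; set p := FQ 26 _.
have [fN2 fR2 fO2] := den_fr G Q now p s1.
pose fin s' i := if na s aEl i != 0%N then
    if svn X i then na s' aPend i = 0%N /\ ra s' rH i = ra s rG i
    else [/\ na s' aPend i = na s aPend i, na s' aLev i = na s aLvn 0, ra s' rB i = ra s rNxt 0 &
           ra s' rH i = Num.max (ra s rG i) (dl i (ra s rTau2 0))]
    else [/\ na s' aPend i = na s aPend i, na s' aLev i = na s aLev i, ra s' rB i = ra s rB i &
           ra s' rH i = ra s rH i].
pose old s' i := [/\ na s' aPend i = na s aPend i, na s' aLev i = na s aLev i, ra s' rB i = ra s rB i &
           ra s' rH i = ra s rH i].
pose I (k : nat) s' := forall i, if (i < k)%N then fin s' i else old s' i.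
have F2 : forall i, fin (den p s1) i.
  apply: (@FQ_ind _ _ _ _ _ I (fun s' => forall i, fin s' i)).
  - by move=> i; rewrite /old /= e1 e2 e5 e6.
  - move=> k s2 [fN fR _] Ik.
    have [E1 E2 E3] : [/\ na s2 aEl = na s aEl, na s2 aLvn = na s aLvn & na s2 aUns = na s1 aUns].
      by split; rewrite fN.
    have [E4 E5 E6] : [/\ ra s2 rG = ra s rG, ra s2 rNxt = ra s rNxt & ra s2 rTau2 = ra s rTau2].
      by split; rewrite fR.
    have same s3 : (forall j, j != k -> [/\ na s3 aPend j = na s2 aPend j, na s3 aLev j = na s2 aLev j,
        ra s3 rB j = ra s2 rB j & ra s3 rH j = ra s2 rH j]) -> fin s3 k -> I k.+1 s3.
      move=> h fk i; rewrite ltnS; case: (eqVneq i k) => [->|ne]; first by rewrite leqnn.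
      have lt : (i <= k)%N = (i < k)%N by rewrite [RHS]ltn_neqAle -[(i == k :> nat)]/(i == k) ne.
      have [h1 h2 h3 h4] := h _ ne; rewrite lt; have := Ik i; rewrite /fin /old h1 h2 h3 h4.
      by [].
    have [d1 d2 d3 d4] : old s2 k by have := Ik k; rewrite ltnn.
    have nk (j : 'I_N) : j != k -> (j == k :> nat) = false by move=> /negbTE.
    rewrite denIf /= E1 posE; case: ifP => ek; last first.
      by rewrite denSkip; apply: same => //; rewrite /fin ek; split.
    rewrite denIf /= E3 U1 posE; case sk: (svn X k); rewrite /=.
      rewrite denSeq denN denR; apply: same => /= [j /nk ->//|].
      by rewrite /fin ek sk /= eqxx E4.
    rewrite denSeq denN denSeq denR denIf /= E2 E4 E5 E6.
    case: leP => h; rewrite denR; apply: same => /= [j /nk ->//|].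
    - by rewrite /fin ek sk /= !eqxx d1 E6 (max_idPr h).
    - by rewrite /fin ek sk /= !eqxx d1 E4 (max_idPl (ltW h)).
  - by move=> s2 _ h i; have := h i; rewrite ltn_ord.
set s2 := den p s1 in fN2 fR2 fO2 F2 *.
have [g1 g2] : na s2 aCnt = na s aCnt /\ na s2 aY = na s1 aY by rewrite !fN2.
have [g3 g4] : al s2 = al s /\ ob s2 = ob s by have [-> ->] := fO2 isT.
clearbody s2; rewrite denT; split; first exact: F2.
by split=> //=; rewrite g4; congr rcons; rewrite -Y1 /fset g2.
Qed.

Lemma cheap_cost b : 0 <= b -> \sum_(v in cheap G b) c v <= b / 2.
Proof.
move=> b0; apply: (@le_trans _ _ (\sum_(v : 'I_n) b / (2 * n)%:R)).
  rewrite big_mkcond; apply: ler_sum => v _; case: ifP => [|_]; last by rewrite divr_ge0.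
  by rewrite inE => /ltW h; rewrite ler_pdivlMr 1?mulrC // ltr0n; have := ltn_ord v; lia.
rewrite sumr_const card_ord -[leLHS]mulr_natr; case: (posnP n) => [->|n0].
  by rewrite mulr0 divr_ge0.
have {}n0 : 0 < n%:R :> R by rewrite ltr0n.
rewrite natrM; move: (n%:R : R) n0 => x x0.
by rewrite le_eqVlt; apply/orP; left; apply/eqP; field; rewrite gt_eqF.
Qed.

Definition service_post s s' : Prop := exists X l u oc,
  serv_rel G Q now (abst Q s) (abst Q s') X l u oc /\
  [/\ ob s' = rcons (ob s) X, al s' = al s, na s' aCnt = na s aCnt &
    forall i, na s' aPend i != 0%N -> ra s' rB i = chain (na s' aLev i)].

Lemma service_spec s : (forall i, rel Q i <= now) ->
  (forall i, na s aPend i != 0%N -> ra s rB i = chain (na s aLev i) /\ 0 < ra s rB i) ->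
  (exists i, na s aPend i != 0%N /\ chain (na s aLev i) / 2 <= csm Q s now (na s aLev i)) ->
  service_post s (den service s).
Proof.
move=> rn hB cr; have [i1 _] := cr; have N0 : (0 < N)%N by apply: leq_ltn_trans (ltn_ord i1).
have BL i : na s aPend i != 0%N -> ra s rB i = chain (na s aLev i) by case/hB.
rewrite /service denSeq.
have [l [[i0 [p0 l0 c0]] [N1 V1 G1] F1 [T1 B1 S1] k1]] := @service_init_spec _ _ G Q now s BL cr.
have [_ _ fO1] := den_fr G Q now service_init s.
set s1 := den service_init s in N1 V1 G1 F1 T1 B1 S1 k1 fO1 *; have [A1 U1] := fO1 isT.
clearbody s1; set b := chain l.+1 in N1 F1.
have b0 : 0 < b.
  have [_] := hB _ p0; rewrite (BL _ p0) l0 => h; apply: lt_le_trans (next_ge _ _).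
  by rewrite mulr_gt0.
have F11 i : na s1 aEl i = elig l (abst Q s) i :> nat by have [] := F1 i.
have F12 i : ra s1 rG i = Num.max (ra s rH i) (dl i now) by have [] := F1 i.
have F13 i : ra s1 rInc i = b / (N + N)%:R by have [] := F1 i.
have [m [I2 S2]] : exists m, search_inv G Q now s1 b m (den search s1) /\ na (den search s1) aStop 0 != 0%N.
  by apply: search_spec => // i _; rewrite F12 le_max lexx orbT.
rewrite denSeq -/search.
have [fN2 fR2 fO2] := den_fr G Q now search s1.
set s2 := den search s1 in I2 S2 fN2 fR2 fO2 *; have [A2 U2] := fO2 isT.
clearbody s2; have [st nt pd2 br] := I2; have [k2 [[e1 e2 e3 _ e5] _]] := st.
have [stl [A3 U3 C3]] := settle_spec s2.
set s3 := den settle s2 in stl A3 U3 C3 *; clearbody s3.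
have k02 := keep_trans k1 k2; have [P2 L2 B2 H2 C2] := k02.
rewrite e5 N1 in stl U3; set X := fset s2 aBest :|: cheap G b in stl U3.
have El1 i : (na s2 aEl i != 0%N) = elig l (abst Q s) i.
  by rewrite e1 F11; case: (elig _ _ _).
have El0 i : El s1 i = elig l (abst Q s) i by rewrite /El F11; case: (elig _ _ _).
pose g (k : nat) := Num.max (hh (abst Q s) k) (dl k now).
have gE i : g i = ra s1 rG i by rewrite F12 /g /= ltn_ord.
pose tau := ra s2 rTau2 0; pose u (k : nat) := Num.max (g k) (dl k tau).
have stop2 i : elig l (abst Q s) i -> ~~ svn X i -> na s2 aStop 0 != 1%N.
  move: br; case: (na s2 aStop 0) => [|[|q]] // br Ei; rewrite (br i) //.
  by rewrite El0.
have pr0 i : 0 <= prize s1 (ra s2 rTau 0) i := prize_ge0 _ _ _.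
exists X, l, u, (if na s2 aStop 0 == 1%N then None else Some tau); split; last first.
  split; rewrite ?U3 ?U2 ?U1 ?A3 ?A2 ?A1 ?C3 ?C2 // => i.
  have := stl i; rewrite El1; case: ifP => [_|_ [-> -> -> _]]; last first.
    by rewrite P2 L2 B2; exact: BL.
  case: ifP => [_ [-> //]|_ [_ -> -> _] _].
  by rewrite e2 V1.
split.
- split; first by exists i0 => /=; rewrite ltn_ord p0.
  exact: c0.
- move=> k; case: (ltnP k N) => kN; last first.
    by rewrite /elig /= ltnNge kN.
  have gk := gE (Ordinal kN); rewrite /= in gk.
  have := stl (Ordinal kN); rewrite El1 /= e3 -gk P2 L2 H2 kN /= e2 V1.
  case: ifP => [/andP[]|_ [-> -> _ ->]]; last by [].
  rewrite /= kN /= => pk _; case: ifP => [_ [-> ->]|_ [-> -> _ ->]] //; by rewrite /g /= kN.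
(* The shares of the budget: [gam * b] for the last affordable forest and its prizes, [b / 2] for
   the cheap vertices, and [b / 2] for the last jump of at most [N] requests. *)
- split; first exact: finset.subsetUr.
  have cX : \sum_(v in X) c v <= \sum_(v in fset s2 aBest) c v + b / 2.
    apply: (le_trans (@sum_setU _ _ _ _ _ _)); first by move=> v; exact: c_ge0.
    by rewrite lerD2l; apply: cheap_cost; exact: ltW.
  have cU : \sum_(i < N | elig l (abst Q s) i && ~~ svn X i) (u i - g i) <=
      \sum_(i < N | ~~ svn X i) prize s1 (ra s2 rTau 0) i + b / 2.
    have bN : \sum_(i < N) (b / (N + N)%:R) = b / 2.
      rewrite sumr_const card_ord -[LHS]mulr_natr.
      have {}N0 : 0 < N%:R :> R by rewrite ltr0n.
      rewrite natrD; move: (N%:R : R) N0 => x x0.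
      by field; apply/eqP; lra.
    rewrite -bN big_mkcond [X in _ <= X + _]big_mkcond -big_split /=.
    apply: ler_sum => i _; case: (boolP (svn X i)) => sX; rewrite /= ?andbF ?andbT.
      by rewrite add0r divr_ge0 // ltW.
    case: ifP => [Ei|_]; last by rewrite addr_ge0 // divr_ge0 // ltW.
    have := stop2 _ Ei sX; move: br; case: (na s2 aStop 0) S2 => [|[|q]] // _ [tt up _] _.
    have := up i; rewrite El0 => /(_ Ei sX) le.
    rewrite /prize El0 Ei /u gE -/(gv s1 i) addrAC lerD2r ge_max le andbT.
    apply: (@le_trans _ _ (Num.max (gv s1 i) (dl i (ra s2 rTau 0)))); first by rewrite le_max lexx.
    by rewrite lerDl divr_ge0 // ltW.
  have := pd2; rewrite /paid /covers -/X; move: cX cU.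
  set z1 := \sum_(v in X) _; set z2 := \sum_(v in fset _ _) _; set z3 := \sum_(i < N | _ && _) _.
  rewrite -/b; set z4 := \sum_(i < N | ~~ _) _; move: z1 z2 z3 z4 (gam R n) (b) => z1 z2 z3 z4 x y; lra.
- by move=> k _; rewrite /u le_max lexx.
- case: (na s2 aStop 0) S2 br stop2 => [|[|q]] // _ br stop2 /=.
    move=> k; case: (ltnP k N) => kN; last by rewrite /elig /= ltnNge kN.
    by have := br (Ordinal kN); rewrite El0.
  have [tt _ cf] := br; split=> //; first exact: le_trans nt tt.
  move=> Y; apply: lt_le_trans (cf Y) _; rewrite lerD2l big_mkcond [leRHS]big_mkcond /=.
  apply: ler_sum => i _; rewrite andbC /prize El0; case: (svn Y i) => //=.
  by rewrite -[Num.max (if _ then _ else _) _]/(g i) /u gE; case: (elig _ _ _).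
Qed.

End Settle.

(** * Arrivals and alarms *)

Definition prologue : prog :=
  PS 25 (HLit 0) ;; PS 26 (HLit 0) ;;
  FV 23 (FV 24 (PN aTab (HS 25) (HS 26) ;; PS 25 (HAdd (HS 25) (HLit 1)) ;;
                PS 26 (HAdd (HS 26) HV))).

(* The activation is an arrival if and only if some released request has not  *)
(* been counted yet.                                                          *)
Definition main : prog :=
  PIf (HLeN HQ (HS aCnt)) service (PS aCnt (HAdd (HS aCnt) (HLit 1)) ;; init_level) ;;
  next_alarm.

Lemma ok_prologue : okP false prologue. Proof. by []. Qed.
Lemma ok_main : okP true main. Proof. by []. Qed.

Section Events.
Variables (R : realType) (n : nat) (G : wgraph R n).
Notation chain := (chain G).
Implicit Types (s : hstate R n) (v : 'I_n) (X Y : {set 'I_n}) (Q : seq (request R n)).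

Lemma prologue_tab Q now s : tab (den G Q now prologue s).
Proof.
rewrite /prologue denSeq denN denSeq denN; set s0 := setN _ _ _ _.
pose I (m : nat) s1 := [/\ na s1 25 0 = m, na s1 26 0 = (m * n)%N &
  forall i, (i < m)%N -> na s1 0 i = (i * n)%N].
have [_ _ h] : I (n * n)%N (den G Q now (FV 23 (FV 24 (PN aTab (HS 25) (HS 26) ;;
    PS 25 (HAdd (HS 25) (HLit 1)) ;; PS 26 (HAdd (HS 26) HV)))) s0); last exact: h.
have -> : (n * n = 0 + bnd Q (1,0,0) * (bnd Q (1,0,0) * 1))%N by rewrite !bndV; lia.
apply: rep_ind; [by []| |by []] => m s1 _ H1.
apply: rep_ind; [by []| |exact: H1] => {H1} m' s2 _ [h1 h2 h3].
rewrite denSeq denN denSeq !denN /= h1 h2; split=> //=.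
  by rewrite addn1 mulSnr.
by move=> i; rewrite addn1 ltnS leq_eqVlt; case: eqP => [-> //|_] /=; exact: h3.
Qed.

Definition waked s : hstate R n := HState (na s) (ra s) None [::].

Definition good Q now s : Prop :=
  [/\ na s aCnt 0 = size Q, base G Q (size Q) (abst Q s),
    forall i : 'I_(size Q), na s aPend i != 0%N -> ra s rB i = chain (na s aLev i),
    forall i : 'I_(size Q), rel Q i <= now &
    if [exists i : 'I_(size Q), na s aPend i != 0%N] then exists t, [/\ al s = Some t, now <= t,
      exists i : 'I_(size Q), na s aPend i != 0%N /\ chain (na s aLev i) / 2 <= csm Q s t (na s aLev i) &
      forall l, csm Q s t l <= chain l]
    else al s = None].

Definition event Q now s : hstate R n := den G Q now main (den G Q now prologue (waked s)).

Lemma base_chain_gt0 Q s m (i : 'I_(size Q)) : base G Q m (abst Q s) -> na s aPend i != 0%N ->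
  0 < chain (na s aLev i).
Proof.
move=> [_ _ _ th] pi; have := th i; rewrite /= ltn_ord => /(_ pi) [v _].
exact: chain_gt0 v _.
Qed.

Lemma alarm_event Q now s t : good Q now s -> al s = Some t ->
  let s' := event Q t s in
  [/\ now <= t, good Q t s', forall l, csum Q (abst Q s) t l <= chain l &
    exists X l u oc, serv_rel G Q t (abst Q s) (abst Q s') X l u oc /\ ob s' = [:: X]].
Proof.
move=> [cE ba BE rn]; case: ifP => [_ [t0 [-> nt cr cs]] [<-]|_ -> //] s'.
rewrite {}/s' /event => {t}; move: t0 nt cr cs => t nt cr cs; have f0 := den_fr G Q t prologue (waked s).
have k0 : keep s (den G Q t prologue (waked s)) by apply: (keep_fr f0).
set s0 := den G Q t prologue _ in f0 k0 *.
have [A0 U0] : al s0 = None /\ ob s0 = [::] by have [_ _ /(_ isT)[-> ->]] := f0.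
clearbody s0; clear f0.
have [P0 L0 B0 H0 C0] := k0; have ab0 := keep_abst Q k0.
have rt i : rel Q (i : 'I_(size Q)) <= t by apply: le_trans (rn i) nt.
rewrite /main denSeq denIf /= C0 cE leqnn.
have : service_post G Q t s0 (den G Q t service s0).
  apply: service_spec => //.
- move=> i; rewrite P0 B0 L0 => pi; split; first exact: BE.
  by rewrite BE //; exact: base_chain_gt0 ba pi.
- by case: cr => i [pi ci]; exists i; rewrite P0 L0 /csm ab0.
set s1 := den G Q t service s0 => -[X [l [u [oc [sr [U1 A1 C1 B1]]]]]]; clearbody s1.
rewrite U0 in U1; rewrite A0 in A1; rewrite ab0 in sr.
have ba1 := serv_base ba sr.
have cs1 l' : csm Q s1 t l' <= chain l' by apply: csum_after sr _; exact: cs.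
have [|//|kp fin] := @next_alarm_spec _ _ G Q t s1 rt.
  move=> i pi; split; first exact: B1.
  by rewrite B1 //; exact: base_chain_gt0 ba1 pi.
have [e1 e2 e3 _ e5] := kp.
have ab := keep_abst Q kp; rewrite /good ab; split=> //.
- split=> //; rewrite ?e5 ?C1 ?C0 ?cE //.
  + by move=> i; rewrite e1 e2 e3; exact: B1.
  + move: fin; rewrite e1 e2; case: ifP => _ //; last by rewrite A1.
    by rewrite /csm ab.
- by exists X, l, u, oc; split=> //; rewrite den_mute.
Qed.

(** The program sees the released prefix while the analysis speaks of all requests; this lemma and
    the next ones pass from one to the other. *)
Lemma svn_cat Q F Y i : (i < size Q)%N -> svn G (Q ++ F) Y i = svn G Q Y i.
Proof. by move=> iQ; rewrite /svn onth_cat iQ. Qed.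

Lemma dl_cat Q F i t : (i < size Q)%N -> dl (Q ++ F) i t = dl Q i t.
Proof. by move=> iQ; rewrite /dl onth_cat iQ. Qed.

Lemma rel_cat Q F i : (i < size Q)%N -> rel (Q ++ F) i = rel Q i.
Proof. by move=> iQ; rewrite /rel onth_cat iQ. Qed.

Lemma csum_cat Q F (a : astate R) t l : (forall i, pd a i -> (i < size Q)%N) ->
  csum (Q ++ F) a t l = csum Q a t l.
Proof.
move=> pQ; rewrite /csum.
rewrite -!(big_mkord (fun i => pd a i && (lv a i == l)) (fun i => res _ a t i)).
rewrite (@big_cat_nat _ _ _ (size Q)) //= ?size_cat ?leq_addr //.
rewrite [X in _ + X]big_nat_cond [X in _ + X]big_pred0 ?addr0; last first.
  by move=> i; apply/negbTE/negP => /andP[/andP[h _] /andP[/pQ]]; lia.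
rewrite big_nat_cond [RHS]big_nat_cond; apply: eq_bigr => i /andP[/andP[_ iQ] _].
by rewrite /res dl_cat.
Qed.

Definition same_upto (m : nat) (a a' : astate R) : Prop :=
  forall k, k != m -> [/\ pd a' k = pd a k, lv a' k = lv a k & hh a' k = hh a k].

Definition fresh Q (j : nat) (t : R) (a : astate R) : Prop :=
  [/\ forall l, (l < lv a j)%N -> ~~ svn G Q (light G (chain l)) j, hh a j = dl Q j t,
    pd a j = svn G Q (light G (chain (lv a j))) j & svn G Q [set: 'I_n] j -> pd a j].

Lemma arrival_event Q q now s : good Q now s -> now <= release q ->
  (if al s is Some t then release q <= t else true) ->
  let s' := event (rcons Q q) (release q) s in
  [/\ good (rcons Q q) (release q) s', ob s' = [::],
    same_upto (size Q) (abst Q s) (abst (rcons Q q) s') &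
    fresh (rcons Q q) (size Q) (release q) (abst (rcons Q q) s')].
Proof.
move=> [cE ba BE rn alm] nr rt s'; set Q' := rcons Q q; set t := release q in nr rt *.
have sQ : size Q' = (size Q).+1 by rewrite size_rcons.
have Q'E : Q' = Q ++ [:: q] by rewrite cats1.
rewrite {}/s' /event; have f0 := den_fr G Q' t prologue (waked s).
have k0 : keep s (den G Q' t prologue (waked s)) by apply: (keep_fr f0).
set s0 := den G Q' t prologue _ in f0 k0 *.
have [A0 U0] : al s0 = None /\ ob s0 = [::] by have [_ _ /(_ isT)[-> ->]] := f0.
clearbody s0; clear f0.
have [P0 L0 B0 H0 C0] := k0.
rewrite /main denSeq denIf /= C0 cE sQ ltnn denSeq denN /=; set s1 := setN s0 _ _ _.
have N0 : (0 < size Q')%N by rewrite sQ.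
have := @init_level_spec _ _ G Q' t s1 N0.
have [fN fR fO] := den_fr G Q' t init_level s1; move: fN fR fO.
set s2 := den G Q' t init_level s1 => fN fR fO.
have [A2 C2 U2] : [/\ al s2 = None, na s2 aCnt 0 = size Q' & ob s2 = [::]].
  by have [-> ->] := fO isT; rewrite fN //= C0 cE addn1 sQ.
clearbody s2; rewrite sQ /= => -[old [low BL HL PL] fr].
have jQ (i : 'I_(size Q')) : i != size Q :> nat -> (i < size Q)%N.
  by move=> ne; rewrite ltn_neqAle ne -ltnS -sQ ltn_ord.
have same : same_upto (size Q) (abst Q s) (abst Q' s2).
  move=> k ne /=; rewrite sQ ltnS leq_eqVlt (negbTE ne) /=.
  case: ifP => kQ //; have kQ' : (k < (size Q).+1)%N by rewrite ltnW.
  by have [e1 e2 _ e4] := old (Ordinal kQ') ne; rewrite e1 e2 e4 /s1 /= P0 L0 H0.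
have svj (Y : {set 'I_n}) k : (k < size Q)%N -> svn G Q' Y k = svn G Q Y k.
  by move=> kQ; rewrite Q'E svn_cat.
have jlt : (size Q < size Q')%N by rewrite sQ.
have fre : fresh Q' (size Q) t (abst Q' s2) by split=> /=; rewrite jlt.
have ba2 : base G Q' (size Q') (abst Q' s2).
  have [b1 b2 b3 b4] := ba; split=> //; first by move=> i /= /andP[].
    move=> i pi; case: (eqVneq i (size Q)) => [ie|ne].
      by have [_ _ pE _] := fre; rewrite ie in pi *; rewrite -pE.
    have [e1 e2 _] := same _ ne; rewrite e2 svj; first by apply: b3; rewrite -e1.
    by apply: b1; rewrite -e1.
  move=> i pi; case: (eqVneq i (size Q)) => [ie|ne].
    have [low' _ pE _] := fre; rewrite ie in pi *; rewrite pE in pi.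
    by have [_ hy] := low_heavy low'; exact: hy.
  by have [e1 e2 _] := same _ ne; rewrite e2; apply: b4; rewrite -e1.
have cs2 l : csm Q' s2 t l <= chain l.
  rewrite /csm; apply: (@le_trans _ _ (csum Q' (abst Q s) t l)).
    rewrite /csum big_mkcond [leRHS]big_mkcond; apply: ler_sum => i _.
    case: (eqVneq (i : nat) (size Q)) => [->|ne].
      case: ifP => [_|_]; last by case: ifP => // _; exact: res_ge0.
      by rewrite /res /= jlt HL maxxx subrr ltnn /=.
    by have [-> -> hE] := same _ ne; case: ifP => // _; rewrite /res hE.
  rewrite Q'E csum_cat; last by move=> i /andP[].
  (* The arrival precedes the pending alarm, so unpaid delays are at most what they would be at the
     time of that alarm. *)
  move: alm rt; case: ifP => [_ [t1 [-> _ _ cs]] tt|no _ _].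
    apply: le_trans (cs l); rewrite /csm /csum; apply: ler_sum => i _.
    by rewrite /res lerD2r ge_max !le_max lexx (dl_mono _ _ tt) orbT.
  rewrite /csum big_pred0 ?chain_ge0 // => i; rewrite /= ltn_ord.
  apply/negbTE/negP => /andP[/= pi _]; move/negbT: no.
  by rewrite negb_exists => /forallP/(_ i); rewrite pi.
have relE k : (k < size Q)%N -> rel Q' k = rel Q k.
  by move=> kQ; rewrite Q'E rel_cat.
have rn2 (i : 'I_(size Q')) : rel Q' i <= t.
  case: (eqVneq (i : nat) (size Q)) => [->|/jQ iQ].
    by rewrite /rel Q'E onth_cat ltnn subnn.
  by rewrite relE // (le_trans (rn (Ordinal iQ))).
have BE2 (i : 'I_(size Q')) : na s2 aPend i != 0%N -> ra s2 rB i = chain (na s2 aLev i).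
  case: (eqVneq (i : nat) (size Q)) => [->//|ne].
  have iQ := jQ _ ne; have kQ' : (i < (size Q).+1)%N by rewrite ltnW.
  have [-> -> -> _] := old (Ordinal kQ') ne; rewrite /s1 /= P0 L0 B0.
  exact: (BE (Ordinal iQ)).
have [|//|kp fin] := @next_alarm_spec _ _ G Q' t s2 rn2.
  by move=> i pi; split; rewrite BE2 //; exact: base_chain_gt0 ba2 pi.
have [e1 e2 e3 _ e5] := kp; have ab := keep_abst Q' kp.
rewrite /good ab; split=> //; last by rewrite den_mute.
split=> //; rewrite ?e5 //.
- by move=> i; rewrite e1 e2 e3; exact: BE2.
- move: fin; rewrite e1 e2; case: ifP => _ //; last by rewrite A2.
  by rewrite /csm ab.
Qed.

End Events.

(** * The whole run *)

Definition algorithm : cmd := CSeq (cP prologue) (cP main).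

Definition event_time (m : nat) : nat := (tm prologue m + tm main m).+1.

Section Run.
Variables (R : realType) (n : nat) (G : wgraph R n).
Notation chain := (chain G).
Implicit Types (s : hstate R n) (v : 'I_n) (X Y : {set 'I_n}) (Q : seq (request R n)).

Lemma event_exec Q now st s m : (0 < m)%N -> (n <= m)%N -> (size Q <= m)%N -> sim st s ->
  exists st' k, [/\ exec G Q now (wake st) algorithm st' k, (k <= event_time m)%N &
    sim st' (event G Q now s)].
Proof.
move=> m0 nm Qm [h1 h2 h3 h4]; have ss : sim (wake st) (waked s) by split.
have r0 : rowok false (waked s) by [].
have [st1 [k1 [x1 b1 s1]]] := sim_den G now m0 nm Qm ss r0 ok_prologue.
have r1 : rowok true (den G Q now prologue (waked s)) by move=> _; exact: prologue_tab.
have [st2 [k2 [x2 b2 s2]]] := sim_den G now m0 nm Qm s1 r1 ok_main.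
exists st2, (k1 + k2).+1; split=> //; first exact: ExecSeq x1 x2.
by rewrite /event_time ltnS leq_add.
Qed.

Lemma serv_rel_cat Q F t a a' X l u oc : (forall i, pd a i -> (i < size Q)%N) ->
  serv_rel G Q t a a' X l u oc -> serv_rel G (Q ++ F) t a a' X l u oc.
Proof.
move=> pQ [[h1 h1'] h2 [h3 h3'] h4 h5].
have eQ i : elig l a i -> (i < size Q)%N by move=> /andP[/pQ].
have cut (P : pred nat) (f g : nat -> R) : (forall i, P i -> (i < size Q)%N) ->
    (forall i, P i -> f i = g i) ->
    \sum_(i < size (Q ++ F) | P i) f i = \sum_(i < size Q | P i) g i.
  move=> PQ fg; rewrite -!(big_mkord P).
  rewrite (@big_cat_nat _ _ _ (size Q)) //= ?size_cat ?leq_addr //.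
  rewrite [X in _ + X]big_nat_cond [X in _ + X]big_pred0 ?addr0; last first.
    by move=> i; apply/negbTE/negP => /andP[/andP[h _] /PQ]; lia.
  by apply: eq_bigr => i /fg.
have cutY Y : \sum_(i < size (Q ++ F) | elig l a i && ~~ svn G (Q ++ F) Y i)
    (u i - Num.max (hh a i) (dl (Q ++ F) i t)) =
   \sum_(i < size Q | elig l a i && ~~ svn G Q Y i) (u i - Num.max (hh a i) (dl Q i t)).
  rewrite (cut (fun i => elig l a i && ~~ svn G (Q ++ F) Y i)
    (fun i => u i - Num.max (hh a i) (dl (Q ++ F) i t)) (fun i => u i - Num.max (hh a i) (dl Q i t))).
  - apply: eq_bigl => i; case: (boolP (elig l a i)) => //= /eQ iQ.
    by rewrite svn_cat.
  - by move=> i /andP[/eQ].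
  - by move=> i /andP[/eQ iQ _]; rewrite dl_cat.
split.
- by split=> //; rewrite csum_cat.
- move=> i; have := h2 i; case: ifP => // /eQ iQ.
  by rewrite svn_cat // dl_cat.
- by split=> //; rewrite cutY.
- by move=> i Ei; have := h4 i Ei; rewrite dl_cat // eQ.
- case: oc h5 => [tau|] h5.
    have [t1 t2 t3] := h5; split=> //.
      by move=> i Ei; rewrite !dl_cat ?eQ //; exact: t2.
    by move=> Y; rewrite cutY; exact: t3.
  by move=> i Ei; rewrite svn_cat ?eQ //; exact: h5.
Qed.

Lemma base_cat Q F m (a : astate R) : base G Q m a -> base G (Q ++ F) m a.
Proof.
move=> [h1 h2 h3 h4]; split=> //.
  by rewrite size_cat (leq_trans h2) ?leq_addr.
by move=> i pi; rewrite svn_cat ?h3 // (leq_trans (h1 _ pi)).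
Qed.

Lemma fresh_cat Q F j t (a : astate R) : (j < size Q)%N ->
  fresh G Q j t a -> fresh G (Q ++ F) j t a.
Proof.
move=> jQ [h1 h2 h3 h4]; split; rewrite ?svn_cat ?dl_cat //.
by move=> l; rewrite svn_cat //; exact: h1.
Qed.

(** A request still to come counts for its delay at release, so that an arrival leaves the total
    unchanged. *)
Definition acc Q m (a : astate R) i : R := if (i < m)%N then hh a i else dl Q i (rel Q i).

(** The right-hand side of [wt_bound]: all that can ever be charged to the offline schedule. *)
Definition weight Q (S : schedule R n) ts : R :=
  (lg n + 3)%:R * transmission_cost G S + \sum_(i < size Q) (od Q ts i - dl Q i (rel Q i)).

Definition answers Q (S : schedule R n) i x : Prop :=
  exists2 tr, tr \in S & [/\ rel Q i <= tr.1, svn G Q tr.2 i & dl Q i tr.1 <= x].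

(** A statement about the rest of a run, quantified over every offline schedule and every ghost
    state compatible with the present. It can thus be proved from the last event backwards; [hf]
    gives the final delays. *)
Definition ledger Q m now (a : astate R) (S : schedule R n) : Prop :=
  forall S0 ts, (forall i, (i < size Q)%N -> rel Q i <= ts i) ->
  (forall i, (i < size Q)%N -> exists tr, [/\ tr \in S0, tr.1 = ts i & svn G Q tr.2 i]) ->
  forall gh, ginv G Q S0 ts m now a gh ->
  exists hf, [/\ forall i, (i < m)%N -> hh a i <= hf i,
    forall i, (i < size Q)%N -> pd a i || (m <= i)%N -> answers Q S i (hf i) &
    transmission_cost G S + \sum_(i < size Q) (hf i - acc Q m a i) <=
      4 * (gam R n + 3) * (weight Q S0 ts - wt gh)].

Lemma ledger_idle Q now a : (forall i, ~~ pd a i) -> ledger Q (size Q) now a [::].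
Proof.
move=> np S0 ts tr tv gh gi; exists (hh a); split=> //.
  by move=> i iQ; rewrite (negbTE (np i)) leqNgt iQ.
rewrite /transmission_cost big_nil add0r big1; last first.
  by move=> i _; rewrite /acc ltn_ord subrr.
rewrite mulr_ge0 //; first by have := gam_gt0 R n; lra.
by rewrite subr_ge0; exact: wt_bound gi.
Qed.

Lemma ledger_arrival Q m now t a a' S : (m < size Q)%N -> now <= t -> rel Q m = t ->
  (forall i, pd a i -> (i < m)%N) -> same_upto m a a' -> fresh G Q m t a' ->
  ledger Q m.+1 t a' S -> ledger Q m now a S.
Proof.
move=> mQ nt rt pm same [low hm pE dead] led S0 ts tr tv gh gi.
have pdm : pd a' m.
  (* The offline schedule serves the request, so the graph connects its ends and the request did
     become pending. *)
  apply: dead; have [tr0 [_ _]] := tv m mQ; apply: svn_sub.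
  by apply/fintype.subsetP => v _; rewrite inE.
have gi' : ginv G Q S0 ts m.+1 t a' gh.
  have [[g1 g1'] g2 g3 g4 g5] := gi; split=> //.
  - by split=> //; exact: le_trans nt.
  - by move=> i /andP[mi iQ]; apply: g2; rewrite iQ ltnW.
  - move=> i pi; case: (eqVneq i m) => [->|ne]; last first.
      by have [e1 e2 e3] := same _ ne; rewrite e2 e3; apply: g3; rewrite -e1.
    have [|l1 l2] := g2 m; first by rewrite leqnn.
    split.
    + by apply: le_lt_trans l1; exact: g1.
    + by rewrite l2 hm rt.
    + by left; split; [rewrite hm rt|have [] := low_heavy low].
have [hf [f1 f2 f3]] := led S0 ts tr tv gh gi'.
exists hf; split.
- move=> i im; have ne : i != m by rewrite ltn_eqF.
  by have [_ _ <-] := same _ ne; apply: f1; rewrite ltnW.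
- move=> i iQ; case: (eqVneq i m) => [->|ne]; first by move=> _; apply: f2; rewrite ?pdm.
  have [e1 _ _] := same _ ne => h; apply: f2 => //; rewrite e1.
  by move: h; rewrite leq_eqVlt eq_sym (negbTE ne).
- have aE i : acc Q m.+1 a' i = acc Q m a i.
    rewrite /acc ltnS leq_eqVlt; case: (eqVneq i m) => [->|ne] /=.
      by rewrite ltnn hm rt.
    by have [_ _ ->] := same _ ne.
  by under eq_bigr do rewrite -aE.
Qed.

(** [charge] raises [wt] by half a budget, and [serv_cost] bounds the service by [4 * (gam + 3)]
    times as much. *)
Lemma ledger_alarm Q m now t a a' X l u oc S : base G Q m a -> now <= t ->
  (forall i, (i < m)%N -> rel Q i <= t) ->
  (forall i, (m <= i < size Q)%N -> t < rel Q i) ->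
  (forall l, csum Q a t l <= chain l) ->
  serv_rel G Q t a a' X l u oc -> ledger Q m t a' S -> ledger Q m now a ((t, X) :: S).
Proof.
move=> ba nt pst fut cs sr led S0 ts tr tv gh gi.
have [gh' [gi' wE]] := charge tr tv ba gi nt fut sr.
have [hf [f1 f2 f3]] := led S0 ts tr tv gh' gi'.
have [_ st _ gu _] := sr; have [pm mQ _ _] := ba.
have hl i : hh a i <= hh a' i.
  have := st i; case: ifP => [Ei|_ [_ _ -> //]].
  case: ifP => [_ [_ ->]|_ [_ _ ->]]; first by rewrite le_max lexx.
  by apply: le_trans (gu i Ei); rewrite le_max lexx.
exists hf; split.
- by move=> i im; apply: le_trans (hl i) (f1 i im).
- move=> i iQ; case: (boolP (pd a' i || (m <= i)%N)) => [p' _|].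
    have [tr1 t1 t2] := f2 i iQ p'; exists tr1 => //.
    by rewrite inE t1 orbT.
  rewrite negb_or => /andP[np' im] pi.
  have {}pi : pd a i by move: pi; rewrite (negbTE im) orbF.
  have := st i; case: ifP => [Ei|_ [e _ _]]; last by rewrite e pi in np'.
  case: ifP => [sX [_ hE]|_ [e _ _]]; last by rewrite e in np'.
  exists (t, X); first by rewrite inE eqxx.
  split=> //=; first by apply: pst; exact: pm.
  apply: le_trans (f1 i (pm i pi)); by rewrite hE le_max lexx orbT.
- have sc := serv_cost ba sr cs.
  have aE : \sum_(i < size Q) (hf i - acc Q m a i) =
      \sum_(i < size Q) (hf i - acc Q m a' i) + \sum_(i < size Q) (hh a' i - hh a i).
    rewrite -big_split; apply: eq_bigr => i _ /=; rewrite /acc; case: ltnP => im; first by ring.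
    have := st i; case: ifP => [/andP[/pm]|_ [_ _ ->]]; first by rewrite ltnNge im.
    by rewrite subrr addr0.
  rewrite aE /transmission_cost big_cons /= -/(transmission_cost G S).
  move: f3 sc; rewrite wE.
  set z1 := transmission_cost G S; set z2 := \sum_(v in X) _; set z3 := \sum_(i < _) (hf _ - _).
  set z4 := \sum_(i < _) (hh _ _ - _); set w := weight _ _ _.
  move: z1 z2 z3 z4 w (wt gh) (chain l) (gam R n) => z1 z2 z3 z4 w z5 z6 g h1 h2.
  have -> : 4 * (g + 3) * (w - z5) = 4 * (g + 3) * (w - (z5 + z6 / 2)) + 4 * (g + 3) * (z6 / 2) by field.
  lra.
Qed.

End Run.

Section Run.
Variables (R : realType) (n : nat) (G : wgraph R n).
Notation chain := (chain G).
Implicit Types (s : hstate R n) (v : 'I_n) (X Y : {set 'I_n}) (Q past future : seq (request R n)).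

(** Bounds the moves left to a request: rising one level, or being served, whence the extra unit. A
    service at level [l] makes a request of level [l] move. *)
Definition lives (a : astate R) i : nat := if pd a i then ((Lm n).+1 - lv a i)%N else 0%N.

Lemma lives_serv Q m t a a' X l u oc : base G Q m a -> serv_rel G Q t a a' X l u oc ->
  (\sum_(i < m) lives a' i < \sum_(i < m) lives a i)%N.
Proof.
move=> ba sr; have [_ lL] := serv_double ba sr; have [pm _ _ _] := ba.
have [[[i0 [p0 l0]] _] st _ _ _] := sr.
have le i : (lives a' i <= lives a i)%N.
  rewrite /lives; have := st i; case: ifP => [/andP[-> li]|_ [-> -> _] //].
  by case: ifP => [_ [-> //]|_ [-> -> _]]; lia.
rewrite (bigD1 (Ordinal (pm i0 p0))) //= [ltnRHS](bigD1 (Ordinal (pm i0 p0))) //=.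
rewrite -addSn; apply: leq_add; last by apply: leq_sum => i _; exact: le.
rewrite /lives; have := st i0; rewrite /elig p0 l0 leqnSn /=.
by case: ifP => [_ [-> _]|_ [-> -> _]]; lia.
Qed.

Lemma lives_arrival m a a' : same_upto m a a' ->
  (\sum_(i < m.+1) lives a' i <= \sum_(i < m) lives a i + (Lm n).+1)%N.
Proof.
move=> same; rewrite big_ord_recr /=; apply: leq_add; last first.
  by rewrite /lives; case: ifP => // _; exact: leq_subr.
apply: leq_sum => i _; have ne : (i : nat) != m by rewrite ltn_eqF.
by have [e1 e2 _] := same _ ne; rewrite /lives e1 e2.
Qed.

(** Bounds the events left: a request to come brings one arrival and at most [(Lm n).+1] alarms. *)
Definition rounds past future s : nat :=
  (size future * (Lm n).+2 + \sum_(i < size past) lives (abst past s) i)%N.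

Variables (m0 : nat).
Hypotheses (m0_gt0 : (0 < m0)%N) (n_m0 : (n <= m0)%N).

Lemma good_idle Q now s : good G Q now s -> al s = None -> forall i, ~~ pd (abst Q s) i.
Proof.
move=> [_ _ _ _ h] e i; move: h; case: ifP => [_ [t []]|no _]; first by rewrite e.
apply/negP => /andP[iQ pi]; move/negbT: no.
by rewrite negb_exists => /forallP/(_ (Ordinal iQ)); rewrite pi.
Qed.

Lemma sorted_after q (F : seq (request R n)) (t : R) : sorted (@in_order R n) (q :: F) ->
  t < release q -> forall i, (i < size (q :: F))%N -> t < rel (q :: F) i.
Proof.
move=> /= ; elim: F q => [|q' F IH] q /=; first by move=> _ tq [|i].
by move=> /andP[qq' pF] tq [|i] // iF; apply: (IH q') => //; apply: lt_le_trans qq'.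
Qed.

(** Existence of the run, time and cost are proved together, as each event starts from the state
    left by the previous one. The induction is on a strict bound on [rounds]. *)
Lemma run_ledger mu past future st s now : (size (past ++ future) <= m0)%N ->
  sorted (@in_order R n) future -> (if future is q :: _ then now <= release q else true) ->
  sim st s -> good G past now s -> (rounds past future s < mu)%N ->
  exists S k, [/\ run G algorithm past future st S k,
    (k <= rounds past future s * event_time m0)%N &
    ledger G (past ++ future) (size past) now (abst past s) S].
Proof.
elim: mu past future st s now => // mu IH past future st s now Qm srt nf ss gd mle.
have pm : (size past <= m0)%N by apply: leq_trans Qm; rewrite size_cat leq_addr.
have [_ _ sa _] := ss; have [_ ba _ rn _] := gd.
have alarmed t : al s = Some t -> (if future is q :: _ then t < release q else true) ->
    exists S k, [/\ run G algorithm past future st S k,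
    (k <= rounds past future s * event_time m0)%N &
    ledger G (past ++ future) (size past) now (abst past s) S].
  move=> at_t tf; have [nt gd' cs [X [l [u [oc [sr U1]]]]]] := alarm_event gd at_t.
  have [st1 [k1 [x1 b1 s1]]] := event_exec G t m0_gt0 n_m0 pm ss.
  have ml : (rounds past future (event G past t s) < rounds past future s)%N.
    by rewrite /rounds ltn_add2l; exact: lives_serv ba sr.
  have tf' : is_true (if future is q :: _ then t <= release q else true).
    by move: tf; case: (future) => // q F /ltW.
  have [S [k [r1 k2 led]]] := IH past future st1 _ t Qm srt tf' s1 gd' (leq_trans ml mle).
  exists (stamp t (outbox st1) ++ S), (k1 + k)%N; split.
  - by apply: RunAlarm r1 => //; rewrite sa.
  - apply: leq_trans (leq_add b1 k2) _; rewrite -mulSn leq_mul2r.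
    by apply/orP; right.
  - have [_ _ _ ->] := s1; rewrite U1.
    apply: (@ledger_alarm _ _ G _ (size past) now t (abst past s) _ X l u oc S) => //.
    + exact: base_cat.
    + by move=> i im; rewrite rel_cat // (le_trans (rn (Ordinal im))).
    + move=> i /andP[mi iQ]; move: iQ; rewrite /rel onth_cat [(i < size past)%N]ltnNge mi size_cat /=.
      move: srt tf; case: (future) => [|q F] srt tf; first by rewrite addn0 ltnNge mi.
      by move=> h; apply: (sorted_after srt tf); rewrite ltn_subLR.
    + by move=> l'; rewrite csum_cat // => i /andP[].
    + by apply: serv_rel_cat sr => i /andP[].
    + exact: led.
have none_idle : al s = None -> future = [::] -> exists S k, [/\ run G algorithm past future st S k,
    (k <= rounds past future s * event_time m0)%N &
    ledger G (past ++ future) (size past) now (abst past s) S].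
  move=> an ->; exists [::], 0%N; split=> //; first by apply: RunIdle; rewrite sa.
  by rewrite cats0; apply: ledger_idle; exact: good_idle gd an.
case fE: future => [|q F]; rewrite -fE.
  case e: (al s) => [t1|]; first by apply: alarmed e _; rewrite fE.
  exact (none_idle e fE).
case: (boolP (if al s is Some t then release q <= t else true)) => [rt|]; last first.
  by case e: (al s) => [t|//]; rewrite -ltNge => lt; apply: alarmed e _; rewrite fE.
rewrite fE in srt nf Qm mle *; have [gd' U1 same fr] := arrival_event gd nf rt.
have pq : (size (rcons past q) <= m0)%N by apply: leq_trans Qm; rewrite size_rcons size_cat /= -addSnnS leq_addr.
have [st1 [k1 [x1 b1 s1]]] := event_exec G (release q) m0_gt0 n_m0 pq ss.
have ml : (rounds (rcons past q) F (event G (rcons past q) (release q) s) < rounds past (q :: F) s)%N.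
  have := lives_arrival same; rewrite /rounds size_rcons [size (_ :: _)]/= mulSn.
  by move=> h; rewrite -addnA [X in (X < _)%N]addnC -addSn; lia.
have Qm' : (size (rcons past q ++ F) <= m0)%N by rewrite cat_rcons.
have [|S [k [r1 k2 led]]] := IH _ F st1 _ (release q) Qm' (path_sorted srt) _ s1 gd' (leq_trans ml mle).
  by move: srt; case: (F) => //= q' F' /andP[].
exists (stamp (release q) (outbox st1) ++ S), (k1 + k)%N; split.
- by apply: RunArrival r1 => //; rewrite sa.
- apply: leq_trans (leq_add b1 k2) _; rewrite -mulSn leq_mul2r.
  by apply/orP; right.
- have [_ _ _ ->] := s1; rewrite U1 /=; rewrite cat_rcons size_rcons in led.
  apply: ledger_arrival led => //.
  + by rewrite size_cat /= -addSnnS leq_addr.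
  + by rewrite /rel onth_cat ltnn subnn.
  + by move=> i /andP[].
  + by rewrite -cat_rcons; apply: fresh_cat fr; rewrite size_rcons.
Qed.

End Run.

(** * Comparison with the optimum *)

Section Final.
Variables (R : realType) (n : nat) (G : wgraph R n).
Implicit Types (Q : seq (request R n)) (q : request R n) (S : schedule R n).

Definition all_zero : hstate R n := HState (fun _ _ => 0%N) (fun _ _ => 0) None [::].

Lemma run_start Q : sorted (@in_order R n) Q -> exists S k now,
  [/\ run G algorithm [::] Q (init_state R n) S k,
    (k <= size Q * (Lm n).+2 * event_time (n + size Q).+1)%N,
    ledger G Q 0 now (abst [::] all_zero) S & forall i, (i < size Q)%N -> now < rel Q i].
Proof.
move=> srt; pose now := if Q is q :: _ then release q - 1 else 0.
have rE : rounds [::] Q all_zero = (size Q * (Lm n).+2)%N.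
  by rewrite /rounds big_ord0 addn0.
have gd : good G [::] now all_zero.
  split=> //=; [by move=> i; have := ltn_ord i|by case: ifP => // /existsP[i]; have := ltn_ord i].
have ss : sim (init_state R n) all_zero by [].
have nf : is_true (if Q is q :: _ then now <= release q else true).
  by rewrite /now; case: (Q) => // q F; rewrite lerBlDr lerDl.
have [] := @run_ledger R n G (n + size Q).+1 isT _ _ [::] Q _ _ _ _ srt nf ss gd (ltnSn _).
- by rewrite ltnW // ltnS leq_addr.
- by rewrite /= ltnW // ltnS leq_addl.
move=> S [k [r1 k1 led]]; exists S, k, now; split=> //; first by rewrite -rE.
move: srt; rewrite /now; case: (Q) => // q F srt i iF.
by apply: sorted_after iF => //; rewrite ltrBlDr ltrDl.
Qed.

Lemma service_time_le S q tr : tr \in S -> serves G tr q -> (service_time G S q <= tr.1%:E)%E.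
Proof.
rewrite /service_time; elim: S => //= tr' S IH; rewrite inE big_cons => /orP[/eqP<- ->|trS sq].
  by rewrite ge_min lexx.
by case: ifP => _; rewrite ?ge_min IH ?orbT.
Qed.

Lemma service_timeP S q :
  service_time G S q = +oo%E \/
  exists2 tr, tr \in S & serves G tr q /\ service_time G S q = tr.1%:E.
Proof.
rewrite /service_time; elim: S => /= [|tr S IH]; first by left; rewrite big_nil.
rewrite big_cons; case: ifP => sq; last first.
  case: IH => [->|[tr' t1 t2]]; first by left.
  by right; exists tr' => //; rewrite inE t1 orbT.
right; case: (leP tr.1%:E (\big[mine/+oo%E]_(tr <- S | serves G tr q) tr.1%:E)%E) => h.
  by exists tr; rewrite ?inE ?eqxx.
case: IH => [e|[tr' t1 t2]]; first by rewrite e ltNge leey in h.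
by exists tr' => //; rewrite inE t1 orbT.
Qed.

Lemma answers_cost Q S (i : 'I_(size Q)) x : answers G Q S i x ->
  (delay_cost G S (tnth (in_tuple Q) i) <= x%:E)%E.
Proof.
rewrite /answers /rel /svn /dl onthQ /=; set q := tnth _ _ => -[tr trS [rt st dx]].
have sv : serves G tr q by rewrite /serves rt.
have le := service_time_le trS sv; rewrite /delay_cost.
case: (service_timeP S q) => [e|[tr' _ [sv' e]]]; first by rewrite e leye_eq in le.
rewrite e in le *; rewrite lee_fin (le_trans _ dx) // /delay_at (max_idPr rt).
by apply: delay_le => //; case/andP: sv'.
Qed.

Lemma delay_cost_ge0 S q : (0 <= delay_cost G S q)%E.
Proof.
rewrite /delay_cost; case: (service_timeP S q) => [->|[tr _ [/andP[rt _] ->]]] //.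
by rewrite lee_fin (le_trans (delay_ge0 q)) // delay_le.
Qed.

Lemma total_cost_seq Q S : total_cost G Q S =
  ((transmission_cost G S)%:E + \sum_(i < size Q) delay_cost G S (tnth (in_tuple Q) i))%E.
Proof. by rewrite /total_cost [in LHS](big_tnth _ _ Q). Qed.

Definition competitive_ratio : R := 4 * (gam R n + 3) * (lg n + 3)%:R.

Lemma competitive_ratio_gt0 : 0 < competitive_ratio.
Proof. by rewrite /competitive_ratio mulr_gt0 ?mulr_gt0 ?ltr0n ?addnS //; have := gam_gt0 R n; lra. Qed.

Lemma cost_le Q now S S0 : ledger G Q 0 now (abst [::] all_zero) S ->
  (forall i, (i < size Q)%N -> now < rel Q i) ->
  (total_cost G Q S <= competitive_ratio%:E * total_cost G Q S0)%E.
Proof.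
move=> led fut; case: (ltP (total_cost G Q S0) +oo%E) => fin; last first.
  by rewrite leye_eq in fin; rewrite (eqP fin) gt0_muley ?lte_fin ?competitive_ratio_gt0 ?leey.
pose q (i : 'I_(size Q)) := tnth (in_tuple Q) i.
have dfin i : (delay_cost G S0 (q i) < +oo)%E.
  apply: le_lt_trans fin; rewrite total_cost_seq (bigD1 i) //= addeCA leeDl //.
  apply: adde_ge0; last by apply: sume_ge0 => j _; exact: delay_cost_ge0.
  by rewrite lee_fin; apply: sumr_ge0 => tr _; apply: sumr_ge0 => v _; exact: c_ge0.
have sfin i : exists2 tr, tr \in S0 & serves G tr (q i) /\ delay_cost G S0 (q i) = (delay (q i) tr.1)%:E.
  have := dfin i; rewrite /delay_cost; case: (service_timeP S0 (q i)) => [->|[tr t1 [t2 ->]] _].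
    by rewrite ltxx.
  by exists tr.
pose ts (k : nat) : R := if insub k is Some i then fine (service_time G S0 (q i)) else 0.
have tsE (i : 'I_(size Q)) : exists2 tr, tr \in S0 & [/\ serves G tr (q i), ts i = tr.1 &
    delay_cost G S0 (q i) = (delay (q i) tr.1)%:E].
  rewrite /ts valK; have := dfin i; rewrite /delay_cost.
  case: (service_timeP S0 (q i)) => [->|[tr t1 [t2 ->]] _]; first by rewrite ltxx.
  by exists tr.
have tr i : (i < size Q)%N -> rel Q i <= ts i.
  move=> iQ; have [x _ [/andP[r1 _] e _]] := tsE (Ordinal iQ); rewrite /= in e.
  by rewrite e (_ : rel Q i = release (q (Ordinal iQ))) // /rel (onthQ (Ordinal iQ)).
have tv i : (i < size Q)%N -> exists tr, [/\ tr \in S0, tr.1 = ts i & svn G Q tr.2 i].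
  move=> iQ; have [x xS [/andP[_ r1] e _]] := tsE (Ordinal iQ); rewrite /= in e.
  by exists x; rewrite e /svn (onthQ (Ordinal iQ)).
(* At the start nothing is charged, there is no certificate, and the last service at each level is
   dated before the first release. *)
pose gh := Ghost (fun=> now) (fun i => dl Q i (rel Q i)) (fun=> None) 0.
have od_ge (i : 'I_(size Q)) : dl Q i (rel Q i) <= od Q ts i.
  by apply: dl_mono; exact: tr.
have gi : ginv G Q S0 ts 0 now (abst [::] all_zero) gh.
  split=> //=.
    by move=> i /fut.
  rewrite big1 // addr0; apply: addr_ge0.
    apply: sumr_ge0 => l _; apply: sumr_ge0 => x _; apply: sumr_ge0 => v _.
    by apply: trc_ge0; exact: chain_ge0.
  by apply: sumr_ge0 => i _; rewrite min_l ?subrr.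
have [hf [_ f2 f3]] := led S0 ts tr tv gh gi.
have costS0 : total_cost G Q S0 = (transmission_cost G S0 + \sum_(i < size Q) od Q ts i)%:E.
  rewrite total_cost_seq EFinD -[X in _ = (_ + X)%E]sumEFin; congr (_ + _)%E; apply: eq_bigr => i _.
  have [x _ [/andP[r1 _] e ->]] := tsE i.
  by rewrite /od /dl onthQ /= e /delay_at (max_idPr r1).
apply: (@le_trans _ _ ((transmission_cost G S + \sum_(i < size Q) hf i)%:E)).
  rewrite total_cost_seq EFinD -[X in (_ <= _ + X)%E]sumEFin leeD2l //; apply: lee_sum => i _.
  by apply: answers_cost; apply: f2; rewrite ?ltn_ord.
rewrite costS0 -EFinM lee_fin.
have d0 (i : 'I_(size Q)) : 0 <= dl Q i (rel Q i).
  by rewrite /dl /rel onthQ /= /delay_at maxxx delay_ge0.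
move: f3; rewrite /weight /gh /= subr0 /acc !sumrB /=.
have : 0 <= \sum_(i < size Q) dl Q i (rel Q i) by apply: sumr_ge0 => i _; exact: d0.
have : \sum_(i < size Q) dl Q i (rel Q i) <= \sum_(i < size Q) od Q ts i.
  by apply: ler_sum => i _.
have : 0 <= transmission_cost G S0.
  by apply: sumr_ge0 => x _; apply: sumr_ge0 => v _; exact: c_ge0.
have := gam_gt0 R n; have : 3 <= (lg n + 3)%:R :> R by rewrite ler_nat leq_addl.
rewrite /competitive_ratio; set D := \sum_(i < _) dl _ _ _; set O := \sum_(i < _) od _ _ _.
set H := \sum_(i < _) hf _; move: (transmission_cost G S) (transmission_cost G S0) D O H.
move: ((lg n + 3)%:R : R) (gam R n) => L g T T0 D O H L3 g0 T00 DO D0 le.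
have c3 : 0 < 4 * (g + 3) - 1 by lra.
have h1 : 0 <= (4 * (g + 3) - 1) * D by rewrite mulr_ge0 // ltW.
have h2 : 0 <= 4 * (g + 3) * (L - 1) * O.
  by rewrite !mulr_ge0 //; lra.
(* The ledger only compares the delays in excess of [D], the delay at release that both sides pay;
   factors at least 1 absorb [D]. *)
rewrite -subr_ge0; have -> : 4 * (g + 3) * L * (T0 + O) - (T + H) =
  (4 * (g + 3) * (L * T0 + (O - D)) - (T + (H - D))) + (4 * (g + 3) - 1) * D + 4 * (g + 3) * (L - 1) * O by ring.
by apply: addr_ge0 => //; apply: addr_ge0 => //; rewrite subr_ge0.
Qed.

Lemma cost_opt Q now S : ledger G Q 0 now (abst [::] all_zero) S ->
  (forall i, (i < size Q)%N -> now < rel Q i) ->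
  (total_cost G Q S <= competitive_ratio%:E * opt G Q)%E.
Proof.
move=> led fut; rewrite -lee_pdivrMl ?competitive_ratio_gt0 //; apply: le_ereal_inf_tmp => _ [S0 _ <-].
by rewrite lee_pdivrMl ?competitive_ratio_gt0 //; exact: cost_le led fut.
Qed.

End Final.

(** * Asymptotics and the polynomial time bound *)

Local Open Scope classical_set_scope.
Local Open Scope ring_scope.

(** Each new term [1 / (k + 2)] is at most [ln ((k + 2) / (k + 1))], by [ln (1 + x) <= x]. *)
Lemma harm_ln (R : realType) k : harm R k.+1 <= 1 + ln k.+1%:R.
Proof.
elim: k => [|k IH]; first by rewrite /harm big_ord1 invr1 ln1 addr0.
rewrite harmS; apply: (le_trans (lerD IH (lexx _))); rewrite -addrA lerD2l.
have k1 : 0 < k.+1%:R :> R by rewrite ltr0n.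
have k2 : 0 < k.+2%:R :> R by rewrite ltr0n.
have : ln (k.+1%:R / k.+2%:R) <= - (k.+2%:R)^-1 :> R.
  have -> : k.+1%:R / k.+2%:R = 1 + - (k.+2%:R)^-1 :> R.
    by rewrite -[k.+2%:R]natr1; field.
  by apply: le_ln1Dx; rewrite ltrN2 invf_lt1 // ltr1n.
by rewrite ln_div ?posrE // lerBlDl -lerBrDr.
Qed.

Lemma lg_ln (R : realType) k : (lg k.+1)%:R <= 2 + 2 * ln k.+1%:R :> R.
Proof.
rewrite /lg -natr1; set t := trunc_log _ _.
(* This crude bound suffices to pass from binary to natural logarithms. *)
have h2 : 2^-1 <= ln 2 :> R.
  have : ln (2^-1) <= - 2^-1 :> R.
    have -> : 2^-1 = 1 + - 2^-1 :> R by field.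
    by apply: le_trans (@le_ln1Dx _ _ _) _; lra.
  by rewrite lnV ?posrE // lerN2.
have : (2 ^ t <= 2 * k.+1)%N by apply: trunc_logP.
rewrite -(ler_nat R) natrX natrM => le.
have k0 : 0 < k.+1%:R :> R by rewrite ltr0n.
have {}le : ln 2 *+ t <= ln 2 + ln k.+1%:R :> R.
  by rewrite -lnXn // -lnM ?posrE // ler_ln ?posrE ?exprn_gt0 ?mulr_gt0.
have l0 : 0 <= ln (k.+1%:R) :> R by apply: ln_ge0; rewrite ler1n.
move: le; rewrite -[ln 2 *+ t]mulr_natr; move: (t%:R : R) (ln 2 : R) (ln k.+1%:R : R) h2 l0 => x y z h2 l0 h.
have : (x - 1) * y <= z by lra.
case: (lerP x 1) => x1 h3; first by lra.
have : (x - 1) * 2^-1 <= z by apply: le_trans h3; rewrite ler_pM2l // subr_gt0.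
lra.
Qed.

Lemma competitive_ratio_bigO (R : realType) : @competitive_ratio R =O_\oo (fun n : nat => ln (n%:R : R) ^+ 2).
Proof.
(* Once [ln n >= 1], [gam n + 3 <= 9 * ln n] and [lg n + 3 <= 7 * ln n]; and [252 = 4 * 9 * 7]. *)
apply/eqO_exP; exists 252 => //; near=> n.
have n3 : expR 1 <= n%:R :> R by near: n; exact: nbhs_infty_ger.
have n0 : (0 < n)%N by rewrite -(ltr0n R) (lt_le_trans _ n3) // expR_gt0.
have l1 : 1 <= ln (n%:R : R).
  by rewrite -[leLHS](expRK) ler_ln ?posrE ?expR_gt0 ?ltr0n.
have h1 : harm R n <= 1 + ln n%:R by rewrite -(prednK n0) harm_ln.
have h2 : (lg n)%:R <= 2 + 2 * ln n%:R :> R by rewrite -(prednK n0) lg_ln.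
have h0 := harm_ge0 R n; have g0 : 0 <= (lg n)%:R :> R by [].
rewrite !ger0_norm ?sqr_ge0 ?(ltW (competitive_ratio_gt0 _ _)) // /competitive_ratio /gam natrD.
move: (ln (n%:R : R)) (harm R n) ((lg n)%:R : R) l1 h1 h2 h0 g0 => x y z l1 h1 h2 h0 g0.
apply: (@le_trans _ _ (4 * (9 * x) * (7 * x))); last by rewrite expr2; lra.
by apply: ler_pM; lra.
Unshelve. all: by end_near. Qed.

Lemma event_time_poly : exists C d, forall m, (0 < m)%N -> (event_time m <= C * m ^ d)%N.
Proof.
have [C1 [d1 H1]] := tm_poly prologue; have [C2 [d2 H2]] := tm_poly main.
exists (C1 + C2 + 1)%N, (d1 + d2)%N => m m0; rewrite /event_time.
move: (H1 m m0) (H2 m m0); rewrite expnD.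
by have := expn_gt0 m d1; have := expn_gt0 m d2; rewrite m0 /=; nia.
Qed.

Theorem theorem5p3 (R : realType) :
  exists (P : cmd) (alpha : nat -> R),
    alpha =O_\oo (fun n : nat => ln (n%:R : R) ^+ 2) /\
    competitive P alpha /\
    polynomial_time R P.
Proof.
exists algorithm, (@competitive_ratio R); split; first exact: competitive_ratio_bigO.
split=> [n G Q srt|].
  have [S [k [now [r1 _ led fut]]]] := run_start G srt.
  by exists S, k; split=> //; exact: cost_opt led fut.
have [C [d H]] := event_time_poly.
(* With [m = n + size Q + 1], there are at most [6 * m ^ 3] events of at most [C * m ^ d] steps
   each. *)
exists ((C * 6)%:P * ('X + 1) ^+ (d + 3)) => n G Q srt.
have [S [k [now [r1 kT _ _]]]] := run_start G srt.
exists S, k; split=> //; apply: leq_trans kT _.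
set m := (n + size Q).+1; have mE : (n + size Q + 1 = m)%N by rewrite addn1.
have -> : ((C * 6)%:P * ('X + 1) ^+ (d + 3) : {poly nat}).[n + size Q] = (C * 6 * m ^ (d + 3))%N.
  by rewrite hornerM horner_exp !hornerE -mE natrXE.
have le1 : (size Q * (Lm n).+2 <= m * (6 * m ^ 2))%N.
  by apply: leq_mul; rewrite /m /Lm; nia.
apply: leq_trans (leq_mul le1 (H m isT)) _.
by rewrite expnD leq_eqVlt; apply/orP; left; apply/eqP; ring.
Qed.
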